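(* Let $d\ge1$, $\alpha\in(0,1)\cup(1,2]$, and let $X$ be an $\mathbb R^d$-valued random variable with $\mathbb E|X|^2=\infty$ which is nondegenerate and regularly varying with index $-\alpha$. Let $S_n=X_1+\dots+X_n$ where the $X_i$ are independent copies of $X$, and let $\tilde\ell$, $a_n$, $b_n$ be as defined in the context. Then for every $h>0$ there is a constant $C>0$ such that \[ \mathbb P\big(S_n-b_n\in\Pi_h(x)\big)\le C\,\frac{n}{a_n^d}\,\frac{\tilde\ell(|x|)}{1+|x|^\alpha}\qquad\text{for all } n\ge1,\ x\in\mathbb R^d. \]
   Context: $|\cdot|$ is the Euclidean norm on $\mathbb R^d$, $\mathbb S^{d-1}=\{x\in\mathbb R^d:|x|=1\}$, and $\Pi_h(x)=\prod_{j=1}^d(x_j-h,x_j+h]$ for $x\in\mathbb R^d$, $h>0$. $X$ is regularly varying with index $-\alpha$ if there is a Borel probability measure $\sigma$ on $\mathbb S^{d-1}$ such that \[ \lim_{t\to\infty}\frac{\mathbb P(|X|>\lambda t,\ X/|X|\in A)}{\mathbb P(|X|>t)}=\lambda^{-\alpha}\sigma(A) \] for all $\lambda>0$ and all Borel sets $A\subset\mathbb S^{d-1}$ with $\sigma(\partial A)=0$. It is nondegenerate if $\int_{\mathbb S^{d-1}}|u\cdot\theta|^\alpha\,d\sigma(\theta)>0$ for all $u\in\mathbb S^{d-1}$. Then there is a continuous slowly varying function $\ell:[0,\infty)\to(0,\infty)$ with $\mathbb P(|X|>t)=(1+o(1))\,t^{-\alpha}\ell(t)$ as $t\to\infty$;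 fix such an $\ell$. Set $\tilde\ell=\ell$ if $\alpha<2$ and $\tilde\ell(x)=1+\int_1^{1+x}\frac{\ell(u)}{u}\,du$ if $\alpha=2$. The sequence $a_n>0$ satisfies $\lim_{n\to\infty}n\tilde\ell(a_n)/a_n^\alpha=1$. Set $b_n=0$ if $\alpha\in(0,1)$ and $b_n=n\,\mathbb E X$ if $\alpha\in(1,2]$. *)

(* Defs.v *)
From HB Require Import structures.
From mathcomp Require Import all_boot all_order all_algebra finmap.
From mathcomp Require Import all_classical all_reals all_analysis.

Import Order.TTheory GRing.Theory Num.Theory.
Import numFieldNormedType.Exports.

Local Open Scope classical_set_scope.
Local Open Scope ring_scope.

(* Row vectors equipped with their Borel sigma-algebra (the topology of the
   library's sup norm on 'rV[R]_d is the Euclidean one).  The type is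
   convertible to 'rV[R]_d. *)
Notation borel_rV R d := (g_sigma_algebraType (@open 'rV[R]_d)).

Section Euclidean.
Context {R : realType} {d : nat}.
Implicit Types x y : 'rV[R]_d.

Definition edot x y : R := \sum_(j < d) x ord0 j * y ord0 j.

(* The canonical `|x| on 'rV[R]_d is the sup norm, hence a separate name. *)
Definition enorm x : R := Num.sqrt (\sum_(j < d) x ord0 j ^+ 2).

Definition unit_sphere : set 'rV[R]_d := [set x | enorm x = 1].

(* Boundary of A relative to the sphere; since the sphere is closed, closures
   of its subsets relative to it and in 'rV[R]_d agree. *)
Definition sphere_boundary (A : set 'rV[R]_d) : set 'rV[R]_d :=
  closure A `&` closure (unit_sphere `\` A).

Definition cube (h : R) x : set 'rV[R]_d :=
  [set y : 'rV[R]_d | forall j, x ord0 j - h < y ord0 j <= x ord0 j + h].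

End Euclidean.

Section RandomElements.
Context {disp disp' : measure_display} {T : measurableType disp}
  {E : measurableType disp'} {R : realType}.
Variable P : probability T R.

Definition mutually_independent {I : choiceType} (Y : I -> {RV P >-> E}) :=
  forall (J : {fset I}) (A : I -> set E),
    (forall j, j \in J -> measurable (A j)) ->
    (P (\bigcap_(j in [set` J]) (Y j @^-1` A j)) =
     \prod_(j <- J) P (Y j @^-1` A j))%E.

Definition same_law (Y Z : {RV P >-> E}) :=
  forall A, measurable A -> distribution P Y A = distribution P Z A.

Definition independent_copies (X : {RV P >-> E}) (Y : nat -> {RV P >-> E}) :=
  mutually_independent Y /\ forall i, same_law (Y i) X.

End RandomElements.

Definition slowly_varying {R : realType} (l : R -> R) :=
  forall lambda, 0 < lambda -> l (lambda * t) / l t @[t --> +oo] --> (1 : R).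

Section RegularVariation.
Context {disp : measure_display} {T : measurableType disp} {R : realType}
  {d : nat}.
Variable P : probability T R.

Definition tail_prob (X : {RV P >-> borel_rV R d}) (t : R) : R :=
  fine (P [set w | t < enorm (X w)]).

(* A Borel probability measure on the sphere is represented by a Borel
   probability measure on the whole space giving mass 1 to the sphere. *)
Definition on_sphere (sigma : probability (borel_rV R d) R) :=
  sigma unit_sphere = 1%E.

Definition regularly_varying (X : {RV P >-> borel_rV R d}) (alpha : R)
    (sigma : probability (borel_rV R d) R) :=
  on_sphere sigma /\
  forall (lambda : R) (A : set (borel_rV R d)), 0 < lambda ->
    measurable A -> A `<=` unit_sphere -> sigma (sphere_boundary A) = 0%E ->
    fine (P [set w | lambda * t < enorm (X w) /\
                     A ((enorm (X w))^-1 *: (X w : 'rV[R]_d))]) / tail_prob X t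
      @[t --> +oo] --> lambda `^ (- alpha) * fine (sigma A).

Definition nondegenerate_spectral (alpha : R)
    (sigma : probability (borel_rV R d) R) :=
  forall u : 'rV[R]_d, unit_sphere u ->
    (0 < \int[sigma]_(theta in unit_sphere) (`|edot u theta| `^ alpha)%:E)%E.

(* Functions on [0, +oo[ are represented by functions on R whose values on
   the negative half-line are irrelevant. *)
Definition tail_slow_part (X : {RV P >-> borel_rV R d}) (alpha : R)
    (l : R -> R) :=
  [/\ {within `[0, +oo[, continuous l},
      forall t, 0 <= t -> 0 < l t,
      slowly_varying l &
      tail_prob X t / (t `^ (- alpha) * l t) @[t --> +oo] --> (1 : R)].

Definition tilde (alpha : R) (l : R -> R) (x : R) : R :=
  if alpha < 2 then l x
  else 1 + \int[lebesgue_measure]_(u in `[1, 1 + x]) (l u / u).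

Definition mean (X : {RV P >-> borel_rV R d}) : 'rV[R]_d :=
  \row_j fine ('E_P[fun w => (X w : 'rV[R]_d) ord0 j]).

(* For alpha > 1 regular variation makes X integrable, so that [mean] is the
   genuine expectation. *)
Definition centering (X : {RV P >-> borel_rV R d}) (alpha : R) (n : nat) :
    'rV[R]_d :=
  if alpha < 1 then 0 else n%:R *: mean X.

Definition partial_sum (Y : nat -> {RV P >-> borel_rV R d}) (n : nat) (w : T) :
    'rV[R]_d :=
  \sum_(i < n) (Y i w : 'rV[R]_d).

End RegularVariation.

(* Main.v *)
Require Import Defs.
From HB Require Import structures.
From mathcomp Require Import all_boot all_order all_algebra finmap.
From mathcomp Require Import all_classical all_reals all_analysis.
From mathcomp Require Import measurable_realfun.
From mathcomp Require Import ring lra zify.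
Import Order.TTheory GRing.Theory Num.Theory.
Import numFieldNormedType.Exports.
Local Open Scope classical_set_scope.
Local Open Scope ring_scope.

(** Everything is measured by V(y) = E min(|X|^2, y^2) / y^2.  Regular variation
makes V(y) comparable with L(y) / y^alpha, where L is the normalizing function,
for alpha < 2 and alpha = 2 alike (rate_equiv), and the choice of a_n then keeps
n V(a_n) bounded away from 0 (scale_large).  The bound to prove is therefore, for
large |x|, that the sum lands in the cube around x with probability at most
C a_n^-d n V(|x|).  It is the product of two estimates.

Large deviations (sum_tail): |S_n - b_n| >= y has probability at most C n V(y).
Summands larger than y are counted one by one; the truncated sum is controlled by
its first moment if alpha < 1 and by Chebyshev's inequality if alpha > 1, where
recentering costs no more than y V(y) per summand.

Concentration (concentration_bound): whatever happens to some of the summands,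
a positive proportion of the others makes the sum fall into a given cube with
conditional probability at most C a_n^-d.

If S_n - b_n is near x, one of the two halves of the sum is at distance at least
|x|/4 from its centre; the first estimate bounds the probability of that, and the
second one, applied to the other half, gives the factor a_n^-d (half_split).  For
bounded x concentration alone is enough.

Concentration is Fourier analysis on a finite lattice.  The squared modulus of an
average of exponentials with frequencies in a lattice cube of mesh of order 1/a_n
is nonnegative and at least 1/4 on the cube, so that the probability is at most an
average of powers |phi(t)|^m over differences t of lattice points
(list_sum_concentration).  Symmetrization gives 1 - |phi(t)|^2 >= c V(1/|t|)
(fourier_lower): by nondegeneracy and compactness of the sphere every large dyadic shell
of the law of X has a proportion of mass visible in every direction
(directional_mass_uniform), and these shells add up to a multiple of the
truncated second moment.  Hence |phi(t)|^m <= exp(- c n V(1/|t|)), and Potter's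
bound (potter_power) makes the sum over the lattice bounded.

Regular variation of the law is used only through the limit of the tail ratio under doubling
of the radius, in the whole space (tail_doubling) and in a cone (shell_ratio);
monotonicity and induction over doublings (doubling_ind, dominated_by_increments)
replace the uniform convergence and Karamata theorems. *)

(** * Elementary inequalities *)

Section Elementary.
Context {R : realType}.
Implicit Types (x y z u v : R).

Lemma sqr_le_of_norm u v : `|u| <= v -> u ^+ 2 <= v ^+ 2.
Proof. by rewrite ler_norml => /andP[? ?]; nra. Qed.

Lemma sin_chord v : exists2 xi, `|xi| <= `|v| & sin v = cos xi * v.
Proof.
wlog v0 : v / 0 < v => [wlog_pos|].
  have [v0|v0|->] := ltgtP v 0; last by exists 0; rewrite ?sin0 ?mulr0.
  - have [|xi xiv e] := wlog_pos (- v); first by rewrite oppr_gt0.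
    exists xi; first by rewrite normrN in xiv.
    by apply: oppr_inj; rewrite -sinN e mulrN.
  - exact: wlog_pos.
have [|xi] := @MVT R sin cos 0 v v0 (fun x _ => is_derive_sin x).
  by apply: continuous_subspaceT => x; exact: continuous_sin.
rewrite in_itv /= sin0 !subr0 => /andP[xi0 xiv] e.
by exists xi => //; rewrite !gtr0_norm // ltW.
Qed.

Lemma one_sub_cos u : 1 - cos u = 2 * sin (u / 2) ^+ 2.
Proof.
have -> : cos u = cos (u / 2 *+ 2) by congr cos; rewrite mulr2n; lra.
by rewrite cos_mulr2n sin2cos2; ring.
Qed.

Lemma cos_ge_parabola u : 1 - u ^+ 2 / 2 <= cos u.
Proof.
have [xi _ e] := sin_chord (u / 2).
have := one_sub_cos u; rewrite e => h.
have := sqr_le_of_norm _ _ (cos_max xi); rewrite expr1n.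
have := sqr_ge0 u; nra.
Qed.

Lemma cos_le_parabola u : `|u| <= 1 -> u ^+ 2 / 4 <= 1 - cos u.
Proof.
move=> u1; have [xi xiu e] := sin_chord (u / 2).
have xi1 : `|xi| <= 2^-1.
  by rewrite (le_trans xiu)// normrM (@ger0_norm _ 2^-1)// ler_piMl.
have := sqr_le_of_norm _ _ xi1.
have c1 := cos_ge_parabola xi => xi2.
rewrite one_sub_cos e exprMn.
have c34 : 3 / 4 <= cos xi by nra.
have : 9 / 16 <= cos xi ^+ 2 by nra.
have := sqr_ge0 u; nra.
Qed.

Lemma cos_ge_half u : `|u| <= 1 -> 2^-1 <= cos u.
Proof.
move=> u1; have := cos_ge_parabola u.
have := sqr_le_of_norm _ _ u1; rewrite expr1n.
lra.
Qed.

Lemma rotation_le c c' x : c * cos x + c' * sin x <= Num.sqrt (c ^+ 2 + c' ^+ 2).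
Proof.
rewrite (le_trans (ler_norm _))// -sqrtr_sqr ler_wsqrtr//.
rewrite -[leRHS]mulr1 -(cos2Dsin2 x).
by have := sqr_ge0 (c * sin x - c' * cos x); lra.
Qed.

(** This is 1 + v <= e^v at v = u / (p + 1), raised to the power p + 1. *)
Lemma expRN_le_powV p u : 0 < u -> expR (- u) <= (p.+1%:R / u) ^+ p.+1.
Proof.
move=> u0; rewrite expRN -[u in expR u](@divfK _ p.+1%:R)// expRM_natr -exprVn.
rewrite ler_pXn2r ?nnegrE ?invr_ge0 ?expR_ge0 ?divr_ge0 ?(ltW u0)//.
rewrite -[leRHS]invrK lef_pV2 ?posrE ?expR_gt0 ?invr_gt0 ?divr_gt0//.
by rewrite invf_div (le_trans _ (expR_ge1Dx _))// lerDr.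
Qed.

Lemma powR2N_lt (a b : R) : a < b -> 2 `^ (- b) < 2 `^ (- a) :> R.
Proof.
move=> ab; rewrite /powR !gt_eqF// ltr_expR ltr_pM2r ?ln_gt0 ?ltr1n//.
by rewrite ltrN2.
Qed.

Lemma powR2N_lt1 {a : R} : 0 < a -> 2 `^ (- a) < 1 :> R.
Proof.
by move=> a0; rewrite /powR gt_eqF// expR_lt1 mulNr oppr_lt0 mulr_gt0// ln_gt0 ?ltr1n.
Qed.

(** All comparisons below are between functions whose behaviour is known under
y |-> 2 y only; this induction makes them hold on a half-line. *)
Lemma doubling_ind (Q : R -> Prop) y0 : 0 < y0 ->
  (forall y, y0 <= y <= 2 * y0 -> Q y) ->
  (forall y, y0 <= y -> Q y -> Q (2 * y)) ->
  forall y, y0 <= y -> Q y.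
Proof.
move=> y00 base step y yy0.
have Qk k : forall z, y0 <= z <= 2 ^+ k.+1 * y0 -> Q z.
  elim: k => [|k IH] z /andP[z0 zk]; first by apply: base; rewrite z0.
  have [z2|z2] := leP z (2 * y0); first by apply: base; rewrite z0.
  rewrite (_ : z = 2 * (z / 2)); last by field.
  apply: step; first by lra.
  apply: IH; rewrite exprS in zk; apply/andP; split; lra.
have [k yk] : exists k, y <= 2 ^+ k.+1 * y0.
  exists (Num.truncn (y / y0)).+1; rewrite -ler_pdivrMr//.
  rewrite (le_trans (ltW (truncnS_gt _)))//.
  by rewrite -natrX ler_nat (leq_trans (ltnW (ltn_expl _ (isT : 1 < 2)%N)))// leq_exp2l.
by apply: (Qk k); rewrite yy0.
Qed.

Lemma dyadic_floor z y : 0 < z -> z <= y ->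
  exists k, 2 ^+ k * z <= y < 2 ^+ k.+1 * z.
Proof.
move=> z0; apply: (@doubling_ind (fun y => exists k, 2 ^+ k * z <= y < 2 ^+ k.+1 * z) z z0).
  move=> t /andP[zt]; rewrite le_eqVlt => /orP[/eqP ->|t2].
    by exists 1%N; rewrite expr1 lexx/= ltr_pM2r// expr2; lra.
  by exists 0%N; rewrite expr0 mul1r zt expr1.
move=> t zt [k /andP[h1 h2]]; exists k.+1.
rewrite !(exprS 2 k.+1) (exprS 2 k) in h2 *.
by apply/andP; split; lra.
Qed.

End Elementary.

(** * Dyadic comparison of tails and truncated moments *)

Section Dyadic.
Context {R : realType}.
Implicit Types (x y z : R) (F Phi V : R -> R).

(** Here Phi is the truncated second moment and F the tail.  Since F decays by
the factor q over one dyadic step, the increments 3 y^2 F y of Phi form a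
geometric sum of ratio 4 q. *)
Lemma second_moment_growth {F Phi} {q : R} {y0 : R} : 0 < y0 -> 4^-1 < q ->
  (forall y, 0 < y -> Phi (2 * y) <= Phi y + 3 * y ^+ 2 * F y) ->
  (forall y, 0 < y -> 0 <= F y) ->
  (forall y, 0 < y -> y ^+ 2 * F y <= Phi y) ->
  (forall y, y0 <= y -> F (2 * y) <= q * F y) ->
  exists2 C, 0 < C &
    forall k y, y0 <= y -> Phi (2 ^+ k * y) <= C * (4 * q) ^+ k * Phi y.
Proof.
move=> y00 q4 hPhi F0 FPhi Fq.
pose c := 3 / (4 * q - 1).
have c0 : 0 < c by rewrite divr_gt0//; lra.
have hc : c * (4 * q - 1) = 3 by rewrite /c; field; lra.
exists (1 + c); first lra.
move=> k y yy0.
have y0' : 0 < y by lra.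
have Fk j : F (2 ^+ j * y) <= q ^+ j * F y.
  elim: j => [|j IH]; first by rewrite !expr0 !mul1r.
  rewrite exprS -mulrA (le_trans (Fq _ _))//.
    by rewrite (le_trans yy0)// ler_peMl ?(ltW y0')// exprn_ege1//; lra.
  by rewrite exprS -mulrA ler_pM2l//; lra.
have main : Phi (2 ^+ k * y) <= Phi y + c * ((4 * q) ^+ k - 1) * (y ^+ 2 * F y).
  elim: k => [|k IH]; first by rewrite !expr0 subrr mulr0 mul0r addr0 mul1r.
  have p0 : 0 < 2 ^+ k * y by rewrite mulr_gt0// exprn_gt0.
  rewrite exprS -mulrA (le_trans (hPhi _ p0))//.
  have e : (2 ^+ k * y) ^+ 2 = 4 ^+ k * y ^+ 2.
    by rewrite exprMn -exprM mulnC exprM; congr (_ ^+ k * _); ring.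
  rewrite e.
  have : 3 * (4 ^+ k * y ^+ 2) * F (2 ^+ k * y) <= 3 * (4 ^+ k * y ^+ 2) * (q ^+ k * F y).
    by rewrite ler_pM2l// !mulr_gt0 ?exprn_gt0.
  have -> : 3 * (4 ^+ k * y ^+ 2) * (q ^+ k * F y) = c * (4 * q - 1) * (4 * q) ^+ k * (y ^+ 2 * F y).
    by rewrite hc exprMn; ring.
  move: IH; rewrite (exprS (4 * q) k); nra.
rewrite (le_trans main)//.
have := FPhi _ y0'; have G0 : 0 <= y ^+ 2 * F y by rewrite mulr_ge0 ?F0// sqr_ge0.
have q1 : 1 <= (4 * q) ^+ k by rewrite exprn_ege1//; lra.
move=> h.
have P0 : 0 <= Phi y by lra.
have h1 : c * ((4 * q) ^+ k - 1) * (y ^+ 2 * F y) <= c * ((4 * q) ^+ k - 1) * Phi y.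
  by rewrite ler_wpM2l// mulr_ge0 ?(ltW c0)//; lra.
have h2 : Phi y <= (4 * q) ^+ k * Phi y by rewrite ler_peMl.
have h3 : 0 <= c * Phi y by rewrite mulr_ge0// ltW.
lra.
Qed.

(** Potter's bound.  The power p is chosen so large that q^(p+1) <= 2^-D: this
is the form in which the bound is summed over lattice points. *)
Lemma potter_power {V} {q y0 C : R} (D : nat) : 0 < y0 -> 0 < C -> 0 < q < 1 ->
  (forall y, 0 < y -> 0 <= V y) ->
  (forall y z, 0 < z -> z <= y -> V y <= V z) ->
  (forall k y, y0 <= y -> V (2 ^+ k * y) <= C * q ^+ k * V y) ->
  exists p : nat, exists2 K, 0 < K &
    forall z y, y0 <= z -> z <= y -> V y ^+ p.+1 <= K * (z / y) ^+ D * V z ^+ p.+1.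
Proof.
move=> y00 C0 /andP[q0 q1] V0 Vni VC.
have [p hp] : exists p : nat, q ^+ p.+1 <= (2^-1) ^+ D.
  have : (fun n => q ^+ n) @ \oo --> (0 : R).
    by apply: cvg_expr; rewrite ger0_norm// ltW.
  move=> /cvgr_lt /(_ ((2^-1) ^+ D)) /(_ (exprn_gt0 _ _)) [|N _ HN].
    by rewrite invr_gt0.
  by exists N; apply/ltW/HN => /=.
exists p; exists (C ^+ p.+1 * 2 ^+ D); first by rewrite mulr_gt0 ?exprn_gt0.
move=> z y zy0 zy; have z0 : 0 < z by lra.
have y0' : 0 < y by lra.
have [k /andP[k1 k2]] := dyadic_floor _ _ z0 zy.
have h1 : V y <= C * q ^+ k * V z.
  by rewrite (le_trans _ (VC _ _ _))// Vni// mulr_gt0// exprn_gt0.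
rewrite (le_trans (lerXn2r p.+1 _ _ h1)) ?nnegrE ?V0 ?mulr_ge0 ?exprn_ge0 ?V0 ?(ltW C0) ?(ltW q0) ?(ltW z0) ?(ltW y0')//.
have -> : (C * q ^+ k * V z) ^+ p.+1 = C ^+ p.+1 * (q ^+ p.+1) ^+ k * V z ^+ p.+1.
  by rewrite !exprMn -!exprM mulnC.
apply: ler_wpM2r; first by rewrite exprn_ge0// V0.
rewrite -mulrA ler_pM2l ?exprn_gt0//.
rewrite (le_trans (lerXn2r k _ _ hp)) ?nnegrE ?exprn_ge0 ?invr_ge0 ?(ltW C0) ?(ltW q0) ?(ltW z0) ?(ltW y0')//.
rewrite -exprM mulnC exprM -exprMn lerXn2r ?nnegrE ?exprn_ge0 ?mulr_ge0 ?invr_ge0 ?(ltW C0) ?(ltW q0) ?(ltW z0) ?(ltW y0')//.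
rewrite exprVn -div1r ler_pdivrMr ?exprn_gt0// -mulrA mulrCA mulrC mulrAC -mulrA.
have -> : 2 * (z / y * 2 ^+ k) = 2 ^+ k.+1 * z / y by rewrite exprS; ring.
by rewrite ler_pdivlMr// mul1r ltW.
Qed.

End Dyadic.

(** * Expectations of bounded random variables *)

Section BoundedMeasurable.
Context {disp : measure_display} {T : measurableType disp} {R : realType}.
Implicit Types (f g : T -> R) (A : set T).

Definition bounded_measurable f :=
  measurable_fun setT f /\ exists M, forall w, `|f w| <= M.

Lemma bounded_measurable_cst c : bounded_measurable (fun _ => c).
Proof. by split; [exact: measurable_cst|exists `|c|]. Qed.

Lemma bounded_measurableD f g : bounded_measurable f -> bounded_measurable g ->
  bounded_measurable (fun w => f w + g w).
Proof.
move=> [mf [M fM]] [mg [N gN]]; split; first exact: measurable_funD.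
by exists (M + N) => w; rewrite (le_trans (ler_normD _ _))// lerD.
Qed.

Lemma bounded_measurableM f g : bounded_measurable f -> bounded_measurable g ->
  bounded_measurable (fun w => f w * g w).
Proof.
move=> [mf [M fM]] [mg [N gN]]; split; first exact: measurable_funM.
by exists (M * N) => w; rewrite normrM ler_pM.
Qed.

Lemma bounded_measurableN f : bounded_measurable f ->
  bounded_measurable (fun w => - f w).
Proof.
move=> [mf [M fM]]; split; first exact: measurableT_comp.
by exists M => w; rewrite normrN.
Qed.

Lemma bounded_measurableB f g : bounded_measurable f -> bounded_measurable g ->
  bounded_measurable (fun w => f w - g w).
Proof. by move=> bf bg; exact/bounded_measurableD/bounded_measurableN. Qed.

Lemma bounded_measurable_indic A : measurable A ->
  bounded_measurable (\1_A : T -> R).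
Proof.
move=> mA; split; first exact: measurable_indic.
by exists 1 => w; rewrite indicE; case: (_ \in _); rewrite ?normr1 ?normr0.
Qed.

Lemma bounded_measurable_cos f : measurable_fun setT f ->
  bounded_measurable (fun w => cos (f w)).
Proof.
move=> mf; split; last by exists 1 => w; exact: cos_max.
by apply: measurableT_comp => //; apply: continuous_measurable_fun => x; exact: continuous_cos.
Qed.

Lemma bounded_measurable_sin f : measurable_fun setT f ->
  bounded_measurable (fun w => sin (f w)).
Proof.
move=> mf; split; last by exists 1 => w; exact: sin_max.
by apply: measurableT_comp => //; apply: continuous_measurable_fun => x; exact: continuous_sin.
Qed.

Lemma bounded_measurable_sum (I : Type) (r : seq I) (F : I -> T -> R) :
  (forall i, bounded_measurable (F i)) ->
  bounded_measurable (fun w => \sum_(i <- r) F i w).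
Proof.
move=> bF; elim: r => [|i r IH].
  by under eq_fun do rewrite big_nil; exact: bounded_measurable_cst.
by under eq_fun do rewrite big_cons; exact: bounded_measurableD.
Qed.

End BoundedMeasurable.

Section Mean.
Context {disp : measure_display} {T : measurableType disp} {R : realType}.
Variable P : probability T R.
Implicit Types (f g : T -> R) (A : set T).

Lemma bounded_measurable_integrable f : bounded_measurable f ->
  P.-integrable setT (EFin \o f).
Proof.
move=> [mf [M fM]]; apply: measurable_bounded_integrable => //.
  by rewrite -ge0_fin_numE// fin_num_measure.
exists M; split; first exact: num_real.
by move=> x Mx w _; rewrite /= (le_trans (fM w))// ltW.
Qed.

Lemma mean_cst c : \int[P]_w c = c.
Proof. by rewrite Rintegral_cst//= probability_setT mulr1. Qed.

Lemma meanD f g : bounded_measurable f -> bounded_measurable g ->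
  \int[P]_w (f w + g w) = \int[P]_w f w + \int[P]_w g w.
Proof. by move=> ? ?; rewrite RintegralD//; exact: bounded_measurable_integrable. Qed.

Lemma meanB f g : bounded_measurable f -> bounded_measurable g ->
  \int[P]_w (f w - g w) = \int[P]_w f w - \int[P]_w g w.
Proof. by move=> ? ?; rewrite RintegralB//; exact: bounded_measurable_integrable. Qed.

Lemma meanZ c f : bounded_measurable f ->
  \int[P]_w (c * f w) = c * \int[P]_w f w.
Proof. by move=> ?; rewrite RintegralZl//; exact: bounded_measurable_integrable. Qed.

Lemma mean_sum (I : Type) (r : seq I) (F : I -> T -> R) :
  (forall i, bounded_measurable (F i)) ->
  \int[P]_w (\sum_(i <- r) F i w) = \sum_(i <- r) \int[P]_w F i w.
Proof.
move=> bF; elim: r => [|i r IH].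
  by under eq_Rintegral do rewrite big_nil; rewrite mean_cst big_nil.
under eq_Rintegral do rewrite big_cons.
by rewrite meanD ?IH ?big_cons//; exact: bounded_measurable_sum.
Qed.

Lemma le_mean f g : bounded_measurable f -> bounded_measurable g ->
  (forall w, f w <= g w) -> \int[P]_w f w <= \int[P]_w g w.
Proof. by move=> ? ? fg; apply: le_Rintegral => //; exact: bounded_measurable_integrable. Qed.

Lemma mean_ge0 f : (forall w, 0 <= f w) -> 0 <= \int[P]_w f w.
Proof. by move=> f0; exact: Rintegral_ge0. Qed.

Lemma mean_indic A : measurable A -> \int[P]_w (\1_A w) = fine (P A).
Proof.
move=> mA; rewrite /Rintegral; congr fine.
by rewrite integral_indic// setIT.
Qed.

Lemma EFin_mean f : bounded_measurable f ->
  (\int[P]_w f w)%:E = (\int[P]_w (f w)%:E)%E.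
Proof.
move=> bf; rewrite /Rintegral fineK//.
by apply: integrable_fin_num => //; exact: bounded_measurable_integrable.
Qed.

Lemma fineP_ge0 A : 0 <= fine (P A).
Proof. by rewrite fine_ge0. Qed.

Lemma fineP_le1 A : measurable A -> fine (P A) <= 1.
Proof. by move=> mA; rewrite -lee_fin fineK ?fin_num_measure// probability_le1. Qed.

Lemma fineP_le A B : measurable A -> measurable B -> A `<=` B ->
  fine (P A) <= fine (P B).
Proof.
by move=> mA mB AB; rewrite fine_le ?fin_num_measure// le_measure// inE.
Qed.

End Mean.

(** * Independence *)

Section Independence.
Context {disp disp' : measure_display} {T : measurableType disp}
  {E : measurableType disp'} {R : realType}.
Variables (P : probability T R) (Y : nat -> {RV P >-> E}).
Hypothesis indepY : mutually_independent P Y.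
Implicit Types (s : {fset nat}).

(** The cylinders over the coordinates in s: a pi-system that generates
the sigma-algebra of these coordinates. *)
Definition cylinders s : set (set T) :=
  [set B | exists2 A : nat -> set E, (forall j, measurable (A j)) &
    B = \bigcap_(j in [set` s]) (Y j @^-1` A j)].

Definition coordinate_algebra s := g_sigma_algebraType (cylinders s).

Lemma measurable_preimage_rv j (A : set E) : measurable A -> measurable (Y j @^-1` A).
Proof. by move=> mA; rewrite -[_ @^-1` _]setTI; exact: measurable_funP. Qed.

Lemma cylinders_measurable s : cylinders s `<=` measurable.
Proof.
move=> _ [A mA ->]; apply: fin_bigcap_measurable => // j _.
exact: measurable_preimage_rv.
Qed.

Lemma cylinders_setI_closed s : setI_closed (cylinders s).
Proof.
move=> _ _ [A mA ->] [B mB ->]; exists (fun j => A j `&` B j).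
  by move=> j; exact: measurableI.
by rewrite -bigcapI.
Qed.

Lemma cylinders_setT s : cylinders s setT.
Proof. by exists (fun=> setT) => //; rewrite bigcapT. Qed.

Lemma coordinate_measurable s (j : nat) : j \in s ->
  measurable_fun setT (Y j : coordinate_algebra s -> E).
Proof.
move=> js _ A mA; rewrite setTI; apply: sub_sigma_algebra.
exists (fun k => if k == j then A else setT).
  by move=> k; case: eqP.
apply/seteqP; split => [w wA k /= ks|w /(_ j js) /=]; last by rewrite eqxx.
by case: eqP => // ->.
Qed.

Lemma coordinate_subalgebra s (B : set T) :
  (@measurable _ (coordinate_algebra s) B) -> measurable B.
Proof.
by apply: smallest_sub; [exact: sigma_algebra_measurable|exact: cylinders_measurable].
Qed.

Lemma coordinate_measurable_fun d'' (T'' : measurableType d'') s (f : T -> T'') :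
  measurable_fun setT (f : coordinate_algebra s -> T'') -> measurable_fun setT f.
Proof.
by move=> mf _ A mA; apply: (@coordinate_subalgebra s); exact: mf.
Qed.

Lemma coordinate_algebra_mono d'' (T'' : measurableType d'') s s' (f : T -> T'') :
  (s `<=` s')%fset -> measurable_fun setT (f : coordinate_algebra s -> T'') ->
  measurable_fun setT (f : coordinate_algebra s' -> T'').
Proof.
move=> /fsubsetP ss' mf _ A mA; apply: (@sub_sigma_algebra2 _ _ _ (cylinders s)).
  move=> _ [B mB ->]; exists (fun j => if j \in s then B j else setT).
    by move=> j; case: ifP.
  apply/seteqP; split => [w Bw j /= js'|w Bw j /= js]; last first.
    by have := Bw j (ss' _ js); rewrite js.
  by case: ifPn => // js; exact: Bw.
exact: mf.
Qed.

(** Both sides are finite measures in B that agree on cylinders. *)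
Lemma independent_event s i (B : set T) (A : set E) : i \notin s ->
  (@measurable _ (coordinate_algebra s) B) -> measurable A ->
  P (B `&` Y i @^-1` A) = (P B * P (Y i @^-1` A))%E.
Proof.
move=> is_ mB mA.
have mD : measurable (Y i @^-1` A) by exact: measurable_preimage_rv.
pose r := NngNum (fineP_ge0 P (Y i @^-1` A)).
have rE : (r%:num)%:E = P (Y i @^-1` A).
  by apply: fineK; exact: fin_num_measure.
rewrite muleC -rE -[LHS]/(mrestr P mD B) -[RHS]/(mscale r P B).
apply: (g_sigma_algebra_measure_unique (cylinders s) _ (fun=> setT)) => //.
- exact: cylinders_measurable.
- by move=> _; exact: cylinders_setT.
- by rewrite bigcup_const//; exists 0%N.
- exact: cylinders_setI_closed.
- move=> _ [C mC ->]; rewrite -[LHS]/(P (_ `&` _)) -[RHS]/((r%:num)%:E * P _)%E rE.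
  pose C' k := if k == i then A else C k.
  have C's k : k \in s -> C' k = C k.
    by rewrite /C'; case: eqP => // -> /(negP is_).
  have mC' k : measurable (C' k) by rewrite /C'; case: eqP.
  have -> : \bigcap_(j in [set` s]) Y j @^-1` C j =
            \bigcap_(j in [set` s]) Y j @^-1` C' j.
    by apply: eq_bigcapr => j /= js; rewrite C's.
  have := indepY (i |`  s)%fset C' (fun j _ => mC' j).
  rewrite big_fsetU1//= -indepY; last by move=> j _; exact: mC'.
  rewrite {2 3}/C' eqxx => <-; congr (P _).
  rewrite set_fsetU1 bigcap_setU1 setIC; congr (_ `&` _).
  by rewrite /C' eqxx.
- move=> _; rewrite -[X in (X < _)%E]/(P (setT `&` _)) setTI.
  by rewrite (le_lt_trans (probability_le1 _ _))// ltry.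
Qed.

(** By the previous lemma the joint law of the coordinates in s and of the i-th
one is a product measure, so that Fubini's theorem applies. *)
Lemma mean_independent s i (f : T -> R) (g : E -> R) : i \notin s ->
  bounded_measurable (f : coordinate_algebra s -> R) -> bounded_measurable g ->
  \int[P]_w (f w * g (Y i w)) = \int[P]_w f w * \int[P]_w g (Y i w).
Proof.
move=> is_ bf bg.
have bfT : bounded_measurable f.
  by case: bf => mf bf; split=> //; exact: coordinate_measurable_fun mf.
have mgY : bounded_measurable (g \o Y i).
  by case: bg => mg [M gM]; split; [exact: measurableT_comp|exists M => w; exact: gM].
have mid : measurable_fun setT (id : T -> coordinate_algebra s).
  by move=> _ A mA; rewrite setTI; exact: (@coordinate_subalgebra s).
have mpair : measurable_fun setT (fun w : T => (w : coordinate_algebra s, Y i w)).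
  by apply: measurable_fun_pair => //; exact: measurable_funP.
pose idm : {RV P >-> coordinate_algebra s} :=
  HB.pack (id : T -> coordinate_algebra s) (isMeasurableFun.Build _ _ _ _ _ mid).
pose pairm : {RV P >-> (coordinate_algebra s * E)%type} :=
  HB.pack (fun w : T => (w : coordinate_algebra s, Y i w))
    (isMeasurableFun.Build _ _ _ _ _ mpair).
pose m1 := distribution P idm; pose m2 := distribution P (Y i).
pose fg (z : coordinate_algebra s * E) := f z.1 * g z.2.
have bfg : bounded_measurable fg.
  apply: bounded_measurableM.
    by case: bf => mf [M fM]; split; [exact: measurableT_comp|exists M => z; exact: fM].
  by case: bg => mg [M gM]; split; [exact: measurableT_comp|exists M => z; exact: gM].
have joint A : measurable A -> distribution P pairm A = (m1 \x m2)%E A.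
  move=> mA; apply/esym; apply: product_measure_unique => // B C mB mC.
  exact: (independent_event _ _ _ _ is_ mB mC).
apply: EFin_inj; rewrite EFin_mean; last exact: bounded_measurableM.
have -> : (\int[P]_w (f w * g (Y i w))%:E = \int[distribution P pairm]_z (fg z)%:E)%E.
  rewrite integral_distribution//; first by apply/measurable_EFinP; case: bfg.
  exact/bounded_measurable_integrable/bounded_measurableM.
rewrite (eq_measure_integral (m1 \x m2)%E); last by move=> A mA _; exact: joint.
have ifg : (m1 \x m2)%E.-integrable setT (EFin \o fg).
  exact: (bounded_measurable_integrable (m1 \x m2)%E).
rewrite -integral12_prod_meas1//.
have inner x : fubini_F m2 (EFin \o fg) x = ((\int[P]_w g (Y i w)) * f x)%:E.
  have ig : m2.-integrable setT (EFin \o g) by exact: bounded_measurable_integrable.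
  rewrite /fubini_F /fg /=; under eq_integral do rewrite EFinM.
  rewrite integralZl// EFinM muleC EFin_mean//.
  rewrite integral_distribution//; first by apply/measurable_EFinP; case: bg.
  exact: (bounded_measurable_integrable P _ mgY).
rewrite (eq_integral _ _ (fun x _ => inner x)).
rewrite integral_distribution//=.
- by rewrite -EFin_mean ?meanZ 1?mulrC//; apply: bounded_measurableM => //; exact: bounded_measurable_cst.
- by apply/measurable_EFinP; apply: measurable_funM => //; case: bf.
- by apply: (bounded_measurable_integrable P); apply: bounded_measurableM => //; exact: bounded_measurable_cst.
Qed.

End Independence.

(** * Euclidean geometry and Borel functions on the space of row vectors *)

Section Vectors.
Context {R : realType} {d : nat}.
Implicit Types (x y z t : 'rV[R]_d) (a : R).

Lemma edotC x y : edot x y = edot y x.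
Proof. by apply: eq_bigr => j _; rewrite mulrC. Qed.

Lemma edotDr t x y : edot t (x + y) = edot t x + edot t y.
Proof. by rewrite /edot -big_split; apply: eq_bigr => j _; rewrite mxE mulrDr. Qed.

Lemma edotZr t a x : edot t (a *: x) = a * edot t x.
Proof. by rewrite /edot mulr_sumr; apply: eq_bigr => j _; rewrite mxE mulrCA. Qed.

Lemma edotZl t a x : edot (a *: t) x = a * edot t x.
Proof. by rewrite edotC edotZr edotC. Qed.

Lemma edotNr t x : edot t (- x) = - edot t x.
Proof. by rewrite -scaleN1r edotZr mulN1r. Qed.

Lemma edotBr t x y : edot t (x - y) = edot t x - edot t y.
Proof. by rewrite edotDr edotNr. Qed.

Lemma edotBl t t' x : edot (t - t') x = edot t x - edot t' x.
Proof. by rewrite edotC edotBr ![edot x _]edotC. Qed.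

Lemma enorm_ge0 x : 0 <= enorm x.
Proof. exact: sqrtr_ge0. Qed.

Lemma sqr_enorm x : enorm x ^+ 2 = edot x x.
Proof. by rewrite sqr_sqrtr ?sumr_ge0// => j _; exact: sqr_ge0. Qed.

Lemma coord_le_enorm x j : `|x ord0 j| <= enorm x.
Proof.
rewrite -sqrtr_sqr; apply: ler_wsqrtr.
by rewrite (bigD1 j)//= lerDl sumr_ge0// => i _; exact: sqr_ge0.
Qed.

Lemma enorm_le_sum x : enorm x <= \sum_(j < d) `|x ord0 j|.
Proof.
suff [s0 s2] : 0 <= \sum_(j < d) `|x ord0 j| /\
    \sum_(j < d) x ord0 j ^+ 2 <= (\sum_(j < d) `|x ord0 j|) ^+ 2.
  by rewrite -(ler_pXn2r (isT : 0 < 2)%N) ?nnegrE ?enorm_ge0// sqr_sqrtr// sumr_ge0// => j _; exact: sqr_ge0.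
apply: (big_ind2 (fun a b => 0 <= b /\ a <= b ^+ 2)) => [|a b a' b' [b0 ab] [b'0 ab']|j _].
- by rewrite expr0n.
- by split; [exact: addr_ge0|nra].
- by rewrite normr_ge0 real_normK ?num_real.
Qed.

Lemma enorm_eq0 x : enorm x = 0 -> x = 0.
Proof.
move=> x0; apply/rowP => j; rewrite mxE; apply/normr0_eq0/eqP.
by rewrite eq_le normr_ge0 -x0 coord_le_enorm.
Qed.

Lemma edot0r t : edot t 0 = 0.
Proof. by rewrite /edot big1// => j _; rewrite mxE mulr0. Qed.

Lemma edot_le_enorm x y : edot x y <= enorm x * enorm y.
Proof.
have [x0|x0] := eqVneq (enorm x) 0.
  by rewrite (enorm_eq0 _ x0) edotC edot0r mulr_ge0 ?enorm_ge0.
have [y0|y0] := eqVneq (enorm y) 0.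
  by rewrite (enorm_eq0 _ y0) edot0r mulr_ge0 ?enorm_ge0.
have {}x0 : 0 < enorm x by rewrite lt_def x0 enorm_ge0.
have {}y0 : 0 < enorm y by rewrite lt_def y0 enorm_ge0.
have := sqr_ge0 (enorm (enorm y *: x - enorm x *: y)).
rewrite sqr_enorm !(edotBr, edotBl, edotZr, edotZl) -!sqr_enorm (edotC y x).
have xy0 : 0 < enorm x * enorm y by exact: mulr_gt0.
move=> h; have : 0 <= (enorm x * enorm y) * (enorm x * enorm y - edot x y) by nra.
by rewrite pmulr_rge0// subr_ge0.
Qed.

Lemma enormZ a x : enorm (a *: x) = `|a| * enorm x.
Proof.
apply: (@pexpIrn _ 2) => //; rewrite ?nnegrE ?mulr_ge0 ?enorm_ge0//.
by rewrite exprMn !sqr_enorm edotZl edotZr real_normK ?num_real// mulrA expr2.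
Qed.

Lemma enormN x : enorm (- x) = enorm x.
Proof. by rewrite -scaleN1r enormZ normrN1 mul1r. Qed.

Lemma norm_edot_le x y : `|edot x y| <= enorm x * enorm y.
Proof.
rewrite ler_norml edot_le_enorm andbT lerNl -edotNr.
by rewrite (le_trans (edot_le_enorm _ _))// enormN.
Qed.

Lemma enormD x y : enorm (x + y) <= enorm x + enorm y.
Proof.
rewrite -(ler_pXn2r (isT : 0 < 2)%N) ?nnegrE ?addr_ge0 ?enorm_ge0//.
rewrite sqr_enorm edotDr !(edotC (x + y)) !edotDr (edotC y x) -!sqr_enorm.
by have := edot_le_enorm x y; lra.
Qed.

End Vectors.

Section BorelVectors.
Context {R : realType} {d : nat}.
Implicit Types (x y t : 'rV[R]_d).

Lemma continuous_borel (f : 'rV[R]_d -> R) : continuous f ->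
  measurable_fun setT (f : borel_rV R d -> R).
Proof.
move=> /continuousP cf; apply: (measurability _ (RGenOpens.measurableE R)).
move=> _ [_ [a [b ->] <-]]; rewrite setTI; apply: sub_sigma_algebra.
exact/cf/interval_open.
Qed.

Lemma continuous_sum_coord (F : 'I_d -> 'rV[R]_d -> R) :
  (forall j, continuous (F j)) -> continuous (fun x => \sum_(j < d) F j x).
Proof.
move=> cF; apply: continuous_big => [|j _]; last exact: cF.
exact: add_continuous.
Qed.

Lemma continuous_edot t : continuous (edot t).
Proof.
apply: (continuous_sum_coord (fun j (x : 'rV[R]_d) => t ord0 j * x ord0 j)) => j x.
apply: (@cvgM R 'rV[R]_d (nbhs x) _ (fun=> t ord0 j) (fun y => y ord0 j)).
  exact: cvg_cst.
exact: coord_continuous.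
Qed.

Lemma continuous_enorm : continuous (@enorm R d).
Proof.
have cs : continuous (fun x : 'rV[R]_d => \sum_(j < d) x ord0 j ^+ 2).
  apply: (continuous_sum_coord (fun j (x : 'rV[R]_d) => x ord0 j ^+ 2)) => j.
  under eq_fun do rewrite expr2.
  move=> x; apply: (@cvgM R 'rV[R]_d (nbhs x) _ (fun y => y ord0 j) (fun y => y ord0 j)).
    exact: coord_continuous.
  exact: coord_continuous.
move=> x; apply: (@continuous_comp _ _ _ (fun x => \sum_(j < d) x ord0 j ^+ 2)).
  exact: cs.
exact: sqrt_continuous.
Qed.

Lemma borel_edot t : measurable_fun setT (edot t : borel_rV R d -> R).
Proof. by apply: continuous_borel; exact: continuous_edot. Qed.

Lemma borel_enorm : measurable_fun setT (@enorm R d : borel_rV R d -> R).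
Proof. by apply: continuous_borel; exact: continuous_enorm. Qed.

Lemma borel_coord j : measurable_fun setT (fun x : borel_rV R d => (x : 'rV[R]_d) ord0 j).
Proof. by apply: continuous_borel; exact: coord_continuous. Qed.

End BorelVectors.

(** * Concentration of sums of independent vectors *)

Section Concentration.
Context {disp : measure_display} {T : measurableType disp} {R : realType}
  {d : nat} {P : probability T R} {X : {RV P >-> borel_rV R d}}
  {Y : nat -> {RV P >-> borel_rV R d}}.
Hypothesis copiesY : independent_copies P X Y.
Implicit Types (t x : 'rV[R]_d) (s : {fset nat}) (r : seq nat) (u b : T -> R).

Definition cos_mean t := \int[P]_w cos (edot t (X w)).
Definition sin_mean t := \int[P]_w sin (edot t (X w)).

(** The squared modulus of the characteristic function of X. *)
Definition sqr_chf t := cos_mean t ^+ 2 + sin_mean t ^+ 2.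

Definition list_sum r (w : T) : 'rV[R]_d := \sum_(i <- r) (Y i w : 'rV[R]_d).

Lemma sqr_chf_ge0 t : 0 <= sqr_chf t.
Proof. by rewrite addr_ge0 ?sqr_ge0. Qed.

Lemma mean_copy i (g : borel_rV R d -> R) : bounded_measurable g ->
  \int[P]_w g (Y i w) = \int[P]_w g (X w).
Proof.
move=> bg.
have bZ (Z : {RV P >-> borel_rV R d}) : bounded_measurable (g \o Z).
  by case: bg => mg [M gM]; split; [exact: measurableT_comp|exists M => w; exact: gM].
have mg : measurable_fun setT (EFin \o g) by apply/measurable_EFinP; case: bg.
apply: EFin_inj; rewrite !EFin_mean//; [|exact: bZ|exact: bZ].
have hZ (Z : {RV P >-> borel_rV R d}) :
    (\int[P]_w (g (Z w))%:E = \int[distribution P Z]_x (g x)%:E)%E.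
  by rewrite integral_distribution//; exact/bounded_measurable_integrable/bZ.
rewrite !hZ; apply: eq_measure_integral => A mA _; exact: copiesY.2.
Qed.

Lemma bounded_measurable_cos_edot t :
  bounded_measurable (fun x : borel_rV R d => cos (edot t x)).
Proof. by apply: bounded_measurable_cos; exact: borel_edot. Qed.

Lemma bounded_measurable_sin_edot t :
  bounded_measurable (fun x : borel_rV R d => sin (edot t x)).
Proof. by apply: bounded_measurable_sin; exact: borel_edot. Qed.

(** Adding one independent vector multiplies E b e^(iu) by the characteristic
function of X; in real coordinates the pair of cosine and sine parts is rotated
and scaled by the factor sqrt (sqr_chf t). *)
Lemma fourier_one_step s i t u b : i \notin s ->
  measurable_fun setT (u : coordinate_algebra P Y s -> R) ->
  bounded_measurable (b : coordinate_algebra P Y s -> R) ->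
  (\int[P]_w (b w * cos (u w + edot t (Y i w)))) ^+ 2 +
  (\int[P]_w (b w * sin (u w + edot t (Y i w)))) ^+ 2 =
  ((\int[P]_w (b w * cos (u w))) ^+ 2 + (\int[P]_w (b w * sin (u w))) ^+ 2) * sqr_chf t.
Proof.
move=> is_ mu bb.
have bcu : bounded_measurable (fun w : coordinate_algebra P Y s => b w * cos (u w)).
  exact/bounded_measurableM/bounded_measurable_cos.
have bsu : bounded_measurable (fun w : coordinate_algebra P Y s => b w * sin (u w)).
  exact/bounded_measurableM/bounded_measurable_sin.
have bT (f : T -> R) : bounded_measurable (f : coordinate_algebra P Y s -> R) ->
    bounded_measurable f.
  by case=> mf bf; split=> //; exact: coordinate_measurable_fun mf.
have bc := bounded_measurable_cos_edot t.
have bs := bounded_measurable_sin_edot t.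
have bZ (g : borel_rV R d -> R) : bounded_measurable g -> bounded_measurable (g \o Y i).
  by case=> mg [M gM]; split; [exact: measurableT_comp|exists M => w; exact: gM].
have step f g : bounded_measurable (f : coordinate_algebra P Y s -> R) ->
    bounded_measurable g ->
    \int[P]_w (f w * g (Y i w)) = \int[P]_w f w * \int[P]_w g (X w).
  by move=> bf bg; rewrite (mean_independent P Y copiesY.1 s)// mean_copy.
have -> : \int[P]_w (b w * cos (u w + edot t (Y i w))) =
    \int[P]_w (b w * cos (u w)) * cos_mean t - \int[P]_w (b w * sin (u w)) * sin_mean t.
  rewrite -(step _ _ bcu bc) -(step _ _ bsu bs) -meanB.
  - by apply: eq_Rintegral => w _; rewrite cosD; ring.
  - by apply: bounded_measurableM; [exact: bT|exact: (bZ _ bc)].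
  - by apply: bounded_measurableM; [exact: bT|exact: (bZ _ bs)].
have -> : \int[P]_w (b w * sin (u w + edot t (Y i w))) =
    \int[P]_w (b w * sin (u w)) * cos_mean t + \int[P]_w (b w * cos (u w)) * sin_mean t.
  rewrite -(step _ _ bsu bc) -(step _ _ bcu bs) -meanD.
  - by apply: eq_Rintegral => w _; rewrite sinD; ring.
  - by apply: bounded_measurableM; [exact: bT|exact: (bZ _ bc)].
  - by apply: bounded_measurableM; [exact: bT|exact: (bZ _ bs)].
by rewrite /sqr_chf; ring.
Qed.

Lemma list_sum_measurable s r t : {subset r <= s} ->
  measurable_fun setT ((fun w => edot t (list_sum r w)) : coordinate_algebra P Y s -> R).
Proof.
rewrite /list_sum; elim: r => [|i r IH] rs.
  by under eq_fun do rewrite big_nil edot0r; exact: measurable_cst.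
under eq_fun do rewrite big_cons edotDr.
apply: measurable_funD; last by apply: IH => j jr; apply: rs; rewrite inE jr orbT.
apply: (measurableT_comp (borel_edot t)); apply: coordinate_measurable.
by apply: rs; rewrite mem_head.
Qed.

Lemma fourier_steps s r t u b : uniq r -> {in r, forall i, i \notin s} ->
  measurable_fun setT (u : coordinate_algebra P Y s -> R) ->
  bounded_measurable (b : coordinate_algebra P Y s -> R) ->
  (\int[P]_w (b w * cos (u w + edot t (list_sum r w)))) ^+ 2 +
  (\int[P]_w (b w * sin (u w + edot t (list_sum r w)))) ^+ 2 =
  ((\int[P]_w (b w * cos (u w))) ^+ 2 + (\int[P]_w (b w * sin (u w))) ^+ 2)
    * sqr_chf t ^+ size r.
Proof.
elim: r => [_ _ _ _|i r IH /= /andP[ir ur] rs mu bb].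
  rewrite expr0 mulr1; congr (_ ^+ 2 + _ ^+ 2); apply: eq_Rintegral => w _;
  by rewrite /list_sum big_nil edot0r addr0.
have rs' : {in r, forall j, j \notin s} by move=> j jr; apply: rs; rewrite inE jr orbT.
rewrite [sqr_chf t ^+ _]exprSr mulrA -(IH ur rs' mu bb).
pose s' := (s `|` [fset j in r])%fset.
have ss' : (s `<=` s')%fset by rewrite fsubsetUl.
rewrite -(fourier_one_step s' i).
- by congr (_ ^+ 2 + _ ^+ 2); apply: eq_Rintegral => w _;
    rewrite /list_sum big_cons edotDr addrA [X in _ * _ X](addrAC _ _ (edot _ _)).
- by rewrite !inE negb_or ir rs// mem_head.
- apply: measurable_funD; first exact: coordinate_algebra_mono ss' mu.
  by apply: list_sum_measurable => j jr; rewrite !inE jr orbT.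
- by case: bb => mb bb; split=> //; exact: coordinate_algebra_mono ss' mb.
Qed.

(** The event B may depend on the coordinates in s in any way, even through u:
only the summands in r are used to produce decay.  This is what lets the
concentration bound be multiplied by the probability of a large deviation. *)
Lemma fourier_decay s r t u (B : set T) : uniq r -> {in r, forall i, i \notin s} ->
  measurable_fun setT (u : coordinate_algebra P Y s -> R) ->
  @measurable _ (coordinate_algebra P Y s) B ->
  \int[P]_w (\1_B w * cos (u w + edot t (list_sum r w)))
  <= fine (P B) * Num.sqrt (sqr_chf t) ^+ size r.
Proof.
move=> ur rs mu mB.
have mBT : measurable B by exact: coordinate_subalgebra mB.
have mu' := coordinate_measurable_fun P Y _ _ _ _ mu.
have bB : bounded_measurable (\1_B : coordinate_algebra P Y s -> R).
  exact: bounded_measurable_indic.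
have bBT : bounded_measurable (\1_B : T -> R) by exact: bounded_measurable_indic.
have := fourier_steps s r t u (\1_B) ur rs mu bB.
set a := \int[P]_w _; set a' := \int[P]_w _.
set c := \int[P]_w _; set c' := \int[P]_w _ => e.
have bc : bounded_measurable (fun w => \1_B w * cos (u w)).
  exact/bounded_measurableM/bounded_measurable_cos.
have bs : bounded_measurable (fun w => \1_B w * sin (u w)).
  exact/bounded_measurableM/bounded_measurable_sin.
pose q := c ^+ 2 + c' ^+ 2.
have q0 : 0 <= q by rewrite addr_ge0 ?sqr_ge0.
have qP : q <= fine (P B) * Num.sqrt q.
  rewrite {1}/q !expr2 -[c * c]meanZ// -[c' * c']meanZ// -meanD; first last.
  - by apply: bounded_measurableM => //; exact: bounded_measurable_cst.
  - by apply: bounded_measurableM => //; exact: bounded_measurable_cst.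
  rewrite mulrC -mean_indic// -meanZ//; apply: le_mean.
  - by apply: bounded_measurableD; apply: bounded_measurableM => //; exact: bounded_measurable_cst.
  - by apply: bounded_measurableM => //; exact: bounded_measurable_cst.
  move=> w; rewrite indicE; case: (_ \in _); rewrite /= ?mulr0n ?mulr1n ?mul0r ?mulr0 ?addr0// !mul1r mulr1.
  exact: rotation_le.
have sq : Num.sqrt q <= fine (P B).
  have [->|q1] := eqVneq q 0; first by rewrite sqrtr0 fineP_ge0.
  have sq0 : 0 < Num.sqrt q by rewrite sqrtr_gt0 lt_def q1.
  by rewrite -(ler_pM2r sq0) -expr2 sqr_sqrtr.
rewrite (le_trans (ler_norm _))// -sqrtr_sqr.
apply: (@le_trans _ _ (Num.sqrt (q * sqr_chf t ^+ size r))).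
  by apply: ler_wsqrtr; rewrite /q -e lerDl sqr_ge0.
rewrite sqrtrM// ler_pM ?sqrtr_ge0//.
rewrite -[X in X ^+ size r](sqr_sqrtr (sqr_chf_ge0 t)) -exprM mulnC exprM sqrtr_sqr.
by rewrite ger0_norm// exprn_ge0// sqrtr_ge0.
Qed.

End Concentration.

Section Fejer.
Context {disp : measure_display} {T : measurableType disp} {R : realType}
  {d : nat} {P : probability T R} {X : {RV P >-> borel_rV R d}}
  {Y : nat -> {RV P >-> borel_rV R d}}.
Hypothesis copiesY : independent_copies P X Y.
Implicit Types (t x v : 'rV[R]_d) (s : {fset nat}) (r q : seq nat).

Definition frequency {N} (k : {ffun 'I_d -> 'I_N}) : 'rV[R]_d :=
  \row_j (k j : nat)%:R.

Lemma measurable_list_sum_cube q r x v (h : R) :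
  measurable [set w | cube h x (list_sum (Y := Y) q w + list_sum (Y := Y) r w - v)].
Proof.
have mc r' j : measurable_fun setT (fun w : T => (list_sum (Y := Y) r' w) ord0 j).
  rewrite /list_sum; under eq_fun do rewrite summxE.
  elim: r' => [|i r' IH]; first by under eq_fun do rewrite big_nil; exact: measurable_cst.
  under eq_fun do rewrite big_cons; apply: measurable_funD => //.
  by apply: (measurableT_comp (borel_coord j)); exact: measurable_funP.
rewrite (_ : [set w | _] = \bigcap_(j in [set: 'I_d])
   ((fun w => (list_sum (Y := Y) q w) ord0 j + (list_sum (Y := Y) r w) ord0 j - v ord0 j)
     @^-1` `](x ord0 j - h), (x ord0 j + h)]%classic)); last first.
  apply/seteqP; split => [w xw j _ /=|w xw j].
    by have := xw j; rewrite !mxE in_itv.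
  by have := xw j I; rewrite /= in_itv /= !mxE.
apply: fin_bigcap_measurable => // j _.
rewrite -[_ @^-1` _]setTI; apply: measurable_funB => //.
by apply: measurable_funD.
Qed.

Lemma sum_cos_sq_sin_sq (I : finType) (a : I -> R) :
  (\sum_k cos (a k)) ^+ 2 + (\sum_k sin (a k)) ^+ 2 =
  \sum_k \sum_k' cos (a k - a k').
Proof.
rewrite !expr2 !mulr_suml -big_split; apply: eq_bigr => k _ /=.
by rewrite !mulr_sumr -big_split; apply: eq_bigr => k' _; rewrite cosB.
Qed.

(** The squared modulus of the average of e^(i eps k.z) over the lattice cube
of side N + 1 is a discrete Fejer kernel: it is nonnegative, and at least 1/4
when z lies in the cube of half-side h, since all phases are then in [-1, 1].  Its
expansion into cosines of differences of frequencies brings in only the values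
of the characteristic function at lattice points. *)
Lemma list_sum_concentration s q r x v (h eps : R) (N : nat) (B : set T) :
  uniq r -> {in r, forall i, i \notin s} -> {subset q <= s} ->
  @measurable _ (coordinate_algebra P Y s) B ->
  0 < h -> 0 <= eps -> eps * (N.+1%:R * d%:R * h) <= 1 ->
  fine (P (B `&` [set w | cube h x (list_sum (Y := Y) q w + list_sum (Y := Y) r w - v)]))
  <= 4 * fine (P B) * ((N.+1%:R ^+ d) ^- 2 *
     \sum_(k : {ffun 'I_d -> 'I_N.+1}) \sum_(k' : {ffun 'I_d -> 'I_N.+1})
        Num.sqrt (sqr_chf (X := X) (eps *: (frequency k - frequency k'))) ^+ size r).
Proof.
move=> ur rs qs mB h0 e0 eh.
pose K : finType := {ffun 'I_d -> 'I_N.+1}.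
have cardK : (#|K|%:R : R) = N.+1%:R ^+ d by rewrite card_ffun !card_ord natrX.
set D := [set w | _].
have mD : measurable D by exact: measurable_list_sum_cube.
have mBT : measurable B by exact: coordinate_subalgebra mB.
pose Z w := list_sum (Y := Y) q w + list_sum (Y := Y) r w - v - x.
pose a (k : K) w := eps * edot (frequency k) (Z w).
pose F w := (\sum_(k : K) cos (a k w)) ^+ 2 + (\sum_(k : K) sin (a k w)) ^+ 2.
pose c : R := 4 * (N.+1%:R ^+ d) ^- 2.
have N0 : 0 < (N.+1%:R ^+ d : R) by rewrite exprn_gt0.
have c0 : 0 <= c by rewrite mulr_ge0// invr_ge0 exprn_ge0// ltW.
pose tau (k k' : K) := eps *: (frequency k - frequency k').
have aE k k' w : a k w - a k' w =
    (edot (tau k k') (list_sum (Y := Y) q w) - edot (tau k k') (v + x))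
    + edot (tau k k') (list_sum (Y := Y) r w).
  rewrite /a /tau -mulrBr -edotBl edotZl -!edotZl /Z !edotBr !edotDr; ring.
pose u k k' w := edot (tau k k') (list_sum (Y := Y) q w) - edot (tau k k') (v + x).
have mu k k' : measurable_fun setT (u k k' : coordinate_algebra P Y s -> R).
  by apply: measurable_funB; [exact: list_sum_measurable|exact: measurable_cst].
have mur k k' : measurable_fun setT
    (fun w => u k k' w + edot (tau k k') (list_sum (Y := Y) r w)).
  apply: measurable_funD; first exact: coordinate_measurable_fun (mu k k').
  apply: (coordinate_measurable_fun P Y _ _ [fset i in r]%fset).
  by apply: list_sum_measurable => i; rewrite !inE.
have FE w : F w = \sum_(k : K) \sum_(k' : K)
    cos (u k k' w + edot (tau k k') (list_sum (Y := Y) r w)).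
  rewrite /F sum_cos_sq_sin_sq; apply: eq_bigr => k _; apply: eq_bigr => k' _.
  by rewrite aE.
have bF k k' : bounded_measurable (fun w =>
    \1_B w * cos (u k k' w + edot (tau k k') (list_sum (Y := Y) r w))).
  apply: bounded_measurableM; first exact: bounded_measurable_indic.
  exact: bounded_measurable_cos.
have point w : \1_(B `&` D) w <= c * (\sum_(k : K) \sum_(k' : K)
    \1_B w * cos (u k k' w + edot (tau k k') (list_sum (Y := Y) r w))).
  under eq_bigr do rewrite -mulr_sumr; rewrite -mulr_sumr -FE.
  have F0 : 0 <= F w by rewrite addr_ge0// sqr_ge0.
  rewrite indicE; case: (boolP (w \in B `&` D)) => [|_]; last first.
    by rewrite mulr_ge0// mulr_ge0// indicE ler0n.
  rewrite in_setI => /andP[wB wD]; rewrite indicE wB mul1r /=.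
  have acos k : 2^-1 <= cos (a k w).
    apply: cos_ge_half; rewrite /a normrM ger0_norm//.
    rewrite (le_trans _ eh)// ler_wpM2l// /edot.
    rewrite (le_trans (ler_norm_sum _ _ _))//.
    apply: (@le_trans _ _ (\sum_(j < d) N.+1%:R * h)).
      apply: ler_sum => j _; rewrite !mxE normrM ler_pM//.
        by rewrite ger0_norm// ler_nat ltnW.
      have := wD; rewrite inE => /(_ j); rewrite !mxE ler_norml => /andP[h1 h2].
      by apply/andP; split; lra.
    by rewrite sumr_const card_ord -[leLHS]mulr_natr mulrAC.
  have h1 : N.+1%:R ^+ d * 2^-1 <= \sum_(k : K) cos (a k w).
    rewrite -cardK mulr_natl -sumr_const; exact: ler_sum.
  have h2 : (N.+1%:R ^+ d * 2^-1) ^+ 2 <= F w.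
    have p0 : 0 <= (N.+1%:R ^+ d * 2^-1 : R) by rewrite mulr_ge0// ltW.
    by rewrite /F -[leLHS]addr0 lerD ?sqr_ge0// ler_pXn2r ?nnegrE// (le_trans p0 h1).
  apply: (le_trans _ (ler_wpM2l c0 h2)).
  rewrite /c exprMn; set M := _ ^+ d; rewrite (_ : 4 * _ * _ = 1)//.
  by field; rewrite gt_eqF.
have mI : measurable (B `&` D) by exact: measurableI.
rewrite -mean_indic//.
apply: (@le_trans _ _ (\int[P]_w (c * (\sum_(k : K) \sum_(k' : K)
    \1_B w * cos (u k k' w + edot (tau k k') (list_sum (Y := Y) r w)))))).
  apply: le_mean => //; first exact: bounded_measurable_indic.
  apply: bounded_measurableM; first exact: bounded_measurable_cst.
  by apply: bounded_measurable_sum => k; exact: bounded_measurable_sum.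
rewrite meanZ; last by apply: bounded_measurable_sum => k; exact: bounded_measurable_sum.
rewrite mean_sum; last by move=> k; exact: bounded_measurable_sum.
rewrite /c -!mulrA ler_pM2l// [leRHS]mulrCA ler_pM2l ?invr_gt0 ?exprn_gt0//.
rewrite mulr_sumr; apply: ler_sum => k _; rewrite mean_sum//.
rewrite mulr_sumr; apply: ler_sum => k' _.
by apply: (fourier_decay copiesY s).
Qed.

End Fejer.

(** * Truncated second moment and decay of the characteristic function *)

Section MeasurableComparison.
Context {disp : measure_display} {T : measurableType disp} {R : realType}.
Implicit Types (f g : T -> R).

Lemma measurable_set_lt f g : measurable_fun setT f -> measurable_fun setT g ->
  measurable [set w | f w < g w].
Proof.
move=> mf mg; rewrite -[X in measurable X]setTI.
by apply: (measurable_fun_ltr mf mg) => //; exact: (_ : measurable [set true]).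
Qed.

Lemma measurable_set_le f g : measurable_fun setT f -> measurable_fun setT g ->
  measurable [set w | f w <= g w].
Proof.
move=> mf mg; rewrite -[X in measurable X]setTI.
by apply: (measurable_fun_ler mf mg) => //; exact: (_ : measurable [set true]).
Qed.

End MeasurableComparison.

Section TruncatedMoment.
Context {disp : measure_display} {T : measurableType disp} {R : realType}
  {d : nat} {P : probability T R} {X : {RV P >-> borel_rV R d}}.
Implicit Types (t u v : 'rV[R]_d) (y z : R).

Local Notation tail := (tail_prob P X).

Lemma measurable_enorm_rv (Z : {RV P >-> borel_rV R d}) :
  measurable_fun setT (fun w => enorm (Z w)).
Proof. by apply: (measurableT_comp borel_enorm); exact: measurable_funP. Qed.

Lemma measurable_edot_rv t (Z : {RV P >-> borel_rV R d}) :
  measurable_fun setT (fun w => edot t (Z w)).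
Proof. by apply: (measurableT_comp (borel_edot t)); exact: measurable_funP. Qed.

Lemma measurable_tail y : measurable [set w | y < enorm (X w)].
Proof.
by apply: measurable_set_lt; [exact: measurable_cst|exact: measurable_enorm_rv].
Qed.

Definition truncated_moment y := \int[P]_w Order.min (enorm (X w) ^+ 2) (y ^+ 2).
Local Notation Phi := truncated_moment.

Lemma bounded_measurable_min_sqr y :
  bounded_measurable (fun w => Order.min (enorm (X w) ^+ 2) (y ^+ 2)).
Proof.
split.
  apply: measurable_minr; last exact: measurable_cst.
  exact/measurable_funX/measurable_enorm_rv.
exists (y ^+ 2) => w; rewrite ger0_norm ?ge_min ?lexx ?orbT//.
by rewrite le_min !sqr_ge0.
Qed.

Lemma tail_ge0 y : 0 <= tail y.
Proof. exact: fineP_ge0. Qed.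

Lemma tail_le1 y : tail y <= 1.
Proof. exact/fineP_le1/measurable_tail. Qed.

Lemma tail_noninc y z : z <= y -> tail y <= tail z.
Proof.
move=> zy; apply: fineP_le => [||w /=]; try exact: measurable_tail.
exact: le_lt_trans.
Qed.

Lemma mean_indic_tail y : \int[P]_w (\1_[set w | y < enorm (X w)] w) = tail y.
Proof. exact/mean_indic/measurable_tail. Qed.

Lemma indic_tailE y w : \1_[set w | y < enorm (X w)] w = (y < enorm (X w))%R%:R :> R.
Proof. by rewrite indicE mem_setE. Qed.

Let bm_indic y : bounded_measurable (\1_[set w | y < enorm (X w)] : T -> R).
Proof. exact/bounded_measurable_indic/measurable_tail. Qed.

Let bm_tail c y : bounded_measurable (fun w => c * \1_[set w | y < enorm (X w)] w : R).
Proof.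
apply: bounded_measurableM; first exact: bounded_measurable_cst.
exact/bounded_measurable_indic/measurable_tail.
Qed.

(** Between the caps y and 2 y only the values of |X| above y contribute, each
at most 4 y^2 - y^2. *)
Lemma truncated_moment_double_le y : 0 < y -> Phi (2 * y) <= Phi y + 3 * y ^+ 2 * tail y.
Proof.
move=> y0; have bt := bm_indic y.
rewrite -mean_indic_tail -(meanZ _ _ _ bt) -(meanD _ _ _ (bounded_measurable_min_sqr _) (bm_tail _ _)).
apply: le_mean => [||w]; first exact: bounded_measurable_min_sqr.
  by apply: bounded_measurableD; [exact: bounded_measurable_min_sqr|exact: bm_tail].
rewrite indic_tailE; have := enorm_ge0 (X w); move: (enorm (X w)) => x x0.
have [yx|xy] := ltP y x; rewrite ?mulr1 ?mulr0 ?addr0 !minEle.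
  by do 2 case: ifP => ?; nra.
rewrite [X in _ <= X]ifT; last by nra.
by case: ifP => //; nra.
Qed.

(** Each value of |X| above 2 y contributes the full 4 y^2 - y^2. *)
Lemma truncated_moment_double_ge y : 0 < y -> Phi y + 3 * y ^+ 2 * tail (2 * y) <= Phi (2 * y).
Proof.
move=> y0; have bt := bm_indic (2 * y).
rewrite -mean_indic_tail -(meanZ _ _ _ bt) -(meanD _ _ _ (bounded_measurable_min_sqr _) (bm_tail _ _)).
apply: le_mean => [||w]; last first.
  rewrite indic_tailE; have := enorm_ge0 (X w); move: (enorm (X w)) => x x0.
  have [yx|xy] := ltP (2 * y) x; rewrite ?mulr1 ?mulr0 ?addr0 !minEle.
    by do 2 case: ifP => ?; nra.
  by do 2 case: ifP => ?; nra.
  exact: bounded_measurable_min_sqr.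
by apply: bounded_measurableD; [exact: bounded_measurable_min_sqr|exact: bm_tail].
Qed.

Lemma sqr_tail_le y : 0 < y -> y ^+ 2 * tail y <= Phi y.
Proof.
move=> y0; have bt := bm_indic y.
rewrite -mean_indic_tail -(meanZ _ _ _ bt); apply: le_mean => [||w]; first exact: bm_tail.
  exact: bounded_measurable_min_sqr.
rewrite indic_tailE; have := enorm_ge0 (X w); move: (enorm (X w)) => x x0.
have [yx|xy] := ltP y x; rewrite ?mulr1 ?mulr0 le_min ?sqr_ge0// lexx andbT; nra.
Qed.

Lemma truncated_moment_ge0 y : 0 <= Phi y.
Proof. by apply: mean_ge0 => w; rewrite le_min !sqr_ge0. Qed.

Lemma truncated_moment_le y : Phi y <= y ^+ 2.
Proof.
rewrite -[leRHS](mean_cst P); apply: le_mean => [||w].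
- exact: bounded_measurable_min_sqr.
- exact: bounded_measurable_cst.
- by rewrite ge_min lexx orbT.
Qed.

Lemma truncated_moment_homo y z : 0 <= z -> z <= y -> Phi z <= Phi y.
Proof.
move=> z0 zy; apply: le_mean => [||w]; try exact: bounded_measurable_min_sqr.
by rewrite le_min !ge_min lexx /= orbC ler_pXn2r ?nnegrE ?zy//; lra.
Qed.

(** The normalized truncated second moment, which governs both the tails of
the sums and the decay of the characteristic function. *)
Definition tail_rate y := Phi y / y ^+ 2.

Lemma tail_rate_ge0 y : 0 <= tail_rate y.
Proof. by rewrite divr_ge0 ?truncated_moment_ge0 ?sqr_ge0. Qed.

Lemma tail_rate_noninc y z : 0 < z -> z <= y -> tail_rate y <= tail_rate z.
Proof.
move=> z0 zy; have y0 : 0 < y by lra.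
rewrite /tail_rate ler_pdivrMr ?exprn_gt0// mulrAC ler_pdivlMr ?exprn_gt0//.
rewrite mulrC [leRHS]mulrC -!(meanZ _ _ _ (bounded_measurable_min_sqr _)).
apply: le_mean => [||w].
- by apply: bounded_measurableM; [exact: bounded_measurable_cst|exact: bounded_measurable_min_sqr].
- by apply: bounded_measurableM; [exact: bounded_measurable_cst|exact: bounded_measurable_min_sqr].
have zy2 : z ^+ 2 <= y ^+ 2 by rewrite ler_pXn2r ?nnegrE//; lra.
have := sqr_ge0 (enorm (X w)); move: (enorm (X w) ^+ 2) => x x0.
have := sqr_ge0 z; move: (z ^+ 2) (y ^+ 2) zy2 => a b ab a0.
by rewrite !minEle; do 2 case: ifP => ?; nra.
Qed.

Lemma tail_le_rate y : 0 < y -> tail y <= tail_rate y.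
Proof. by move=> y0; rewrite ler_pdivlMr ?exprn_gt0// mulrC sqr_tail_le. Qed.

(** The truncated moment is nondecreasing, so only its normalization grows. *)
Lemma tail_rate_scale y k : 0 < y -> 1 <= k -> tail_rate (y / k) <= k ^+ 2 * tail_rate y.
Proof.
move=> y0 k1; have k0 : 0 < k by lra.
have h : Phi (y / k) <= Phi y.
  by rewrite truncated_moment_homo ?ler_pdivrMr ?ler_peMr ?divr_ge0// ltW.
have -> : tail_rate (y / k) = k ^+ 2 * (Phi (y / k) / y ^+ 2).
  by rewrite /tail_rate; field; rewrite !gt_eqF.
by rewrite ler_wpM2l ?sqr_ge0// ler_wpM2r ?invr_ge0 ?sqr_ge0.
Qed.

End TruncatedMoment.

Section FourierLower.
Context {disp : measure_display} {T : measurableType disp} {R : realType}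
  {d : nat} {P : probability T R} {X : {RV P >-> borel_rV R d}}
  {Y : nat -> {RV P >-> borel_rV R d}}.
Hypothesis copiesY : independent_copies P X Y.
Implicit Types (t u v x z : 'rV[R]_d) (y : R).

Local Notation tail := (tail_prob P X).
Local Notation Phi := (truncated_moment (P := P) (X := X)).

(** The form in which nondegeneracy enters: uniformly in the unit vector u, every
dyadic shell carries a fixed proportion of the tail in directions that stay away
from the hyperplane orthogonal to u.  One constant bounds both the mass and the
angle. *)
Definition directional_mass (kappa s0 : R) :=
  forall u, enorm u = 1 -> forall s, s0 <= s ->
    tail s <= kappa * fine (P [set w | [/\ s < enorm (X w), enorm (X w) <= 2 * s
                                & enorm (X w) <= kappa * `|edot u (X w)| ] ]).

(** The phase t.(x - z) is at most 1 in absolute value, so that 1 - cos v is at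
least v^2 / 4 there, and z is too small to cancel more than half of t.x. *)
Lemma one_sub_cos_edot_lower t x z (kappa M : R) : 0 < enorm t -> 0 < kappa ->
  enorm x * enorm t <= kappa * `|edot t x| ->
  2 * kappa * M <= enorm x -> 2 * enorm x <= (enorm t)^-1 ->
  enorm z <= M -> 2 * M <= (enorm t)^-1 ->
  (enorm t ^+ 2 / (16 * kappa ^+ 2)) * enorm x ^+ 2 <= 1 - cos (edot t x - edot t z).
Proof.
move=> t0 k0 xt Mx xr zM Mr.
have tz : `|edot t z| <= enorm t * M.
  by rewrite (le_trans (norm_edot_le _ _))// ler_wpM2l// ltW.
have M0 : 0 <= M by rewrite (le_trans (enorm_ge0 z)).
have tx := norm_edot_le t x.
have r1 : enorm t * (2 * enorm x) <= 1 by rewrite -ler_pdivlMl// mulr1.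
have r2 : enorm t * (2 * M) <= 1 by rewrite -ler_pdivlMl// mulr1.
have big : 2 * M * enorm t <= `|edot t x|.
  rewrite -(ler_pM2l k0) (le_trans _ xt)// (le_trans _ (ler_wpM2r (ltW t0) Mx))//.
  by rewrite le_eqVlt; apply/orP; left; apply/eqP; ring.
have le1 : `|edot t x - edot t z| <= 1.
  by rewrite (le_trans (ler_normB _ _))//; lra.
apply: le_trans (cos_le_parabola _ le1).
have low : `|edot t x| / 2 <= `|edot t x - edot t z|.
  by have := lerB_dist (edot t x) (edot t z); lra.
have low2 : enorm x * enorm t <= 2 * kappa * `|edot t x - edot t z|.
  by rewrite (le_trans xt)//; nra.
rewrite -[(edot t x - _) ^+ 2]real_normK ?num_real//.
move: (`|edot t x - _|) low2 => e low2.
have xt0 : 0 <= enorm x * enorm t by rewrite mulr_ge0 ?enorm_ge0.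
have h : (enorm x * enorm t) ^+ 2 <= (2 * kappa * e) ^+ 2.
  by rewrite ler_pXn2r ?nnegrE//; lra.
have -> : enorm t ^+ 2 / (16 * kappa ^+ 2) * enorm x ^+ 2 =
    (enorm x * enorm t) ^+ 2 / (16 * kappa ^+ 2) by ring.
rewrite ler_pdivrMr ?mulr_gt0 ?exprn_gt0//.
by rewrite (le_trans h)// le_eqVlt; apply/orP; left; apply/eqP; field.
Qed.

(** Symmetrization: 1 - |phi|^2 is the mean of a nonnegative function, which can
be bounded below on convenient events. *)
Lemma sqr_chf_symmetrize t :
  \int[P]_w (1 - cos (edot t (Y 0%N w) - edot t (Y 1%N w))) = 1 - sqr_chf (X := X) t.
Proof.
have bc := @bounded_measurable_cos_edot R d t.
have bs := @bounded_measurable_sin_edot R d t.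
have bZ i (g : borel_rV R d -> R) : bounded_measurable g -> bounded_measurable (g \o Y i).
  by case=> mg [M gM]; split; [exact: measurableT_comp|exists M => w; exact: gM].
have bA i (g : borel_rV R d -> R) : bounded_measurable g ->
    bounded_measurable (g \o Y i : coordinate_algebra P Y [fset i]%fset -> R).
  case=> mg [M gM]; split; last by exists M => w; exact: gM.
  by apply: (measurableT_comp mg); apply: coordinate_measurable; rewrite inE.
have step (g : borel_rV R d -> R) : bounded_measurable g ->
    \int[P]_w (g (Y 0%N w) * g (Y 1%N w)) = (\int[P]_w g (X w)) ^+ 2.
  move=> bg; rewrite (mean_independent P Y copiesY.1 [fset 0%N]%fset 1 (g \o Y 0%N))//.
  - by rewrite /= !(mean_copy copiesY)// expr2.
  - by rewrite inE.
  - exact: bA.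
have bcc : bounded_measurable (fun w => cos (edot t (Y 0%N w)) * cos (edot t (Y 1%N w))).
  by apply: bounded_measurableM; exact: (bZ _ _ bc).
have bss : bounded_measurable (fun w => sin (edot t (Y 0%N w)) * sin (edot t (Y 1%N w))).
  by apply: bounded_measurableM; exact: (bZ _ _ bs).
rewrite meanB ?mean_cst; [|exact: bounded_measurable_cst|].
  congr (_ - _); rewrite /sqr_chf /cos_mean /sin_mean.
  rewrite -(step _ bc) -(step _ bs) -meanD//.
  by apply: eq_Rintegral => w _; rewrite cosB.
by under eq_fun do rewrite cosB; exact: bounded_measurableD.
Qed.

Definition visible (kappa s y : R) u : set (borel_rV R d) :=
  [set x : borel_rV R d | [/\ s < enorm x, enorm x <= y & enorm x <= kappa * `|edot u x| ] ].

Lemma measurable_visible kappa s y u : measurable (visible kappa s y u).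
Proof.
rewrite (_ : visible _ _ _ _ =
  [set x : borel_rV R d | s < enorm x] `&` [set x : borel_rV R d | enorm x <= y]
  `&` [set x : borel_rV R d | enorm x <= kappa * `|edot u x|]); last first.
  by apply/seteqP; split => [x []|x [[]]].
have me := @borel_enorm R d.
apply: measurableI; first apply: measurableI.
- by apply: measurable_set_lt => //; exact: measurable_cst.
- by apply: measurable_set_le => //; exact: measurable_cst.
- apply: measurable_set_le => //; apply: measurable_funM; first exact: measurable_cst.
  by apply: measurableT_comp => //; exact: borel_edot.
Qed.

Definition visible_sqr (kappa s y : R) u (x : borel_rV R d) : R :=
  \1_(visible kappa s y u) x * enorm x ^+ 2.

Lemma bounded_measurable_visible_sqr kappa s y u :
  bounded_measurable (visible_sqr kappa s y u).
Proof.
split.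
  apply: measurable_funM; first by apply: measurable_indic; exact: measurable_visible.
  by apply: measurable_funX; exact: borel_enorm.
exists (y ^+ 2) => x; rewrite /visible_sqr indicE.
case: (boolP (x \in _)) => [|_]; rewrite ?mul1r ?mul0r ?normr0 ?sqr_ge0//.
rewrite inE => -[_ xy _]; rewrite ger0_norm ?sqr_ge0//.
by rewrite ler_pXn2r ?nnegrE ?enorm_ge0// (le_trans _ xy) ?enorm_ge0.
Qed.

Lemma visible_sqr_ge0 kappa s y u x : 0 <= visible_sqr kappa s y u x.
Proof. by rewrite mulr_ge0 ?sqr_ge0// indicE ler0n. Qed.

(** The visible part of the truncated second moment grows over each dyadic
shell at least as fast as a multiple of the full one. *)
Lemma visible_moment_lower kappa s : 0 < kappa -> 0 < s -> 0 < tail s ->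
  directional_mass kappa s ->
  exists2 c, 0 < c & forall u y, enorm u = 1 -> 2 * s <= y ->
    c * Phi y <= \int[P]_w visible_sqr kappa s y u (X w).
Proof.
move=> k0 s0 ts dir.
pose c := Order.min (3 * kappa)^-1 (tail s / (16 * kappa)).
have c0 : 0 < c by rewrite lt_min invr_gt0 divr_gt0 ?mulr_gt0.
have [c1 c2] : c <= (3 * kappa)^-1 /\ c <= tail s / (16 * kappa).
  by split; rewrite ge_min lexx ?orbT.
exists c => // u y u1.
have bV y' : bounded_measurable (fun w => visible_sqr kappa s y' u (X w)).
  case: (bounded_measurable_visible_sqr kappa s y' u) => mV [M VM].
  by split; [exact: measurableT_comp|exists M => w; exact: VM].
pose shell y' := X @^-1` visible kappa y' (2 * y') u.
have mS y' : measurable (shell y').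
  by rewrite -[shell _]setTI; apply: measurable_funP => //; exact: measurable_visible.
have shellE y' : s <= y' -> tail y' <= kappa * fine (P (shell y')).
  by move=> /(dir u u1).
have bI y' : bounded_measurable (\1_(shell y') : T -> R) by exact: bounded_measurable_indic.
have bI' c' y' : bounded_measurable (fun w => c' * \1_(shell y') w : R).
  by apply: bounded_measurableM => //; exact: bounded_measurable_cst.
have grow y' : s <= y' ->
    \int[P]_w visible_sqr kappa s y' u (X w) + y' ^+ 2 * fine (P (shell y')) <=
    \int[P]_w visible_sqr kappa s (2 * y') u (X w).
  move=> sy'; rewrite -mean_indic// -(meanZ _ _ _ (bI y')) -(meanD _ _ _ (bV y') (bI' _ _)).
  apply: le_mean => // [|w]; first exact: bounded_measurableD.
  rewrite /visible_sqr !indicE; have x0 := enorm_ge0 (X w).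
  have [h1|h1] := boolP (X w \in visible kappa s y' u).
    have [h2|h2] := boolP (w \in shell y').
      by move: h1 h2; rewrite !inE => -[_ h1 _] [h2 _ _]; lra.
    rewrite mulr0 addr0 (_ : X w \in visible _ _ (2 * y') _)//.
    by move: h1; rewrite !inE => -[? ? ?]; split=> //; lra.
  have [h2|h2] := boolP (w \in shell y'); last first.
    by rewrite mulr0 mul0r addr0 mulr_ge0 ?sqr_ge0// ler0n.
  have -> : X w \in visible kappa s (2 * y') u.
    by move: h2; rewrite !inE => -[? ? ?]; split=> //; lra.
  rewrite mul0r add0r mulr1 mul1r; move: h2; rewrite inE => -[h _ _].
  by rewrite ler_pXn2r ?nnegrE//; lra.
have mono y' y'' : y' <= y'' -> \int[P]_w visible_sqr kappa s y' u (X w) <=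
    \int[P]_w visible_sqr kappa s y'' u (X w).
  move=> yy; apply: le_mean => // w; rewrite /visible_sqr ler_wpM2r ?sqr_ge0// !indicE.
  have [h1|_] := boolP (X w \in visible kappa s y' u); last by rewrite ler0n.
  rewrite (_ : X w \in visible _ _ y'' _)//.
  by move: h1; rewrite !inE => -[? ? ?]; split=> //; lra.
have V0 y' : 0 <= \int[P]_w visible_sqr kappa s y' u (X w).
  by apply: mean_ge0 => w; exact: visible_sqr_ge0.
move: y; apply: (doubling_ind _ (2 * s)); first by rewrite mulr_gt0.
- move=> y /andP[y1 y2]; apply: le_trans (mono _ _ y1); apply: le_trans (grow s (lexx s)).
  have h1 := truncated_moment_le (P := P) (X := X) y.
  have h2 : Phi y <= 16 * s ^+ 2 by nra.
  have h3 := shellE s (lexx s).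
  have h4 : c * Phi y <= tail s / (16 * kappa) * (16 * s ^+ 2).
    by apply: ler_pM => //; [exact: ltW|exact: truncated_moment_ge0].
  have e : tail s / (16 * kappa) * (16 * s ^+ 2) = s ^+ 2 * (tail s / kappa).
    by field; rewrite gt_eqF.
  rewrite e in h4.
  have h5 : tail s / kappa <= fine (P (shell s)) by rewrite ler_pdivrMr// mulrC.
  rewrite (le_trans h4)// ler_wpDl ?V0// ler_wpM2l ?sqr_ge0//.
- move=> y sy IH; have sy' : s <= y by lra.
  apply: le_trans (grow y sy').
  have y0 : 0 < y by lra.
  have h1 := truncated_moment_double_le (P := P) (X := X) y y0.
  have h2 : tail y / kappa <= fine (P (shell y)) by rewrite ler_pdivrMr// mulrC shellE.
  have h3 : c * (3 * y ^+ 2 * tail y) <= y ^+ 2 * (tail y / kappa).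
    have -> : y ^+ 2 * (tail y / kappa) = (3 * kappa)^-1 * (3 * y ^+ 2 * tail y).
      by field; rewrite gt_eqF.
    apply: ler_wpM2r => //; rewrite mulr_ge0 ?tail_ge0// mulr_ge0 ?sqr_ge0//.
  have h4 : y ^+ 2 * (tail y / kappa) <= y ^+ 2 * fine (P (shell y)).
    by rewrite ler_wpM2l ?sqr_ge0.
  have h5 := ler_wpM2l (ltW c0) h1.
  by rewrite mulrDr in h5; lra.
Qed.

(** One of the two independent copies is kept in a ball that carries half of the
mass, the other one ranges over the visible part of the ball of radius
1 / (2 |t|). *)
Lemma fourier_lower kappa s0 M : 0 < kappa -> 0 < s0 ->
  (forall s, 0 < tail s) -> tail M <= 2^-1 ->
  directional_mass kappa s0 ->
  exists2 c, 0 < c & exists2 delta, 0 < delta &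
    forall t, 0 < enorm t -> enorm t <= delta ->
      c * tail_rate (P := P) (X := X) (enorm t)^-1 <= 1 - sqr_chf (X := X) t.
Proof.
move=> k0 s00 ts tM dir.
(* Beyond the radius s the visible copy dominates the one kept in the ball of
   radius M. *)
pose s := s0 + 2 * kappa * `|M| + `|M|.
have M0 := normr_ge0 M.
have kM0 : 0 <= kappa * `|M| by rewrite mulr_ge0// ltW.
have s_gt0 : 0 < s by rewrite /s; nra.
have dirs : directional_mass kappa s.
  by move=> u u1 s' ss'; apply: dir => //; rewrite (le_trans _ ss')// /s; nra.
have [c1 c10 vis] := visible_moment_lower _ _ k0 s_gt0 (ts s) dirs.
exists (c1 / (128 * kappa ^+ 2)); first by rewrite divr_gt0 ?mulr_gt0 ?exprn_gt0.
exists (4 * s)^-1; first by rewrite invr_gt0 mulr_gt0.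
move=> t t0 td; pose rho := (enorm t)^-1.
have rho0 : 0 < rho by rewrite invr_gt0.
have rho4 : 4 * s <= rho by rewrite -[4 * s]invrK lef_pV2 ?posrE ?invr_gt0 ?mulr_gt0.
pose u := rho *: t.
have u1 : enorm u = 1 by rewrite enormZ ger0_norm ?ltW// mulVf// gt_eqF.
pose G := visible_sqr kappa s (rho / 2) u.
pose D := [set x : borel_rV R d | enorm x <= `|M|].
have mD : measurable D.
  by apply: measurable_set_le; [exact: borel_enorm|exact: measurable_cst].
have bG : bounded_measurable G by exact: bounded_measurable_visible_sqr.
have bD : bounded_measurable (\1_D : borel_rV R d -> R) by exact: bounded_measurable_indic.
have bZ i (g : borel_rV R d -> R) : bounded_measurable g -> bounded_measurable (g \o Y i).
  by case=> mg [K gK]; split; [exact: measurableT_comp|exists K => w; exact: gK].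
pose q := enorm t ^+ 2 / (16 * kappa ^+ 2).
have q0 : 0 < q by rewrite divr_gt0 ?mulr_gt0 ?exprn_gt0.
have bGD : bounded_measurable (fun w => G (Y 0%N w) * \1_D (Y 1%N w)).
  by apply: bounded_measurableM; [exact: (bZ _ _ bG)|exact: (bZ _ _ bD)].
have bcos : bounded_measurable (fun w => 1 - cos (edot t (Y 0%N w) - edot t (Y 1%N w))).
  apply: bounded_measurableB; first exact: bounded_measurable_cst.
  apply: bounded_measurable_cos; apply: measurable_funB; exact: measurable_edot_rv.
have point w : q * (G (Y 0%N w) * \1_D (Y 1%N w)) <=
    1 - cos (edot t (Y 0%N w) - edot t (Y 1%N w)).
  have cos0 : 0 <= 1 - cos (edot t (Y 0%N w) - edot t (Y 1%N w)).
    by rewrite subr_ge0 cos_le1.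
  rewrite /G /visible_sqr !indicE.
  have [|_] := boolP (Y 1%N w \in D); last by rewrite !mulr0.
  have [|_] := boolP (Y 0%N w \in _); last by rewrite !mul0r mulr0.
  rewrite !inE mulr1 mul1r => -[h1 h2 h3] h4.
  apply: (one_sub_cos_edot_lower _ _ _ _ `|M|) => //.
  - by move: h3; rewrite edotZl normrM (gtr0_norm rho0) /rho mulrCA ler_pdivlMl// mulrC.
  - by rewrite /s in h1; lra.
  - by rewrite -/rho; lra.
  - by rewrite -/rho; rewrite /s in rho4; lra.
have main : q * (\int[P]_w G (X w) * \int[P]_w \1_D (X w)) <= 1 - sqr_chf (X := X) t.
  rewrite -sqr_chf_symmetrize -(mean_copy copiesY 0%N G)// -(mean_copy copiesY 1%N (\1_D))//.
  have bA : bounded_measurable (G \o Y 0%N : coordinate_algebra P Y [fset 0%N]%fset -> R).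
    case: bG => mg [K gK]; split; last by exists K => w; exact: gK.
    by apply: (measurableT_comp mg); apply: coordinate_measurable; rewrite inE.
  rewrite -(mean_independent P Y copiesY.1 [fset 0%N]%fset 1%N (G \o Y 0%N) (\1_D))//.
    by rewrite -(meanZ _ _ _ bGD); apply: le_mean => //; apply: bounded_measurableM => //; exact: bounded_measurable_cst.
  by rewrite inE.
have half : 2^-1 <= \int[P]_w \1_D (X w).
  have -> : \int[P]_w \1_D (X w) = 1 - tail `|M|.
    rewrite -(mean_cst P 1) -mean_indic_tail -meanB.
    - apply: eq_Rintegral => w _; rewrite !indicE.
      have [h|h] := leP (enorm (X w)) `|M|.
        by rewrite mem_set// memNset ?subr0// => /=; rewrite ltNge h.
      by rewrite memNset ?mem_set ?subrr// => /=; rewrite /D /= leNgt h.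
    - exact: bounded_measurable_cst.
    - exact/bounded_measurable_indic/measurable_tail.
  by have := tail_noninc (P := P) (X := X) _ _ (ler_norm M); lra.
apply: le_trans main.
have G0 : c1 * Phi (rho / 2) <= \int[P]_w G (X w) by apply: vis => //; lra.
have Phi4 : Phi rho / 4 <= Phi (rho / 2).
  have := tail_rate_noninc (P := P) (X := X) rho (rho / 2) _ _.
  rewrite /tail_rate !divr_gt0// => /(_ isT) h.
  have {}h := h ltac:(lra).
  have e : Phi rho / rho ^+ 2 = (Phi rho / 4) / (rho / 2) ^+ 2.
    by field; rewrite gt_eqF.
  by move: h; rewrite e ler_pM2r// invr_gt0 exprn_gt0// divr_gt0.
have P0 := truncated_moment_ge0 (P := P) (X := X) rho.
have -> : c1 / (128 * kappa ^+ 2) * tail_rate (P := P) (X := X) (enorm t)^-1 =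
    q * (c1 * (Phi rho / 4) * 2^-1).
  by rewrite /q /tail_rate -/rho /rho; field; rewrite !gt_eqF.
rewrite ler_pM2l// ler_pM//.
- by rewrite mulr_ge0 ?divr_ge0// ltW.
- by rewrite (le_trans _ G0)// ler_pM2l.
Qed.

End FourierLower.

(** * The concentration function of a sum of n vectors is of order a_n^-d *)

Section LatticeSum.
Context {R : realType}.

(** Each term is at most the difference of the reciprocals of consecutive
distances, so that the sum telescopes on both sides of k. *)
Lemma sum_inv_sqr_dist (k M : nat) :
  \sum_(i < M) (1 + `|k%:R - i%:R : R|) ^- 2 <= 3.
Proof.
have left_ j : (j <= k)%N -> \sum_(i < j) (1 + `|k%:R - i%:R : R|) ^- 2 <= (1 + k%:R - j%:R)^-1.
  elim: j => [_|j IH jk]; first by rewrite big_ord0 invr_ge0 subr0 addr_ge0.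
  rewrite big_ord_recr /= (le_trans (lerD (IH (ltnW jk)) (lexx _)))//.
  have h : (j%:R + 1 <= k%:R :> R) by rewrite -[1]/(1%:R) -natrD ler_nat addn1.
  rewrite ger0_norm; last lra.
  rewrite -natr1; set a : R := 1 + k%:R - j%:R.
  have -> : 1 + (k%:R - j%:R) = a by rewrite /a; ring.
  have -> : 1 + k%:R - (j%:R + 1) = a - 1 by rewrite /a; ring.
  have a2 : 2 <= a by rewrite /a; lra.
  have -> : a^-1 + a ^- 2 = (a + 1) / a ^+ 2 by field; lra.
  rewrite ler_pdivrMr ?exprn_gt0//; last lra.
  rewrite mulrC ler_pdivlMr; last lra.
  nra.
have right_ j : \sum_(i < k + j.+1) (1 + `|k%:R - i%:R : R|) ^- 2 <= 3 - j.+1%:R^-1.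
  elim: j => [|j IH].
    rewrite addn1 big_ord_recr /= subrr normr0 addr0 expr1n.
    by have := left_ k (leqnn k); rewrite addrK; lra.
  rewrite addnS big_ord_recr /= (le_trans (lerD IH (lexx _)))//.
  rewrite natrD opprD addrA subrr sub0r normrN ger0_norm// -(natr1 j.+1).
  move: (j.+1%:R : R) (ltr0Sn R j) => b b0.
  have -> : 3 - b^-1 + (1 + b) ^- 2 = 3 - (b^-1 - (1 + b) ^- 2) by ring.
  rewrite lerD2l lerN2 -subr_ge0.
  have -> : b^-1 - (1 + b) ^- 2 - (b + 1)^-1 = (b * (1 + b) ^+ 2)^-1.
    by field; rewrite !gt_eqF//; lra.
  by rewrite invr_ge0 mulr_ge0 ?sqr_ge0// ltW.
have [Mk|kM] := leqP M k.
  rewrite (le_trans (left_ M Mk))//.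
  have h : (M%:R <= k%:R :> R) by rewrite ler_nat.
  by rewrite invf_ple ?posrE//; lra.
have -> : M = (k + (M - k.+1).+1)%N by rewrite addnS -addSn subnKC.
rewrite (le_trans (right_ _))// lerBlDr lerDl invr_ge0//.
Qed.

Lemma lattice_sum {d N} (k : {ffun 'I_d -> 'I_N}) :
  \sum_(k' : {ffun 'I_d -> 'I_N})
     \prod_(j < d) (1 + `|(k j : nat)%:R - (k' j : nat)%:R : R|) ^- 2 <= 3 ^+ d.
Proof.
rewrite -(bigA_distr_bigA (fun (j : 'I_d) (i : 'I_N) => (1 + `|(k j : nat)%:R - (i : nat)%:R : R|) ^- 2)).
rewrite (_ : 3 ^+ d = \prod_(j < d) (3 : R)); last by rewrite prodr_const card_ord.
apply: ler_prod => j _; apply/andP; split; last exact: sum_inv_sqr_dist.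
by apply: sumr_ge0 => i _; rewrite invr_ge0 exprn_ge0// addr_ge0.
Qed.

Lemma inv_pow_le_prod {d} (x : 'rV[R]_d) :
  (1 + enorm x) ^- (2 * d) <= \prod_(j < d) (1 + `|x ord0 j|) ^- 2.
Proof.
rewrite exprM -exprVn (_ : _ ^+ d = \prod_(j < d) (1 + enorm x) ^- 2); last first.
  by rewrite prodr_const card_ord.
apply: ler_prod => j _; have := coord_le_enorm x j; have := normr_ge0 (x ord0 j).
move=> h0 h1; rewrite invr_ge0 exprn_ge0 ?lef_pV2 ?posrE ?exprn_gt0//=; try lra.
by rewrite ler_pXn2r ?nnegrE//; lra.
Qed.

End LatticeSum.

Section ConcentrationRate.
Context {disp : measure_display} {T : measurableType disp} {R : realType}
  {d : nat} {P : probability T R} {X : {RV P >-> borel_rV R d}}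
  {Y : nat -> {RV P >-> borel_rV R d}}.
Hypothesis copiesY : independent_copies P X Y.

Local Notation V := (tail_rate (P := P) (X := X)).

Lemma sqr_chf_le1 t : sqr_chf (X := X) t <= 1.
Proof.
rewrite -subr_ge0 -(sqr_chf_symmetrize copiesY).
by apply: mean_ge0 => w; rewrite subr_ge0 cos_le1.
Qed.

Lemma sqrt_sqr_chf_le t : Num.sqrt (sqr_chf (X := X) t) <= expR (- ((1 - sqr_chf (X := X) t) / 2)).
Proof.
rewrite -[leRHS]gtr0_norm ?expR_gt0// -[leRHS]sqrtr_sqr ler_wsqrtr//.
rewrite -expRM_natr (le_trans _ (expR_ge1Dx _))//.
by rewrite mulNr divfK//; lra.
Qed.

(** For frequencies w of size at most 2 / eta the trivial bound 1 suffices.  For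
the others 1 / |t| <= a_n, and Potter's bound turns the decay
exp (- c n V(1/|t|)) into a power of |w| that is summable over the lattice. *)
Lemma chf_power_le {c delta y0 K c2 : R} {p : nat} {eta an : R} {N n m : nat} (w : 'rV[R]_d) :
  0 < c -> 0 < delta -> 0 < y0 -> y0 <= delta^-1 -> 0 < K -> 0 < c2 ->
  (forall t, 0 < enorm t -> enorm t <= delta -> c * V (enorm t)^-1 <= 1 - sqr_chf (X := X) t) ->
  (forall y, 0 < y -> 0 < V y) ->
  (forall z y, y0 <= z -> z <= y -> V y ^+ p.+1 <= K * (z / y) ^+ (2 * d) * V z ^+ p.+1) ->
  0 < eta -> 1 <= an -> an <= N.+1%:R -> N.+1%:R <= 2 * an -> c2 <= n%:R * V an ->
  (n <= 3 * m)%N -> eta / N.+1%:R * enorm w <= delta ->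
  Num.sqrt (sqr_chf (X := X) ((eta / N.+1%:R) *: w)) ^+ m <=
    ((1 + 2 / eta) ^+ (2 * d) + (6 * p.+1%:R / c / c2) ^+ p.+1 * K * (2 * (1 + 2 / eta)) ^+ (2 * d))
    * (1 + enorm w) ^- (2 * d).
Proof.
move=> c0 del0 y00 y0d K0 c20 lower V0 potter eta0 an1 anN Nan nV nm wd.
set A := (1 + 2 / eta) ^+ (2 * d); set Bc := _ * K * _.
have w0 := enorm_ge0 w; have e2 : 0 < 2 / eta by rewrite divr_gt0.
have A0 : 0 < A by rewrite exprn_gt0//; lra.
have B0 : 0 <= Bc.
  rewrite mulr_ge0 ?exprn_ge0 ?mulr_ge0 ?exprn_ge0 ?divr_ge0 ?mulr_ge0 ?(ltW K0) ?(ltW c0) ?(ltW c20)//; lra.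
have W0 : 0 < (1 + enorm w) ^+ (2 * d) by rewrite exprn_gt0//; lra.
have sq1 : Num.sqrt (sqr_chf (X := X) ((eta / N.+1%:R) *: w)) <= 1.
  by rewrite -sqrtr1 ler_wsqrtr// sqr_chf_le1.
have N0 : (0 : R) < N.+1%:R by rewrite ltr0Sn.
set t := (eta / N.+1%:R) *: w in sq1 *.
have tE : enorm t = eta / N.+1%:R * enorm w by rewrite /t enormZ ger0_norm// divr_ge0// ltW.
have [wsmall|wbig] := leP (enorm w) (2 / eta).
  apply: (@le_trans _ _ 1); first by rewrite exprn_ile1// sqrtr_ge0.
  rewrite ler_pdivlMr// mul1r (le_trans (_ : _ <= A)) ?lerDl//.
  by rewrite lerXn2r ?nnegrE//; lra.
have wpos : 0 < enorm w by lra.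
have t0 : 0 < enorm t by rewrite tE mulr_gt0// divr_gt0.
pose z := (enorm t)^-1.
have z0 : 0 < z by rewrite invr_gt0.
have zE : z = N.+1%:R / (eta * enorm w) by rewrite /z tE; field; rewrite !gt_eqF.
have td : enorm t <= delta by rewrite tE.
have zy0 : y0 <= z by rewrite (le_trans y0d)// lef_pV2.
have za : z <= an.
  rewrite zE ler_pdivrMr ?mulr_gt0//; move: wbig; rewrite ltr_pdivrMr//; nra.
have low := lower t t0 td; rewrite -/z in low.
have Vz := V0 z z0.
have [n0|n0] := eqVneq n 0%N; first by move: nV; rewrite n0 mul0r; lra.
have {}n0 : (0 : R) < n%:R by rewrite ltr0n lt0n.
have nm' : n%:R <= 3 * m%:R :> R by rewrite -natrM ler_nat.
pose U := n%:R * c * V z / 6.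
have U0 : 0 < U by rewrite /U divr_gt0// mulr_gt0// mulr_gt0.
have step1 : Num.sqrt (sqr_chf (X := X) t) ^+ m <= expR (- U).
  rewrite (le_trans (lerXn2r m _ _ (sqrt_sqr_chf_le t))) ?nnegrE ?sqrtr_ge0 ?expR_ge0//.
  rewrite -expRM_natr ler_expR mulNr lerN2 /U.
  have cV : 0 <= c * V z by rewrite mulr_ge0 ?ltW.
  have h := ler_wpM2r cV nm'.
  have m0 : (0 : R) <= m%:R by [].
  have h2 := ler_wpM2r m0 low.
  lra.
rewrite (le_trans step1)// (le_trans (expRN_le_powV p _ U0))//.
apply: (@le_trans _ _ (Bc * (1 + enorm w) ^- (2 * d))); last first.
  by rewrite ler_wpM2r ?invr_ge0 ?(ltW W0)// lerDr ltW.
have -> : p.+1%:R / U = (6 * p.+1%:R / c) / (n%:R * V z).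
  by rewrite /U; field; rewrite !gt_eqF.
have an0 : 0 < an by lra.
have Pz := potter z an zy0 za.
have key : ((n%:R * V z) ^+ p.+1)^-1 <= K * (z / an) ^+ (2 * d) * c2^-1 ^+ p.+1.
  have nVz : 0 < n%:R * V z by exact: mulr_gt0.
  rewrite -[leLHS]mul1r ler_pdivrMr ?(exprn_gt0 _ nVz)//.
  rewrite exprVn mulrAC ler_pdivlMr ?exprn_gt0// mul1r.
  apply: (@le_trans _ _ ((n%:R * V an) ^+ p.+1)).
    by rewrite lerXn2r ?nnegrE ?(ltW c20)// (le_trans (ltW c20)).
  rewrite [leLHS]exprMn [(n%:R * V z) ^+ _]exprMn [leRHS]mulrCA.
  by rewrite ler_pM2l ?exprn_gt0.
have -> : (6 * p.+1%:R / c / (n%:R * V z)) ^+ p.+1 =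
    (6 * p.+1%:R / c) ^+ p.+1 * ((n%:R * V z) ^+ p.+1)^-1 by rewrite [LHS]exprMn exprVn.
have F0 : 0 <= (6 * p.+1%:R / c) ^+ p.+1 :> R by rewrite exprn_ge0// divr_ge0 ?(ltW c0)// mulr_ge0.
apply: (le_trans (ler_wpM2l F0 key)).
have za2 : z / an <= 2 * (1 + 2 / eta) / (1 + enorm w).
  rewrite ler_pdivrMr// mulrAC ler_pdivlMr; last lra.
  rewrite zE mulrAC ler_pdivrMr ?mulr_gt0//.
  have -> : 2 * (1 + 2 / eta) * an * (eta * enorm w) = 2 * an * ((eta + 2) * enorm w).
    by field; rewrite gt_eqF.
  apply: ler_pM => //; [lra|].
  by move: wbig; rewrite ltr_pdivrMr//; nra.
have za3 : (z / an) ^+ (2 * d) <= (2 * (1 + 2 / eta)) ^+ (2 * d) * (1 + enorm w) ^- (2 * d).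
  have w1 : 0 <= (1 + enorm w)^-1 by rewrite invr_ge0 addr_ge0.
  have e3 : 0 <= 2 * (1 + 2 / eta) by rewrite mulr_ge0// addr_ge0// ltW.
  rewrite -exprVn -exprMn lerXn2r ?nnegrE//; last exact: mulr_ge0.
  by rewrite divr_ge0 ?(ltW z0) ?(ltW an0).
rewrite /Bc [(_ / c2) ^+ _]exprMn.
have G0 : 0 <= (6 * p.+1%:R / c) ^+ p.+1 * c2^-1 ^+ p.+1 * K :> R.
  by rewrite !mulr_ge0 ?(ltW K0)// exprn_ge0// invr_ge0 ltW.
have := ler_wpM2l G0 za3; lra.
Qed.

(** The mesh eta / (N + 1) with N about a_n resolves the scale 1 / a_n at which
the characteristic function of the sum decays; the sum over differences of
lattice points is bounded, and the prefactor (N + 1)^-d remains. *)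
Lemma concentration_bound {c delta y0 K c2 : R} {p : nat} {a : nat -> R} {n0 : nat} {h : R} :
  0 < c -> 0 < delta -> 0 < y0 -> 0 < K -> 0 < c2 -> 0 < h ->
  (forall t, 0 < enorm t -> enorm t <= delta -> c * V (enorm t)^-1 <= 1 - sqr_chf (X := X) t) ->
  (forall y, 0 < y -> 0 < V y) ->
  (forall z y, y0 <= z -> z <= y -> V y ^+ p.+1 <= K * (z / y) ^+ (2 * d) * V z ^+ p.+1) ->
  (forall n, (n0 <= n)%N -> 1 <= a n /\ c2 <= n%:R * V (a n)) ->
  exists2 C, 0 < C & forall n (s : {fset nat}) (q r : seq nat) (x v : 'rV[R]_d) (B : set T),
    (n0 <= n)%N -> (n <= 3 * size r)%N ->
    uniq r -> {in r, forall i, i \notin s} -> {subset q <= s} ->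
    @measurable _ (coordinate_algebra P Y s) B ->
    fine (P (B `&` [set w | cube h x (list_sum (Y := Y) q w + list_sum (Y := Y) r w - v)]))
    <= C / a n ^+ d * fine (P B).
Proof.
move=> c0 delta0 y00 K0 c20 h0 lower V0 potter an.
(* del is small enough for both hypotheses on V, and eta keeps all differences
   of lattice points in the ball of radius del and all phases in [-1, 1]. *)
pose del := Order.min delta y0^-1.
have del0 : 0 < del by rewrite lt_min delta0 invr_gt0.
have del_y : y0 <= del^-1.
  by rewrite -[y0]invrK lef_pV2 ?posrE ?invr_gt0// ge_min lexx orbT.
have lower' t : 0 < enorm t -> enorm t <= del ->
    c * V (enorm t)^-1 <= 1 - sqr_chf (X := X) t.
  by move=> t0 td; apply: lower => //; rewrite (le_trans td)// ge_min lexx.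
pose eta := Order.min (del / d.+1%:R) (d.+1%:R * h)^-1.
have eta0 : 0 < eta by rewrite lt_min invr_gt0 divr_gt0 ?mulr_gt0.
have [eta1 eta2] : eta * d.+1%:R <= del /\ eta * (d.+1%:R * h) <= 1.
  by rewrite -ler_pdivlMr// -ler_pdivlMr ?mulr_gt0// div1r /eta !ge_min !lexx orbT.
pose A := (1 + 2 / eta) ^+ (2 * d) + (6 * p.+1%:R / c / c2) ^+ p.+1 * K * (2 * (1 + 2 / eta)) ^+ (2 * d).
have e2 : 0 < 2 / eta by rewrite divr_gt0.
have A0 : 0 < A.
  rewrite ltr_wpDr ?exprn_gt0//; last lra.
  rewrite mulr_ge0 ?exprn_ge0 ?mulr_ge0 ?exprn_ge0 ?divr_ge0 ?mulr_ge0 ?(ltW K0) ?(ltW c0) ?(ltW c20)//; lra.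
exists (4 * (A * 3 ^+ d)); first by rewrite !mulr_gt0 ?exprn_gt0.
move=> n s q r x v B nn nr ur rs qs mB; have [an1 nV] := an n nn.
have an0 : 0 < a n by lra.
pose N := Num.truncn (a n).
have anN : a n <= N.+1%:R by rewrite ltW// truncnS_gt.
have Nan : N.+1%:R <= 2 * a n.
  by rewrite -natr1; have : N%:R <= a n by [rewrite truncn_le ltW]; lra.
have N0 : (0 : R) < N.+1%:R by rewrite ltr0Sn.
have eN : 0 < eta / N.+1%:R by rewrite divr_gt0.
have dd : (d%:R <= d.+1%:R :> R) by rewrite ler_nat.
have epsh : eta / N.+1%:R * (N.+1%:R * d%:R * h) <= 1.
  rewrite (_ : _ * _ = eta * (d%:R * h)); last by field; rewrite gt_eqF.
  by rewrite (le_trans _ eta2)// ler_pM2l// ler_pM2r.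
have := list_sum_concentration copiesY s q r x v h _ N B ur rs qs mB h0 (ltW eN) epsh.
move=> /le_trans; apply.
have P0 := fineP_ge0 P B.
have inner (k : {ffun 'I_d -> 'I_N.+1}) : \sum_(k' : {ffun 'I_d -> 'I_N.+1})
    Num.sqrt (sqr_chf (X := X) ((eta / N.+1%:R) *: (frequency k - frequency k'))) ^+ size r
    <= A * 3 ^+ d.
  apply: le_trans (ler_wpM2l (ltW A0) (lattice_sum k)).
  rewrite mulr_sumr; apply: ler_sum => k' _.
  pose w : 'rV[R]_d := frequency k - frequency k'.
  have wj j : w ord0 j = (k j : nat)%:R - (k' j : nat)%:R by rewrite !mxE.
  have wd : eta / N.+1%:R * enorm w <= del.
    have we : enorm w <= N.+1%:R * d.+1%:R.
      rewrite (le_trans (enorm_le_sum _))//.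
      apply: (@le_trans _ _ (\sum_(j < d) N.+1%:R)).
        apply: ler_sum => j _; rewrite wj ler_norml.
        have k1 : ((k j : nat)%:R <= N.+1%:R :> R) by rewrite ler_nat ltnW.
        have k2 : ((k' j : nat)%:R <= N.+1%:R :> R) by rewrite ler_nat ltnW.
        have k3 : (0 <= (k j : nat)%:R :> R) by [].
        have k4 : (0 <= (k' j : nat)%:R :> R) by [].
        by apply/andP; split; lra.
      by rewrite sumr_const card_ord -[leLHS]mulr_natr ler_pM2l.
    rewrite (le_trans (ler_wpM2l (ltW eN) we))//.
    by rewrite mulrA divfK ?gt_eqF.
  have := chf_power_le w c0 del0 y00 del_y K0 c20 lower' V0 potter eta0 an1 anN Nan nV nr wd.
  move=> /le_trans; apply; rewrite -/A ler_pM2l//.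
  rewrite (le_trans (inv_pow_le_prod w))// le_eqVlt; apply/orP; left; apply/eqP.
  by apply: eq_bigr => j _; rewrite wj.
have outer : \sum_(k : {ffun 'I_d -> 'I_N.+1}) \sum_(k' : {ffun 'I_d -> 'I_N.+1})
    Num.sqrt (sqr_chf (X := X) ((eta / N.+1%:R) *: (frequency k - frequency k'))) ^+ size r
    <= N.+1%:R ^+ d * (A * 3 ^+ d).
  apply: (@le_trans _ _ (\sum_(k : {ffun 'I_d -> 'I_N.+1}) A * 3 ^+ d)); first exact: ler_sum.
  by rewrite sumr_const card_ffun !card_ord -[leLHS]mulr_natl natrX.
have Nd : 0 < (N.+1%:R ^+ d : R) by rewrite exprn_gt0.
have Nd2 : (N.+1%:R ^+ d : R) ^- 2 * (N.+1%:R ^+ d * (A * 3 ^+ d)) <= A * 3 ^+ d / a n ^+ d.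
  have -> : (N.+1%:R ^+ d : R) ^- 2 * (N.+1%:R ^+ d * (A * 3 ^+ d)) = A * 3 ^+ d / N.+1%:R ^+ d.
    by field; rewrite gt_eqF.
  rewrite ler_pM2l ?mulr_gt0 ?exprn_gt0// lef_pV2 ?posrE ?exprn_gt0//.
  by rewrite lerXn2r ?nnegrE// ltW.
have inv0 : 0 <= (N.+1%:R ^+ d : R) ^- 2 by rewrite invr_ge0 sqr_ge0.
have := ler_wpM2l P0 (le_trans (ler_wpM2l inv0 outer) Nd2).
lra.
Qed.

End ConcentrationRate.

(** * Tails of sums *)

Section SumTail.
Context {disp : measure_display} {T : measurableType disp} {R : realType}
  {d : nat} {P : probability T R} {X : {RV P >-> borel_rV R d}}
  {Y : nat -> {RV P >-> borel_rV R d}}.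
Hypothesis copiesY : independent_copies P X Y.
Implicit Types (r : seq nat) (v : 'rV[R]_d) (y : R).

Local Notation tail := (tail_prob P X).
Local Notation V := (tail_rate (P := P) (X := X)).
Local Notation Phi := (truncated_moment (P := P) (X := X)).

Lemma bounded_measurable_rv (Z : {RV P >-> borel_rV R d}) (g : borel_rV R d -> R) :
  bounded_measurable g -> bounded_measurable (fun w => g (Z w)).
Proof.
by case=> mg [M gM]; split; [exact: measurableT_comp|exists M => w; exact: gM].
Qed.

Lemma variance_sum (g : borel_rV R d -> R) r : uniq r -> bounded_measurable g ->
  \int[P]_w g (X w) = 0 ->
  \int[P]_w (\sum_(i <- r) g (Y i w)) ^+ 2 = (size r)%:R * \int[P]_w (g (X w)) ^+ 2.
Proof.
move=> + bg g0; elim: r => [_|i r IH /= /andP[ir ur]].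
  by under eq_Rintegral do rewrite big_nil expr0n; rewrite mean_cst mul0r.
pose s : {fset nat} := [fset j in r]%fset.
pose f w := \sum_(j <- r) g (Y j w).
have bf : bounded_measurable (f : coordinate_algebra P Y s -> R).
  split.
    rewrite /f; have : {subset r <= s} by move=> j; rewrite inE.
    elim: (r) => [_|j r' IH' rs].
      by under eq_fun do rewrite big_nil; exact: measurable_cst.
    under eq_fun do rewrite big_cons; apply: measurable_funD.
      by case: bg => mg _; apply: (measurableT_comp mg); apply: coordinate_measurable; rewrite rs ?mem_head.
    by apply: IH' => k kr; rewrite rs// inE kr orbT.
  have [_ [M fM]] : bounded_measurable (f : T -> R).
    by apply: bounded_measurable_sum => j; exact: bounded_measurable_rv.
  by exists M.
have bfT : bounded_measurable (f : T -> R).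
  by apply: bounded_measurable_sum => j; exact: bounded_measurable_rv.
have bgi := bounded_measurable_rv (Y i) g bg.
have bg2 : bounded_measurable (fun x : borel_rV R d => g x ^+ 2).
  by under eq_fun do rewrite expr2; exact: bounded_measurableM.
have bff : bounded_measurable (fun w => f w ^+ 2).
  by under eq_fun do rewrite expr2; exact: bounded_measurableM.
have bfg : bounded_measurable (fun w => f w * g (Y i w)) by exact: bounded_measurableM.
have cross : \int[P]_w (f w * g (Y i w)) = 0.
  rewrite (mean_independent P Y copiesY.1 s)//; last by rewrite inE.
  by rewrite (mean_copy copiesY)// g0 mulr0.
transitivity (\int[P]_w (f w ^+ 2 + (2 * (f w * g (Y i w)) + (g (Y i w)) ^+ 2))).
  by apply: eq_Rintegral => w _; rewrite big_cons -/(f w); ring.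
have b2 : bounded_measurable (fun w => 2 * (f w * g (Y i w))).
  by apply: bounded_measurableM; first exact: bounded_measurable_cst.
have bgi2 := bounded_measurable_rv (Y i) _ bg2.
rewrite (meanD _ _ _ bff (bounded_measurableD _ _ b2 bgi2)) (meanD _ _ _ b2 bgi2).
rewrite (meanZ _ _ _ bfg) cross IH// (mean_copy copiesY i _ bg2) -natr1; ring.
Qed.

Lemma measurable_list_sum_ge r v y : measurable [set w | y <= enorm (list_sum (Y := Y) r w - v)].
Proof.
apply: measurable_set_le; first exact: measurable_cst.
rewrite /enorm; apply: measurableT_comp.
  by apply: continuous_measurable_fun => x; exact: sqrt_continuous.
apply: measurable_sum => j; apply: measurable_funX.
rewrite /list_sum; under eq_fun do rewrite !mxE summxE.
apply: measurable_funB; last exact: measurable_cst.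
apply: measurable_sum => i.
by apply: (measurableT_comp (borel_coord j)); exact: measurable_funP.
Qed.

Lemma measurable_list_sum_ge_algebra (s : {fset nat}) r v y : {subset r <= s} ->
  @measurable _ (coordinate_algebra P Y s) [set w | y <= enorm (list_sum (Y := Y) r w - v)].
Proof.
move=> rs.
apply: (@measurable_set_le _ (coordinate_algebra P Y s) R); first exact: measurable_cst.
rewrite /enorm; apply: measurableT_comp.
  by apply: continuous_measurable_fun => x; exact: sqrt_continuous.
apply: measurable_sum => j; apply: measurable_funX.
rewrite /list_sum; under eq_fun do rewrite !mxE summxE.
apply: measurable_funB; last exact: measurable_cst.
elim: r rs => [_|i r IH rs].
  by under eq_fun do rewrite big_nil; exact: measurable_cst.
under eq_fun do rewrite big_cons; apply: measurable_funD.
  by apply: (measurableT_comp (borel_coord j)); apply: coordinate_measurable; rewrite rs ?mem_head.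
by apply: IH => k kr; rewrite rs// inE kr orbT.
Qed.

(** Without centering a first moment suffices: the capped norms of the summands
add up to at least y as soon as the sum leaves the ball of radius y. *)
Lemma sum_tail_uncentered {Cc y0 : R} : 0 < y0 ->
  (forall y, y0 <= y -> \int[P]_w Order.min (enorm (X w)) y <= Cc * (y * V y)) ->
  forall r y, y0 <= y ->
    fine (P [set w | y <= enorm (list_sum (Y := Y) r w)]) <= Cc * ((size r)%:R * V y).
Proof.
move=> y00 hC r y yy0; have y1 : 0 < y by lra.
pose g (x : borel_rV R d) := Order.min (enorm x) y.
have bg : bounded_measurable g.
  split; first by apply: measurable_minr; [exact: borel_enorm|exact: measurable_cst].
  exists y => x; rewrite /g ger0_norm ?ge_min ?lexx ?orbT//.
  by rewrite le_min enorm_ge0 ltW.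
have mA : measurable [set w | y <= enorm (list_sum (Y := Y) r w)].
  by have := measurable_list_sum_ge r 0 y; under eq_set do rewrite subr0.
have bi i : bounded_measurable (fun w => g (Y i w)) by exact: bounded_measurable_rv.
rewrite -mean_indic//; apply: (@le_trans _ _ (\int[P]_w (y^-1 * \sum_(i <- r) g (Y i w)))).
  apply: le_mean => [||w]; first exact: bounded_measurable_indic.
    apply: bounded_measurableM; first exact: bounded_measurable_cst.
    exact: bounded_measurable_sum.
  have g0 i : 0 <= g (Y i w) by rewrite le_min enorm_ge0 ltW.
  rewrite ler_pdivlMl// indicE.
  have [|_] := boolP (w \in _); last by rewrite /= mulr0 sumr_ge0.
  rewrite inE /= => yS; rewrite mulr1; have [/hasP[i ir yi]|/hasPn small] := boolP (has (fun i => y <= enorm (Y i w)) r).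
    rewrite (big_rem i)//= (_ : g (Y i w) = y) ?lerDl ?sumr_ge0//.
    by rewrite /g minEle; case: ifP => // h; apply/eqP; rewrite eq_le h yi.
  apply: (le_trans yS); rewrite /list_sum.
  have : {in r, forall i, enorm (Y i w) <= g (Y i w)}.
    by move=> i ir; rewrite le_min lexx /=; have := small i ir; rewrite -ltNge => /ltW.
  elim: (r) => [_|i r' IH h].
    by rewrite !big_nil /enorm big1 ?sqrtr0// => j _; rewrite mxE expr0n.
  rewrite !big_cons (le_trans (enormD _ _))// lerD ?h ?mem_head ?IH// => k kr.
  by rewrite h// inE kr orbT.
rewrite meanZ; last exact: bounded_measurable_sum.
rewrite mean_sum// ler_pdivrMl//.
rewrite (eq_bigr (fun=> \int[P]_w g (X w))); last by move=> i _; rewrite (mean_copy copiesY).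
rewrite big_const_seq count_predT iter_addr_0 -[leLHS]mulr_natl.
rewrite (le_trans (ler_wpM2l _ (hC y yy0)))//.
by rewrite le_eqVlt; apply/orP; left; apply/eqP; ring.
Qed.

(** The sum leaves the ball of radius y if a summand does or if the truncated
summands deviate from their mean; the latter is Chebyshev's inequality, since
the truncated second moment is what the rate V measures. *)
Lemma sum_tail_centered {Cc y0 : R} {b : 'rV[R]_d} : (0 < d)%N -> 0 <= Cc -> 0 < y0 ->
  (forall y j, y0 <= y ->
     `|\int[P]_w (\1_[set x : borel_rV R d | enorm x <= y] (X w) * (X w : 'rV[R]_d) ord0 j)
       - b ord0 j| <= Cc * (y * V y)) ->
  exists2 C, 0 < C & forall r y, uniq r -> y0 <= y ->
    fine (P [set w | y <= enorm (list_sum (Y := Y) r w - (size r)%:R *: b)])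
    <= C * ((size r)%:R * V y).
Proof.
move=> d0 Cc0 y00 hC.
have dR : 0 < (d%:R : R) by rewrite ltr0n.
exists (1 + 2 * d%:R * Cc + 4 * d%:R ^+ 3).
  by rewrite !ltr_wpDr ?mulr_ge0 ?exprn_ge0.
move=> r y ur yy0; have y1 : 0 < y by lra.
set m := size r; set A := [set w | _].
have mA : measurable A by exact: measurable_list_sum_ge.
have V0 := tail_rate_ge0 (P := P) (X := X) y.
have mV0 : 0 <= m%:R * V y by rewrite mulr_ge0.
have e1 : 0 <= 4 * d%:R ^+ 3 :> R by rewrite mulr_ge0// exprn_ge0.
(* If small fails the claimed bound exceeds 1; otherwise recentering costs at
   most y / (2 d) in each coordinate. *)
have [triv|small] := leP 1 (2 * d%:R * Cc * (m%:R * V y)).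
  rewrite (le_trans (fineP_le1 _ _ mA))// (le_trans triv)// ler_wpM2r//; lra.
pose g j (x : borel_rV R d) : R :=
  \1_[set x : borel_rV R d | enorm x <= y] x * (x : 'rV[R]_d) ord0 j.
have g_le j x : `|g j x| <= Order.min (enorm x) y.
  rewrite /g indicE; case: (boolP (x \in _)) => [|_].
    rewrite inE /= => xy; rewrite mul1r le_min (le_trans (coord_le_enorm _ _) xy) andbT.
    exact: coord_le_enorm.
  by rewrite mul0r normr0 le_min enorm_ge0 ltW.
have bg j : bounded_measurable (g j).
  split; last by exists y => x; rewrite (le_trans (g_le j x))// ge_min lexx orbT.
  apply: measurable_funM; last exact: borel_coord.
  by apply: measurable_indic; apply: measurable_set_le; [exact: borel_enorm|exact: measurable_cst].
pose mu j := \int[P]_w g j (X w).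
pose gc j (x : borel_rV R d) := g j x - mu j.
have bgX j := bounded_measurable_rv X _ (bg j).
have bgc j : bounded_measurable (gc j).
  by apply: bounded_measurableB => //; exact: bounded_measurable_cst.
have gc0 j : \int[P]_w gc j (X w) = 0.
  by rewrite (meanB _ _ _ (bgX j) (bounded_measurable_cst _)) mean_cst subrr.
have bsq (f : T -> R) : bounded_measurable f -> bounded_measurable (fun w => f w ^+ 2).
  by move=> bf; under eq_fun do rewrite expr2; exact: bounded_measurableM.
have var_le j : \int[P]_w (gc j (X w)) ^+ 2 <= Phi y.
  apply: (@le_trans _ _ (\int[P]_w (g j (X w)) ^+ 2)).
    have -> : \int[P]_w (gc j (X w)) ^+ 2 =
        \int[P]_w ((g j (X w)) ^+ 2 - (2 * mu j * g j (X w) - mu j ^+ 2)).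
      by apply: eq_Rintegral => w _; rewrite /gc; ring.
    have b1 : bounded_measurable (fun w => 2 * mu j * g j (X w)).
      by apply: bounded_measurableM => //; exact: bounded_measurable_cst.
    rewrite (meanB _ _ _ (bsq _ (bgX j)) (bounded_measurableB _ _ b1 (bounded_measurable_cst _))).
    rewrite (meanB _ _ _ b1 (bounded_measurable_cst _)) (meanZ _ _ _ (bgX j)) mean_cst.
    by rewrite -/(mu j); have := sqr_ge0 (mu j); lra.
  apply: le_mean => [||w]; [exact: bsq|exact: bounded_measurable_min_sqr|].
  have := g_le j (X w); rewrite le_min => /andP[h1 h2].
  by rewrite le_min !sqr_le_of_norm.
pose S j w := \sum_(i <- r) gc j (Y i w).
have bS j : bounded_measurable (S j).
  by apply: bounded_measurable_sum => i; exact: bounded_measurable_rv.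
pose k := 4 * d%:R ^+ 2 / y ^+ 2.
have k0 : 0 <= k by rewrite divr_ge0 ?mulr_ge0 ?exprn_ge0// ltW.
pose I i : T -> R := \1_[set w | y < enorm (Y i w)].
have mI i : measurable [set w | y < enorm (Y i w)].
  by apply: measurable_set_lt; [exact: measurable_cst|exact: measurable_enorm_rv].
have bI i : bounded_measurable (I i) by exact: bounded_measurable_indic.
have bkS j : bounded_measurable (fun w => k * S j w ^+ 2).
  by apply: bounded_measurableM; [exact: bounded_measurable_cst|exact: bsq].
have I0 i w : 0 <= I i w by rewrite /I indicE ler0n.
have kS0 j w : 0 <= k * S j w ^+ 2 by rewrite mulr_ge0// sqr_ge0.
have point w : \1_A w <= \sum_(i <- r) I i w + \sum_(j < d) k * S j w ^+ 2.
  have rhs0 : 0 <= \sum_(i <- r) I i w + \sum_(j < d) k * S j w ^+ 2.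
    by rewrite addr_ge0// sumr_ge0.
  rewrite indicE; have [|_] := boolP (w \in A) => //; rewrite inE /A /= => yS.
  have [/hasP[i ir yi]|/hasPn inside] := boolP (has (fun i => y < enorm (Y i w)) r).
    have -> : 1 = I i w by rewrite /I indicE mem_set.
    by rewrite (big_rem i)//= -addrA lerDl addr_ge0// sumr_ge0.
  have {}inside i : i \in r -> enorm (Y i w) <= y.
    by move=> /inside; rewrite -leNgt.
  have [j yj] : exists j : 'I_d, y / d%:R <= `|(list_sum (Y := Y) r w - m%:R *: b) ord0 j|.
    apply: contrapT => /forallNP nj; have := le_trans yS (enorm_le_sum _); apply/negP.
    rewrite -ltNge; have -> : y = \sum_(j < d) y / d%:R.
      by rewrite sumr_const card_ord -[RHS]mulr_natr divfK ?gt_eqF.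
    apply: ltr_sum => [|j _]; last by rewrite ltNge; apply/negP; exact: nj.
    by apply/hasP; exists (Ordinal d0) => //; rewrite mem_index_enum.
  have Sj : (list_sum (Y := Y) r w - m%:R *: b) ord0 j = S j w + m%:R * (mu j - b ord0 j).
    rewrite !mxE /list_sum summxE /S /gc sumrB big_const_seq count_predT iter_addr_0.
    rewrite -/m -[mu j *+ m]mulr_natl.
    have -> : \sum_(i <- r) g j (Y i w) = \sum_(i <- r) (Y i w : 'rV[R]_d) ord0 j.
      apply: eq_big_seq => i ir; rewrite /g indicE mem_set ?mul1r//.
      exact: inside.
    ring.
  have dev : `|m%:R * (mu j - b ord0 j)| <= y / (2 * d%:R).
    rewrite normrM ger0_norm// (le_trans (ler_wpM2l _ (hC y j yy0)))//.
    rewrite ler_pdivlMr ?mulr_gt0//.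
    by have := ler_wpM2l (ltW y1) (ltW small); lra.
  have big : y / (2 * d%:R) <= `|S j w|.
    move: yj; rewrite Sj => /le_trans/(_ (ler_normD _ _)) h.
    have e : y / d%:R = y / (2 * d%:R) + y / (2 * d%:R) by field; rewrite gt_eqF.
    lra.
  have one : 1 <= k * S j w ^+ 2.
    have h : (y / (2 * d%:R)) ^+ 2 <= S j w ^+ 2.
      rewrite -[leRHS]real_normK ?num_real// lerXn2r ?nnegrE//.
      by rewrite divr_ge0 ?mulr_ge0// ltW.
    apply: le_trans (ler_wpM2l k0 h).
    by rewrite /k le_eqVlt; apply/orP; left; apply/eqP; field; rewrite !gt_eqF.
  apply: (le_trans one); rewrite (bigD1 j)//= addrCA lerDl addr_ge0// sumr_ge0//.
rewrite -mean_indic//.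
have bsI : bounded_measurable (fun w => \sum_(i <- r) I i w) by exact: bounded_measurable_sum.
have bsS : bounded_measurable (fun w => \sum_(j < d) k * S j w ^+ 2) by exact: bounded_measurable_sum.
apply: (@le_trans _ _ (\int[P]_w (\sum_(i <- r) I i w + \sum_(j < d) k * S j w ^+ 2))).
  by apply: le_mean => //; [exact: bounded_measurable_indic|exact: bounded_measurableD].
rewrite (meanD _ _ _ bsI bsS) (mean_sum _ _ _ _ bI) (mean_sum _ _ _ _ bkS).
have sumI : \sum_(i <- r) \int[P]_w I i w = m%:R * tail y.
  rewrite (eq_bigr (fun=> tail y)) ?big_const_seq ?count_predT ?iter_addr_0 ?mulr_natl// => i _.
  rewrite -mean_indic_tail.
  have mE : measurable [set x : borel_rV R d | y < enorm x].
    by apply: measurable_set_lt; [exact: measurable_cst|exact: borel_enorm].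
  exact: (mean_copy copiesY i _ (bounded_measurable_indic _ mE)).
have sumS : \sum_(j < d) \int[P]_w (k * S j w ^+ 2) <= 4 * d%:R ^+ 3 * (m%:R * V y).
  apply: (@le_trans _ _ (\sum_(j < d) k * (m%:R * Phi y))).
    apply: ler_sum => j _; rewrite (meanZ _ _ _ (bsq _ (bS j))) variance_sum//.
    by rewrite ler_wpM2l// ler_wpM2l.
  rewrite sumr_const card_ord -[leLHS]mulr_natr /k /tail_rate.
  by rewrite le_eqVlt; apply/orP; left; apply/eqP; field; rewrite gt_eqF.
have t1 : m%:R * tail y <= m%:R * V y by rewrite ler_wpM2l// tail_le_rate.
rewrite sumI.
have cross0 : 0 <= 2 * d%:R * Cc * (m%:R * V y).
  by apply: mulr_ge0 => //; rewrite mulr_ge0// mulr_ge0.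
lra.
Qed.

End SumTail.

(** * Mass away from hyperplanes *)

Section Directions.
Context {disp : measure_display} {T : measurableType disp} {R : realType}
  {d : nat} {P : probability T R} {X : {RV P >-> borel_rV R d}}
  {alpha : R} {sigma : probability (borel_rV R d) R}.
Hypothesis alpha0 : 0 < alpha.
Hypothesis rvX : regularly_varying P X alpha sigma.
Hypothesis tail_gt0 : forall t, 0 < tail_prob P X t.
Implicit Types (u x : 'rV[R]_d).

Local Notation tail := (tail_prob P X).

Lemma closed_borel (A : set 'rV[R]_d) : closed A -> measurable (A : set (borel_rV R d)).
Proof.
move=> cA; rewrite -[A]setCK; apply: measurableC; apply: sub_sigma_algebra.
exact: closed_openC.
Qed.

Lemma closed_unit_sphere : closed (@unit_sphere R d).
Proof.
rewrite (_ : unit_sphere = @enorm R d @^-1` [set 1]).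
  by apply: closed_comp => [x _|]; [exact: continuous_enorm|exact: closed_eq].
by [].
Qed.

Lemma compact_unit_sphere : compact (@unit_sphere R d).
Proof.
apply: bounded_closed_compact; last exact: closed_unit_sphere.
exists 1; split; first exact: num_real.
move=> M M1 x /= x1; rewrite (le_trans _ (ltW M1))//.
rewrite [leLHS]/Num.norm /= mx_normrE; apply/bigmax_leP; split => // -[i j] _ /=.
by rewrite (ord1 i) (le_trans (coord_le_enorm x j))// x1.
Qed.

(** Difference of the limits in the definition of regular variation at lambda = 1
and lambda = 2. *)
Lemma shell_ratio (A : set (borel_rV R d)) : measurable A -> A `<=` unit_sphere ->
  sigma (sphere_boundary A) = 0%E ->
  measurable [set x : borel_rV R d | A ((enorm x)^-1 *: (x : 'rV[R]_d))] ->
  fine (P [set w | [/\ t < enorm (X w), enorm (X w) <= 2 * t &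
                     A ((enorm (X w))^-1 *: (X w : 'rV[R]_d))] ]) / tail t
    @[t --> +oo] --> (1 - 2 `^ (- alpha)) * fine (sigma A).
Proof.
move=> mA AS A0 mdir.
have l1 := rvX.2 1 A ltr01 mA AS A0.
have l2 := rvX.2 2 A (ltr0Sn _ _) mA AS A0.
rewrite powR1 mul1r in l1.
have -> : (1 - 2 `^ (- alpha)) * fine (sigma A) =
  fine (sigma A) - 2 `^ (- alpha) * fine (sigma A) by ring.
apply: cvg_trans (cvgB l1 l2).
apply: near_eq_cvg; near=> t.
have t0 : 0 < t by near: t; exact: nbhs_pinfty_gt.
rewrite /= -mulrBl; congr (_ / _).
pose B l := [set w | l * t < enorm (X w) /\ A ((enorm (X w))^-1 *: (X w : 'rV[R]_d))].
have mB l : measurable (B l).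
  apply: measurableI.
    by apply: measurable_set_lt; [exact: measurable_cst|exact: measurable_enorm_rv].
  by rewrite -[X in measurable X]setTI; exact: (measurable_funP X measurableT _ mdir).
have -> : [set w | [/\ t < enorm (X w), enorm (X w) <= 2 * t &
    A ((enorm (X w))^-1 *: (X w : 'rV[R]_d))] ] = B 1 `\` B 2.
  apply/seteqP; split => w; rewrite /B /= mul1r.
    by case=> h1 h2 h3; split=> // -[]; rewrite ltNge h2.
  case=> -[h1 h2] h3; split=> //; rewrite leNgt; apply/negP => h4; exact: h3.
rewrite measureD//; last by rewrite -ge0_fin_numE// fin_num_measure.
rewrite setIidr; last first.
  by move=> w [h1 h2]; split=> //; rewrite mul1r (lt_trans _ h1)//; lra.
by rewrite fineB ?fin_num_measure// /B; do 2 (congr (fine (P _) - _) || congr (_ - fine (P _))) ; under eq_set do rewrite mul1r.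
Unshelve. all: by end_near.
Qed.

Lemma tail_doubling : tail (2 * t) / tail t @[t --> +oo] --> 2 `^ (- alpha).
Proof.
have mS : measurable (@unit_sphere R d : set (borel_rV R d)).
  by apply: closed_borel; exact: closed_unit_sphere.
have S0 : sigma (sphere_boundary (@unit_sphere R d)) = 0%E.
  by rewrite /sphere_boundary setDv closure0 setI0 measure0.
have := rvX.2 2 _ (ltr0Sn _ _) mS (fun x h => h) S0; rewrite rvX.1 mulr1.
apply: cvg_trans; apply: near_eq_cvg; near=> t.
have t0 : 0 < t by near: t; exact: nbhs_pinfty_gt.
congr (fine (P _) / _); apply/seteqP; split => [w [] //|w /= h]; split=> //.
have x0 : 0 < enorm (X w) by rewrite (lt_trans _ h)// mulr_gt0.
by rewrite /unit_sphere /= enormZ gtr0_norm ?invr_gt0// mulVf// gt_eqF.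
Unshelve. all: by end_near.
Qed.

(** The levels of |u.theta| that carry spectral mass are countable, so a level
below which positive mass remains can be chosen with a null boundary. *)
Lemma charged_cap u : nondegenerate_spectral alpha sigma -> enorm u = 1 ->
  exists2 r, 0 < r & sigma [set x | `|edot u x| = r] = 0%E /\
    (0 < sigma [set x : 'rV[R]_d | unit_sphere x /\ (r < `|edot u x|)%R])%E.
Proof.
move=> nd u1.
have mS : measurable (@unit_sphere R d : set (borel_rV R d)).
  by apply: closed_borel; exact: closed_unit_sphere.
have mabs : measurable_fun setT (fun x : borel_rV R d => `|edot u x|).
  by apply: measurableT_comp => //; exact: borel_edot.
pose cap r : set (borel_rV R d) := [set x | unit_sphere x /\ (r < `|edot u x|)%R].
pose low r : set (borel_rV R d) := [set x | unit_sphere x /\ (`|edot u x| <= r)%R].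
have mcap r : measurable (cap r).
  by apply: measurableI => //; apply: measurable_set_lt => //; exact: measurable_cst.
(* If no cap had mass, the spectral integral would be at most r^alpha for every
   positive r. *)
have [eta eta0 capeta] : exists2 eta, 0 < eta & (0 < sigma (cap eta))%E.
  apply: contrapT => none.
  have cap0 r : 0 < r -> sigma (cap r) = 0%E.
    move=> r0; apply/eqP; rewrite eq_le measure_ge0 andbT leNgt; apply/negP => h.
    by apply: none; exists r.
  have ub r : 0 < r ->
      (\int[sigma]_(theta in unit_sphere) (`|edot u theta| `^ alpha)%:E <= (r `^ alpha)%:E)%E.
    move=> r0.
    have split_S : (unit_sphere : set (borel_rV R d)) =
        low r `|` cap r.
      apply/seteqP; split => [x xS|x [[]|[]]//].
      by have [h|h] := leP `|edot u x| r; [left|right].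
    have mle : measurable (low r).
      by apply: measurableI => //; apply: measurable_set_le => //; exact: measurable_cst.
    have mf : measurable_fun setT (fun x : borel_rV R d => (`|edot u x| `^ alpha)%:E).
      by apply/measurable_EFinP; exact: (measurableT_comp (@measurable_powR R alpha)).
    rewrite {1}split_S ge0_integral_setU//=; last 2 first.
    - exact: measurable_funTS.
    - by rewrite disj_set2E; apply/eqP/seteqP; split => // x [[_ h] [_]] /=; rewrite ltNge h.
    rewrite [X in (_ + X)%E](null_set_integral _ _ (cap0 r r0))//; last exact: measurable_funTS.
    rewrite adde0; apply: (@le_trans _ _ (\int[sigma]_(x in low r) (r `^ alpha)%:E)%E).
      apply: ge0_le_integral => //.
      + exact: measurable_funTS.
      + by move=> x [_ h]; rewrite lee_fin ge0_ler_powR// ?nnegrE ?(ltW alpha0)// ltW.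
    rewrite integral_cst// -[leRHS]mule1 lee_pmul2l// ?lte_fin ?powR_gt0//.
    exact: probability_le1.
  have := nd u u1; set I := integral _ _ _ => I0.
  have : (I <= 1%:E)%E by have := ub 1 ltr01; rewrite powR1.
  case EI : I I0 => [i| |]//; rewrite lte_fin => i0 _.
  have i2 : 0 < i / 2 by rewrite divr_gt0.
  have := ub ((i / 2) `^ alpha^-1) (powR_gt0 _ i2).
  rewrite -powRrM mulVf ?gt_eqF// powRr1 ?(ltW i2)// -/I EI lee_fin; lra.
pose Z : {RV sigma >-> R} := HB.pack (fun x : borel_rV R d => `|edot u x|)
  (isMeasurableFun.Build _ _ _ _ _ mabs).
(* An interval of levels that all carry mass would be countable. *)
have [r r01 rZ] : exists2 r, 0 < r < eta & ~ (0 < pmf Z r).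
  apply: contrapT => none.
  have : lebesgue_measure (`]0, eta[%classic : set R) = 0%E.
    apply: countable_lebesgue_measure0; apply: sub_countable (pmf_gt0_countable Z).
    apply: subset_card_le => r; rewrite /= in_itv /= => r0.
    by apply: contrapT => h; apply: none; exists r.
  by rewrite lebesgue_measure_itv /= lte_fin eta0 sube0 => -[]; lra.
have /andP[r0 reta] := r01.
exists r => //; split.
  have mr : measurable [set x : borel_rV R d | `|edot u x| = r].
    by rewrite -[X in measurable X]setTI; exact: (mabs measurableT [set r] (measurable_set1 r)).
  have := pmf_ge0 Z r; rewrite le_eqVlt => /orP[/eqP e|/rZ//].
  rewrite -[LHS]fineK ?fin_num_measure//; congr (_%:E).
  exact/esym.
apply: (lt_le_trans capeta); apply: le_measure; rewrite ?inE//; try exact: mcap.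
by move=> x [xS h]; split=> //; rewrite (lt_trans reta).
Qed.

Lemma visible_nearby {r x b c e : R} : 0 < r -> r * x < b -> e <= r / 2 * x ->
  b - e <= c -> x <= 2 / r * c.
Proof.
move=> r0 h1 h2 h3; have h : r / 2 * x <= c by lra.
have e7 : 2 / r * (r / 2 * x) = x by field; rewrite gt_eqF.
by rewrite -[leLHS]e7 ler_pM2l// divr_gt0.
Qed.

Lemma edot_direction u x r : 0 < enorm x ->
  (r < `|edot u ((enorm x)^-1 *: x)|) = (r * enorm x < `|edot u x|).
Proof.
move=> x0; rewrite edotZr normrM gtr0_norm ?invr_gt0//.
by rewrite ltr_pdivlMl// mulrC.
Qed.

(** If |u0.theta| > r and |u - u0| < r/2 then |u.theta| > r/2 for theta in the
sphere: the cap of u0 serves all directions near u0. *)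
Lemma directional_mass_near u0 : nondegenerate_spectral alpha sigma -> enorm u0 = 1 ->
  exists r k0 : R, 0 < r /\ forall u, enorm (u - u0) < r ->
    forall k, k0 <= k -> forall s, k <= s ->
    tail s <= k * fine (P [set w | [/\ s < enorm (X w), enorm (X w) <= 2 * s
                                & enorm (X w) <= k * `|edot u (X w)| ] ]).
Proof.
move=> nd u1; have [r r0 [r_null cap_pos]] := charged_cap u0 nd u1.
pose A : set (borel_rV R d) := [set x | unit_sphere x /\ (r < `|edot u0 x|)%R].
have mabs : measurable_fun setT (fun x : borel_rV R d => `|edot u0 x|).
  by apply: measurableT_comp => //; exact: borel_edot.
have mA : measurable A.
  apply: measurableI; first by apply: closed_borel; exact: closed_unit_sphere.
  by apply: measurable_set_lt => //; exact: measurable_cst.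
have cabs : continuous (fun x : 'rV[R]_d => `|edot u0 x|).
  move=> x; apply: (@continuous_comp _ _ _ (edot u0) (fun y : R => `|y|)).
    exact: continuous_edot.
  exact: norm_continuous.
have A0 : sigma (sphere_boundary A) = 0%E.
  apply/eqP; rewrite eq_le measure_ge0 andbT -[leRHS]r_null; apply: le_measure; rewrite ?inE.
  - by apply: measurableI; apply: closed_borel; exact: closed_closure.
  - by rewrite -[X in measurable X]setTI; exact: (mabs measurableT [set r] (measurable_set1 r)).
  move=> x [h1 h2] /=.
  have c1 : closed [set x : 'rV[R]_d | r <= `|edot u0 x|].
    by apply: (@closed_comp _ _ (fun x : 'rV[R]_d => `|edot u0 x|) [set y | r <= y]) => [y _|];
      [exact: cabs|exact: closed_ge].
  have c2 : closed [set x : 'rV[R]_d | `|edot u0 x| <= r].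
    by apply: (@closed_comp _ _ (fun x : 'rV[R]_d => `|edot u0 x|) [set y | y <= r]) => [y _|];
      [exact: cabs|exact: closed_le].
  have b1 : r <= `|edot u0 x|.
    by apply: c1 => B /h1 [y [[_ yA] yB]]; exists y; split=> //; exact: ltW.
  have b2 : `|edot u0 x| <= r.
    apply: c2 => B /h2 [y [[yS nyA] yB]]; exists y; split=> //=.
    by rewrite leNgt; apply/negP => h; apply: nyA.
  by apply/eqP; rewrite eq_le b1 b2.
have shellA t w : 0 <= t -> [/\ t < enorm (X w), enorm (X w) <= 2 * t &
      A ((enorm (X w))^-1 *: (X w : 'rV[R]_d))] <->
    [/\ t < enorm (X w), enorm (X w) <= 2 * t & r * enorm (X w) < `|edot u0 (X w)|].
  move=> t0; split=> -[h1 h2].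
    by case=> _; rewrite edot_direction//; exact: le_lt_trans h1.
  move=> h3; have x0 : 0 < enorm (X w) by exact: le_lt_trans h1.
  split=> //; split; last by rewrite edot_direction.
  by rewrite /unit_sphere /= enormZ gtr0_norm ?invr_gt0// mulVf// gt_eqF.
have mdir : measurable [set x : borel_rV R d | A ((enorm x)^-1 *: (x : 'rV[R]_d))].
  rewrite (_ : [set x | _] = [set x : borel_rV R d | 0 < enorm x] `&`
      [set x : borel_rV R d | r * enorm x < `|edot u0 x|]); last first.
    apply/seteqP; split => x.
      rewrite /= => -[h1 h2].
      have x0 : 0 < enorm x.
        rewrite lt_def enorm_ge0 andbT; apply/eqP => e.
        by move: h1; rewrite /unit_sphere /= enormZ e mulr0 => /esym/eqP; rewrite oner_eq0.
      by split=> //=; rewrite -edot_direction.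
    rewrite /= => -[x0 h]; split; last by rewrite edot_direction.
    by rewrite /unit_sphere /= enormZ gtr0_norm ?invr_gt0// mulVf// gt_eqF.
  apply: measurableI; apply: measurable_set_lt => //.
  - exact: borel_enorm.
  - by apply: measurable_funM; [exact: measurable_cst|exact: borel_enorm].
have ratio := shell_ratio A mA (fun x h => h.1) A0 mdir.
pose L := (1 - 2 `^ (- alpha)) * fine (sigma A).
have sA : 0 < fine (sigma A) by apply: fine_gt0; rewrite cap_pos -ge0_fin_numE// fin_num_measure.
have p1 := powR2N_lt1 alpha0.
have L0 : 0 < L by rewrite mulr_gt0// subr_gt0.
have /cvgr_gt /(_ (L / 2)) := ratio; rewrite -/L => /(_ ltac:(lra)) [s1 [_ hs1]].
have L2 : 0 < 2 / L by rewrite divr_gt0.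
have r2 : 0 < 2 / r by rewrite divr_gt0.
have [k0 [k01 k02 k03 k04]] : exists k0 : R, [/\ s1 < k0, 0 < k0, 2 / L <= k0 & 2 / r <= k0].
  by exists (`|s1| + 1 + 2 / L + 2 / r); have := ler_norm s1; have := normr_ge0 s1; split; lra.
exists (r / 2), k0; split; first by rewrite divr_gt0.
move=> u uu k hk s ks.
have k_pos : 0 < k by exact: lt_le_trans hk.
have s_pos : 0 < s by exact: lt_le_trans ks.
have := hs1 s (lt_le_trans k01 (le_trans hk ks)); rewrite ltr_pdivlMr// => h.
set F := fine _ in h; set G := fine _.
have FG : F <= G.
  apply: fineP_le.
  - rewrite (_ : [set w | _] = [set w | s < enorm (X w)] `&` [set w | enorm (X w) <= 2 * s]
       `&` [set w | r * enorm (X w) < `|edot u0 (X w)|]); last first.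
      apply/seteqP; split => w.
        by move=> /(shellA s w (ltW s_pos)) [].
      by move=> [[h1 h2] h3]; apply/(shellA s w (ltW s_pos)).
    have me := measurable_enorm_rv X.
    have mc (c : R) : measurable_fun [set: T] (fun=> c) by exact: measurable_cst.
    apply: measurableI; first apply: measurableI.
    + exact: measurable_set_lt.
    + exact: measurable_set_le.
    + apply: measurable_set_lt; first exact: measurable_funM.
      by apply: measurableT_comp => //; exact: measurable_edot_rv.
  - have := measurable_visible k s (2 * s) u.
    rewrite -[X in _ -> measurable X]setTI => mv; exact: (measurable_funP X measurableT _ mv).
  move=> w /(shellA s w (ltW s_pos)) [h1 h2 h3]; split=> //.
  have x0 := enorm_ge0 (X w).
  have e1 : edot u (X w) = edot u0 (X w) + edot (u - u0) (X w) by rewrite edotBl; ring.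
  have e2 := norm_edot_le (u - u0) (X w).
  have e3 : enorm (u - u0) * enorm (X w) <= r / 2 * enorm (X w) by rewrite ler_wpM2r// ltW.
  have e4 := lerB_normD (edot u0 (X w)) (edot (u - u0) (X w)); rewrite -e1 in e4.
  rewrite (le_trans (visible_nearby r0 h3 (le_trans e2 e3) e4))//.
  by rewrite ler_wpM2r// (le_trans k04).
have G0 : 0 <= G by exact: fineP_ge0.
have t1 : tail s <= 2 / L * F by rewrite -ler_pdivrMl// invf_div ltW.
rewrite (le_trans t1)// (le_trans (ler_wpM2l (ltW L2) FG))// ler_wpM2r//.
exact: le_trans hk.
Qed.

(** By compactness of the sphere the constants can be chosen uniformly. *)
Lemma directional_mass_uniform : nondegenerate_spectral alpha sigma ->
  exists2 kappa, 0 < kappa & directional_mass (P := P) (X := X) kappa kappa.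
Proof.
move=> nd.
have /compact_near_coveringP cover := compact_unit_sphere.
pose Q (k : nat) (u : 'rV[R]_d) := forall s : R, k.+1%:R <= s ->
    tail s <= k.+1%:R * fine (P [set w | [/\ s < enorm (X w), enorm (X w) <= 2 * s
                                & enorm (X w) <= k.+1%:R * `|edot u (X w)| ] ]).
have [k _ hk] : \forall k \near \oo, unit_sphere `<=` Q k; last first.
  by exists k.+1%:R => // u u1 s; exact: (hk k (leqnn k)).
apply: cover => u0 u01; have [r [k0 [r0 h]]] := directional_mass_near u0 nd u01.
exists ([set u | enorm (u - u0) < r], [set k : nat | k0 <= k.+1%:R]); [split => /=|].
- have c : continuous (fun u : 'rV[R]_d => enorm (u - u0)).
    move=> u; apply: (@continuous_comp _ _ _ (fun u : 'rV[R]_d => u - u0) (@enorm R d)).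
      exact: (@cvgB R 'rV[R]_d 'rV[R]_d (nbhs u) _ id (fun=> u0) u u0 cvg_id (cvg_cst _)).
    exact: continuous_enorm.
  have := c u0; rewrite /continuous_at subrr => /cvgr_lt; apply.
  by rewrite /enorm big1 ?sqrtr0// => j _; rewrite mxE expr0n.
- exists (Num.truncn `|k0|) => // k /= hk.
  rewrite (le_trans (ler_norm k0))// (le_trans (ltW (truncnS_gt _)))//.
  by rewrite ler_nat ltnS.
- by move=> [u k] /= [hu hk] s ks; exact: (h u hu _ hk s ks).
Qed.

End Directions.

(** * Consequences of regular variation for truncated moments *)

Section IncrementComparison.
Context {R : realType}.
Implicit Types (Psi h : R -> R) (y : R).

(** Replaces summation over dyadic shells: an inequality between increments over
one doubling is propagated by induction. *)
Lemma dominated_by_increments {Psi h} {k M y0 : R} : 0 < y0 ->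
  (forall y, y0 <= y -> 0 <= h y) ->
  (forall y, y0 <= y -> h y <= h (2 * y)) ->
  (forall y, y0 <= y -> Psi (2 * y) - Psi y <= k * (h (2 * y) - h y)) ->
  (forall y, y0 <= y <= 2 * y0 -> Psi y <= M * h y) ->
  exists2 C, 0 < C & forall y, y0 <= y -> Psi y <= C * h y.
Proof.
move=> y00 h0 hinc Psik base.
pose C := 1 + `|k| + `|M|.
have [k1 M1] : k <= C /\ M <= C.
  have := ler_norm k; have := ler_norm M; have := normr_ge0 k; have := normr_ge0 M.
  by rewrite /C; split; lra.
exists C; first by rewrite /C; have := normr_ge0 k; have := normr_ge0 M; lra.
apply: (doubling_ind _ _ y00) => y.
  move=> /[dup] /base h1 /andP[/h0 h2 _]; rewrite (le_trans h1)// ler_wpM2r//.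
move=> yy0 IH; have h1 := Psik y yy0; have h2 := hinc y yy0.
have h3 : k * (h (2 * y) - h y) <= C * (h (2 * y) - h y) by rewrite ler_wpM2r// subr_ge0.
lra.
Qed.

End IncrementComparison.

Section TailMoments.
Context {disp : measure_display} {T : measurableType disp} {R : realType}
  {d : nat} {P : probability T R} {X : {RV P >-> borel_rV R d}}.
Hypothesis tail_gt0 : forall t, 0 < tail_prob P X t.
Implicit Types (y : R).

Local Notation tail := (tail_prob P X).
Local Notation V := (tail_rate (P := P) (X := X)).
Local Notation Phi := (truncated_moment (P := P) (X := X)).

Definition capped_mean y := \int[P]_w Order.min (enorm (X w)) y.

Lemma bounded_measurable_capped y : 0 <= y ->
  bounded_measurable (fun w => Order.min (enorm (X w)) y).
Proof.
move=> y0; split; first by apply: measurable_minr; [exact: measurable_enorm_rv|exact: measurable_cst].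
exists y => w; rewrite ger0_norm ?ge_min ?lexx ?orbT//.
by rewrite le_min enorm_ge0.
Qed.

Lemma capped_mean_double y : 0 < y -> capped_mean (2 * y) <= capped_mean y + y * tail y.
Proof.
move=> y0; have y00 := ltW y0.
have bi : bounded_measurable (\1_[set w | y < enorm (X w)] : T -> R).
  exact/bounded_measurable_indic/measurable_tail.
have bt : bounded_measurable (fun w => y * \1_[set w | y < enorm (X w)] w : R).
  by apply: bounded_measurableM => //; exact: bounded_measurable_cst.
have bc := bounded_measurable_capped y y00.
rewrite /capped_mean -mean_indic_tail -(meanZ _ _ _ bi) -(meanD _ _ _ bc bt).
apply: le_mean => [||w]; [apply: bounded_measurable_capped; lra|exact: bounded_measurableD|].
rewrite indic_tailE; have := enorm_ge0 (X w); move: (enorm (X w)) => x x0.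
have [yx|xy] := ltP y x; rewrite ?mulr1 ?mulr0 ?addr0 !minEle.
  by do ?[case: ifP => ?]; lra.
by do ?[case: ifP => ?]; lra.
Qed.

Lemma capped_mean_le y : 0 <= y -> capped_mean y <= y.
Proof.
move=> y0; rewrite -[leRHS](mean_cst P); apply: le_mean => [||w].
- exact: bounded_measurable_capped.
- exact: bounded_measurable_cst.
- by rewrite ge_min lexx orbT.
Qed.

(** If tail decays more slowly than 1/y, the capped mean is dominated by its
last dyadic shell. *)
Lemma capped_mean_slow {q y0 : R} : 0 < y0 -> 2^-1 < q ->
  (forall y, y0 <= y -> q * tail y <= tail (2 * y)) ->
  exists2 C, 0 < C & forall y, y0 <= y -> capped_mean y <= C * (y * V y).
Proof.
move=> y00 q2 hq.
have [||y yy0|y /andP[h1 h2]|C C0 hC] := @dominated_by_increments R capped_mean (fun y => y * tail y)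
    (2 * q - 1)^-1 (tail (2 * y0))^-1 y0 y00.
- by move=> y yy0; rewrite mulr_ge0 ?tail_ge0//; lra.
- move=> y yy0; have := hq y yy0; have := tail_ge0 (P := P) (X := X) y => t0 h.
  have h2 : tail y <= 2 * tail (2 * y) by nra.
  have y_gt0 : 0 <= y by lra.
  by have := ler_wpM2l y_gt0 h2; lra.
- have y_gt0 : 0 < y by lra.
  have h1 := capped_mean_double y y_gt0; have h2 := hq y yy0.
  rewrite ler_pdivlMl; last lra.
  have t0 := tail_ge0 (P := P) (X := X) y.
  nra.
- have y_gt0 : 0 < y by lra.
  rewrite (le_trans (capped_mean_le y (ltW y_gt0)))//.
  rewrite ler_pdivlMl// mulrC ler_pM2l//; exact: tail_noninc.
exists C => // y yy0; have y_gt0 : 0 < y by lra.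
by rewrite (le_trans (hC y yy0))// ler_pM2l// ler_pM2l// tail_le_rate.
Qed.

Lemma tail_rate_le_tail {q y0 : R} : 0 < y0 -> 4^-1 < q ->
  (forall y, y0 <= y -> q * tail y <= tail (2 * y)) ->
  exists2 C, 0 < C & forall y, y0 <= y -> V y <= C * tail y.
Proof.
move=> y00 q2 hq.
have [||y yy0|y /andP[h1 h2]|C C0 hC] := @dominated_by_increments R Phi (fun y => y ^+ 2 * tail y)
    (3 / (4 * q - 1)) (tail (2 * y0))^-1 y0 y00.
- by move=> y yy0; rewrite mulr_ge0 ?tail_ge0// sqr_ge0.
- move=> y yy0; have := hq y yy0; have := tail_ge0 (P := P) (X := X) y => t0 h.
  have : y ^+ 2 * (q * tail y) <= y ^+ 2 * tail (2 * y) by rewrite ler_wpM2l// sqr_ge0.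
  have : 0 <= y ^+ 2 * tail y by rewrite mulr_ge0// sqr_ge0.
  nra.
- have y_gt0 : 0 < y by lra.
  have h1 := truncated_moment_double_le (P := P) (X := X) y y_gt0; have h2 := hq y yy0.
  rewrite [leRHS]mulrAC ler_pdivlMr; last lra.
  have : y ^+ 2 * (q * tail y) <= y ^+ 2 * tail (2 * y) by rewrite ler_wpM2l// sqr_ge0.
  nra.
- have y_gt0 : 0 < y by lra.
  rewrite (le_trans (truncated_moment_le y))//.
  rewrite ler_pdivlMl// mulrC ler_pM2l ?exprn_gt0//; exact: tail_noninc.
exists C => // y yy0; have y_gt0 : 0 < y by lra.
rewrite ler_pdivrMr ?exprn_gt0// (le_trans (hC y yy0))//.
by rewrite le_eqVlt; apply/orP; left; apply/eqP; ring.
Qed.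

Lemma capped_mean_iter {q y0 : R} : 0 < y0 -> 0 < q -> q < 2^-1 ->
  (forall y, y0 <= y -> tail (2 * y) <= q * tail y) ->
  forall y n, y0 <= y -> capped_mean (2 ^+ n * y) <= capped_mean y + (1 - 2 * q)^-1 * (y * tail y).
Proof.
move=> y00 q0 q2 hq y n yy0; have y_gt0 : 0 < y by lra.
have c0 : 0 < (1 - 2 * q)^-1 by rewrite invr_gt0; lra.
have e : (1 - 2 * q)^-1 * (1 - 2 * q) = 1 by rewrite mulVf//; lra.
have yk k : y0 <= 2 ^+ k * y.
  by rewrite (le_trans yy0)// ler_peMl ?(ltW y_gt0)// exprn_ege1//; lra.
have tk k : tail (2 ^+ k * y) <= q ^+ k * tail y.
  elim: k => [|k IH]; first by rewrite !expr0 !mul1r.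
  by rewrite exprS -mulrA (le_trans (hq _ (yk k)))// exprS -mulrA ler_pM2l.
have main : capped_mean (2 ^+ n * y) <=
    capped_mean y + (1 - 2 * q)^-1 * (1 - (2 * q) ^+ n) * (y * tail y).
  elim: n => [|n IH]; first by rewrite !expr0 subrr mulr0 mul0r addr0 mul1r.
  have p0 : 0 < 2 ^+ n * y by rewrite mulr_gt0 ?exprn_gt0.
  rewrite exprS -mulrA (le_trans (capped_mean_double _ p0))//.
  have h1 : 2 ^+ n * y * tail (2 ^+ n * y) <= 2 ^+ n * y * (q ^+ n * tail y).
    by rewrite ler_wpM2l// ltW.
  have e1 : 2 ^+ n * y * (q ^+ n * tail y) =
      (1 - 2 * q)^-1 * (1 - 2 * q) * (2 * q) ^+ n * (y * tail y).
    by rewrite e exprMn; ring.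
  move: IH h1; rewrite e1 [(2 * q) ^+ n.+1]exprS; lra.
rewrite (le_trans main)// lerD2l ler_wpM2r ?mulr_ge0 ?tail_ge0 ?ler_piMr ?(ltW c0) ?(ltW y_gt0)//.
by rewrite gerBl exprn_ge0// mulr_ge0// ltW.
Qed.

(** If tail decays faster than 1/y, X is integrable and monotone convergence
along the dyadic caps bounds what truncation at y removes from the mean. *)
Lemma mean_truncation_error {q y0 : R} : 0 < y0 -> 0 < q -> q < 2^-1 ->
  (forall y, y0 <= y -> tail (2 * y) <= q * tail y) ->
  exists2 C, 0 < C & forall y j, y0 <= y ->
   `|\int[P]_w (\1_[set x : borel_rV R d | enorm x <= y] (X w) * (X w : 'rV[R]_d) ord0 j)
       - mean P X ord0 j| <= C * (y * V y).
Proof.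
move=> y00 q0 q2 hq; pose c := (1 - 2 * q)^-1.
have c0 : 0 < c by rewrite invr_gt0; lra.
exists (c + 1) => [|y j yy0]; first lra.
have y_gt0 : 0 < y by lra.
have iter := capped_mean_iter y00 q0 q2 hq y; rewrite -/c in iter.
pose g n w := (Order.min (enorm (X w)) (2 ^+ n * y))%:E.
have p0 n : 0 < 2 ^+ n * y by rewrite mulr_gt0 ?exprn_gt0.
have bg n := bounded_measurable_capped _ (ltW (p0 n)).
have glim w : (enorm (X w))%:E = limn (g^~ w).
  apply/esym/cvg_lim => //; apply: cvg_near_cst.
  exists (Num.truncn (enorm (X w) / y)).+1 => // n /= hn; congr (_%:E).
  rewrite minEle ifT// -ler_pdivrMr// (le_trans (ltW (truncnS_gt _)))//.
  rewrite (le_trans (_ : _ <= n%:R)) ?ler_nat//.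
  by rewrite -natrX ler_nat ltnW// ltn_expl.
have EX : (\int[P]_w (enorm (X w))%:E <= (capped_mean y + c * (y * tail y))%:E)%E.
  under eq_integral do rewrite glim.
  rewrite monotone_convergence//=; last 3 first.
  - by move=> n; apply/measurable_EFinP; case: (bg n).
  - by move=> n w _; rewrite lee_fin le_min enorm_ge0 ltW.
  - move=> w _ m n mn; rewrite lee_fin le_min !ge_min lexx /= orbC ler_pM2r//.
    by rewrite ler_eXn2l ?mn// ltr1n.
  apply: lime_le.
    apply: ereal_nondecreasing_is_cvgn => m n mn; apply: ge0_le_integral => //=.
    - by move=> w _; rewrite lee_fin le_min enorm_ge0 ltW.
    - by apply/measurable_EFinP; case: (bg m).
    - by apply/measurable_EFinP; case: (bg n).
    - move=> w _; rewrite lee_fin le_min !ge_min lexx /= orbC ler_pM2r//.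
      by rewrite ler_eXn2l ?mn// ltr1n.
  apply: nearW => n; rewrite -EFin_mean// lee_fin.
  exact: iter.
have mX := measurable_enorm_rv X.
have intX : P.-integrable setT (EFin \o (fun w => enorm (X w))).
  apply/integrableP; split; first exact/measurable_EFinP.
  under eq_integral do rewrite /= ger0_norm ?enorm_ge0//.
  by rewrite (le_lt_trans EX)// ltry.
pose Xj w := (X w : 'rV[R]_d) ord0 j.
have mXj : measurable_fun setT Xj.
  by apply: (measurableT_comp (borel_coord j)); exact: measurable_funP.
have intXj : P.-integrable setT (EFin \o Xj).
  apply: le_integrable intX => //; first exact/measurable_EFinP.
  by move=> w _; rewrite /= lee_fin (ger0_norm (enorm_ge0 _)) coord_le_enorm.
have meanE : mean P X ord0 j = \int[P]_w Xj w.
  by rewrite /mean mxE unlock.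
pose D := [set x : borel_rV R d | enorm x <= y].
pose g1 w := \1_D (X w) * Xj w.
have mD : measurable D by apply: measurable_set_le; [exact: borel_enorm|exact: measurable_cst].
have mg1 : measurable_fun setT g1.
  apply: measurable_funM => //.
  have mI : measurable_fun setT (\1_D : borel_rV R d -> R) by exact: measurable_indic.
  exact: (measurableT_comp mI (measurable_funP X)).
have ig1 : P.-integrable setT (EFin \o g1).
  apply: le_integrable intXj => //; first exact/measurable_EFinP.
  move=> w _; rewrite /= lee_fin normrM ler_piMl// indicE.
  by case: (_ \in _); rewrite ?normr1 ?normr0.
have iB (f f' : T -> R) : P.-integrable setT (EFin \o f) -> P.-integrable setT (EFin \o f') ->
    P.-integrable setT (EFin \o (fun w => f w - f' w)).
  by move=> i1 i2; apply: (integrableB _ i1 i2).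
have iD (f f' : T -> R) : P.-integrable setT (EFin \o f) -> P.-integrable setT (EFin \o f') ->
    P.-integrable setT (EFin \o (fun w => f w + f' w)).
  by move=> i1 i2; apply: (integrableD _ i1 i2).
rewrite meanE distrC -RintegralB//.
have bt : bounded_measurable (\1_[set w | y < enorm (X w)] : T -> R).
  exact/bounded_measurable_indic/measurable_tail.
have byt : bounded_measurable (fun w => y * \1_[set w | y < enorm (X w)] w : R).
  by apply: bounded_measurableM => //; exact: bounded_measurable_cst.
have bcy := bounded_measurable_capped _ (ltW y_gt0).
pose g2 w : R := enorm (X w) - Order.min (enorm (X w)) y.
have ig2 : P.-integrable setT (EFin \o g2).
  by apply: iB => //; exact: bounded_measurable_integrable.
have iyt := bounded_measurable_integrable P _ byt.
apply: (le_trans (le_normr_Rintegral _ _)) => //; first exact: iB.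
apply: (@le_trans _ _ (\int[P]_w (g2 w + y * \1_[set w | y < enorm (X w)] w))).
  apply: le_Rintegral => //.
  - by apply: integrable_norm; exact: iB.
  - exact: iD.
  move=> w _; rewrite indic_tailE /g1 indicE /g2.
  have [h|h] := leP (enorm (X w)) y.
    by rewrite mem_set//= mul1r !subrr normr0 mulr0 addr0.
  rewrite memNset /= ?mul0r ?subr0 ?mulr1 ?subrK//; last by rewrite /D /= leNgt h.
  exact: coord_le_enorm.
rewrite RintegralD// (meanZ _ _ _ bt) mean_indic_tail RintegralB//; last first.
  exact: bounded_measurable_integrable.
have EX' : \int[P]_w enorm (X w) <= capped_mean y + c * (y * tail y).
  rewrite -lee_fin (le_trans _ EX)// /Rintegral fineK//.
  exact: integrable_fin_num.
have tV : y * tail y <= y * V y by rewrite ler_pM2l// tail_le_rate.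
have := ler_wpM2l (ltW c0) tV; rewrite -/(capped_mean y); lra.
Qed.

End TailMoments.

(** * The truncated moment against the normalizing function *)

Section RateEquivalence.
Context {disp : measure_display} {T : measurableType disp} {R : realType}
  {d : nat} {P : probability T R} {X : {RV P >-> borel_rV R d}}
  {alpha : R} {l : R -> R}.
Hypothesis alpha_pos : 0 < alpha.
Hypothesis alpha_le2 : alpha <= 2.
Hypothesis slowX : tail_slow_part P X alpha l.
Hypothesis doublingX : tail_prob P X (2 * t) / tail_prob P X t @[t --> +oo] --> 2 `^ (- alpha).
Implicit Types (x y : R).

Local Notation tail := (tail_prob P X).
Local Notation V := (tail_rate (P := P) (X := X)).
Local Notation Phi := (truncated_moment (P := P) (X := X)).
Local Notation L := (tilde alpha l).

Lemma slow_part_equiv : exists2 y1 : R, 1 <= y1 & forall y, y1 <= y ->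
  l y <= 2 * (y `^ alpha * tail y) /\ y `^ alpha * tail y <= 2 * l y.
Proof.
have [_ lpos _ h1] := slowX.
have /cvgr_gt /(_ 2^-1) /(_ ltac:(lra)) [A1 [_ hA1]] := h1.
have /cvgr_lt /(_ 2) /(_ ltac:(lra)) [A2 [_ hA2]] := h1.
have := ler_norm A1; have := ler_norm A2; have := normr_ge0 A1; have := normr_ge0 A2.
move=> a1 a2 a3 a4; exists (1 + `|A1| + `|A2|) => [|y hy]; first lra.
have y0 : 0 < y by lra.
have ly := lpos y (ltW y0).
have ya : 0 < y `^ alpha by exact: powR_gt0.
have e : tail y / (y `^ (- alpha) * l y) = y `^ alpha * tail y / l y.
  by rewrite powRN; field; rewrite !gt_eqF.
have := hA1 y ltac:(lra); have := hA2 y ltac:(lra); rewrite e.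
rewrite ltr_pdivrMr// ltr_pdivlMr// => b1 b2; split; lra.
Qed.

Lemma tail_gt0 t : 0 < tail t.
Proof.
have [_ lpos _ _] := slowX; have [y1 y11 h] := slow_part_equiv.
have [h1 _] := h (Order.max y1 t) ltac:(by rewrite le_max lexx).
have m0 : 0 <= Order.max y1 t by rewrite le_max; apply/orP; left; lra.
have lm := lpos _ m0.
have : 0 < Order.max y1 t `^ alpha * tail (Order.max y1 t) by lra.
rewrite pmulr_rgt0; last by rewrite powR_gt0// lt_max; apply/orP; left; lra.
by move=> /lt_le_trans; apply; apply: tail_noninc; rewrite le_max lexx orbT.
Qed.

Lemma tail_doubling_le q : 2 `^ (- alpha) < q ->
  exists2 y0, 0 < y0 & forall y, y0 <= y -> tail (2 * y) <= q * tail y.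
Proof.
move=> hq; have /cvgr_lt /(_ q hq) [A [_ hA]] := doublingX.
have := ler_norm A; have := normr_ge0 A => a0 a1.
exists (1 + `|A|) => [|y hy]; first lra.
by have := hA y ltac:(lra); rewrite ltr_pdivrMr ?tail_gt0// => /ltW.
Qed.

Lemma tail_doubling_ge q : q < 2 `^ (- alpha) ->
  exists2 y0, 0 < y0 & forall y, y0 <= y -> q * tail y <= tail (2 * y).
Proof.
move=> hq; have /cvgr_gt /(_ q hq) [A [_ hA]] := doublingX.
have := ler_norm A; have := normr_ge0 A => a0 a1.
exists (1 + `|A|) => [|y hy]; first lra.
by have := hA y ltac:(lra); rewrite ltr_pdivlMr ?tail_gt0// => /ltW.
Qed.

Lemma tail_half : exists M, tail M <= 2^-1.
Proof.
have q1 := powR2N_lt1 alpha_pos; have q0 : 0 < 2 `^ (- alpha) :> R by exact: powR_gt0.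
pose q := (1 + 2 `^ (- alpha)) / 2 : R.
have [q2 q3] : 0 < q /\ q < 1 by rewrite /q; split; lra.
have [y0 y00 dbl] := tail_doubling_le q ltac:(rewrite /q; lra).
have tk k : tail (2 ^+ k * y0) <= q ^+ k.
  elim: k => [|k IH]; first by rewrite !expr0 tail_le1.
  rewrite exprS -mulrA (le_trans (dbl _ _)) ?exprS ?ler_pM2l//.
  by rewrite ler_peMl ?(ltW y00)// exprn_ege1//; lra.
have : (fun n => q ^+ n) @ \oo --> (0 : R) by apply: cvg_expr; rewrite gtr0_norm.
move=> /cvgr_lt /(_ 2^-1) /(_ ltac:(lra)) [N _ hN].
by exists (2 ^+ N * y0); rewrite (le_trans (tk N))// ltW// hN /=.
Qed.

Lemma slow_integrand_integrable a b : 1 <= a ->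
  (@lebesgue_measure R).-integrable `[a, b] (EFin \o (fun u => l u / u)).
Proof.
move=> a1; have [cl _ _ _] := slowX.
apply: continuous_compact_integrable; first exact: segment_compact.
have c1 : {within `[a, b], continuous l}.
  apply: continuous_subspaceW cl => u /=; rewrite !in_itv /= andbT => /andP[au _]; lra.
have c2 : {within `[a, b], continuous (fun u : R => u^-1)}.
  apply: continuous_in_subspaceT => u; rewrite inE /= in_itv /= => /andP[au _].
  by apply: inv_continuous; rewrite gt_eqF//; lra.
by move=> x; apply: cvgM; [exact: c1|exact: c2].
Qed.

Definition slow_integral x := \int[lebesgue_measure]_(u in `[1, 1 + x]) (l u / u).

(** One dyadic increment of the integral of l(u)/u is comparable with l, hence
with y^2 tail(y), which is also the size of the increment of the truncated
second moment. *)
Lemma slow_integral_increment : alpha = 2 -> exists y0 c C : R,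
  [/\ 0 < y0, 0 < c, 0 < C & forall y, y0 <= y ->
    c * (y ^+ 2 * tail y) <= slow_integral (2 * y) - slow_integral y /\
    slow_integral (2 * y) - slow_integral y <= C * (y ^+ 2 * tail y)].
Proof.
move=> alpha2; have [y1 y11 equiv] := slow_part_equiv.
have h4 : 2 `^ (- alpha) = 4^-1 :> R.
  by rewrite alpha2 powRN powR_mulrn//; congr (_^-1); ring.
have [y2 y20 dbl] := tail_doubling_ge 8^-1 ltac:(rewrite h4; lra).
exists (y1 + y2), (128^-1), 8; split; try lra.
move=> y hy; have y0 : 0 < y by lra.
have t0 := tail_ge0 (P := P) (X := X) y.
have itv := slow_integrand_integrable 1 (1 + 2 * y) (lexx 1).
have incr : slow_integral (2 * y) - slow_integral y =
    \int[lebesgue_measure]_(u in `]1 + y, 1 + 2 * y]) (l u / u).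
  by rewrite /slow_integral Rintegral_itvB//= bnd_simp; lra.
have iI : (@lebesgue_measure R).-integrable `]1 + y, 1 + 2 * y]
    (EFin \o (fun u => l u / u)).
  apply: integrableS itv => //; apply: subset_itv; rewrite bnd_simp//; lra.
have len (c : R) : \int[lebesgue_measure]_(u in `]1 + y, 1 + 2 * y]) c = y * c.
  rewrite Rintegral_cst//= lebesgue_measure_itv /= lte_fin ifT; last lra.
  by rewrite -EFinB /= mulrC; congr (_ * _); lra.
have icst (c : R) : (@lebesgue_measure R).-integrable `]1 + y, 1 + 2 * y]
    (EFin \o (fun=> c)).
  apply: measurable_bounded_integrable => //.
    by rewrite /= lebesgue_measure_itv /= lte_fin; case: ifP; rewrite ltry.
  by exists `|c|; split=> [|M cM u _]; [exact: num_real|exact: ltW].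
have range u : `]1 + y, 1 + 2 * y]%classic u ->
    [/\ y <= u, u <= 4 * y, 0 < u & l u / u <= 2 * (u * tail u) /\
      u * tail u / 2 <= l u / u].
  rewrite /= in_itv /= => /andP[u1 u2]; have u0 : 0 < u by lra.
  have [e1 e2] := equiv u ltac:(lra).
  rewrite alpha2 powR_mulrn in e1 e2; try exact: ltW.
  split; try lra; split.
    rewrite ler_pdivrMr//; lra.
  rewrite ler_pdivlMr//; lra.
rewrite incr; split.
  have -> : 128^-1 * (y ^+ 2 * tail y) = y * (y * tail y / 128) by field.
  rewrite -len; apply: le_Rintegral => // u /range [yu u4 u0 [_ e2]].
  apply: le_trans e2.
  have d1 := dbl y ltac:(lra); have d2 := dbl (2 * y) ltac:(lra).
  have d3 : tail (4 * y) <= tail u by exact: tail_noninc.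
  have e4 : 2 * (2 * y) = 4 * y by ring.
  rewrite e4 in d2.
  have d5 : tail y / 64 <= tail u by lra.
  have d6 : y * (tail y / 64) <= u * tail u.
    by rewrite ler_pM// ?(ltW y0)// divr_ge0.
  lra.
have -> : 8 * (y ^+ 2 * tail y) = y * (8 * (y * tail y)) by ring.
rewrite -len; apply: le_Rintegral => // u /range [yu u4 u0 [e1 _]].
apply: (le_trans e1).
have d3 : tail u <= tail y by exact: tail_noninc.
have d6 : u * tail u <= (4 * y) * tail y.
  by rewrite ler_pM// ?(ltW u0)// tail_ge0.
lra.
Qed.

Lemma slow_integral_ge0 x : 0 <= slow_integral x.
Proof.
have [_ lpos _ _] := slowX.
apply: Rintegral_ge0 => u /=; rewrite in_itv /= => /andP[u1 _].
by rewrite divr_ge0 ?ltW// ?lpos; lra.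
Qed.

Lemma slow_integral_homo x y : x <= y -> slow_integral x <= slow_integral y.
Proof.
move=> xy; have [_ lpos _ _] := slowX.
have itv := slow_integrand_integrable 1 (1 + y) (lexx 1).
have [x0|x0] := leP 0 x; last first.
  rewrite {1}/slow_integral set_itv_ge ?Rintegral_set0 ?slow_integral_ge0//.
  by rewrite bnd_simp -ltNge; lra.
rewrite -subr_ge0 /slow_integral Rintegral_itvB//=; try by rewrite bnd_simp; lra.
apply: Rintegral_ge0 => u /=; rewrite in_itv /= => /andP[u1 _].
by rewrite divr_ge0 ?ltW// ?lpos; lra.
Qed.

Lemma tilde_lt2 x : alpha < 2 -> L x = l x.
Proof. by move=> a2; rewrite /tilde a2. Qed.

Lemma tilde_eq2 x : alpha = 2 -> L x = 1 + slow_integral x.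
Proof. by move=> a2; rewrite /tilde a2 ltxx. Qed.

(** For alpha < 2 the truncated moment is carried by the last dyadic shell.  For
alpha = 2 all shells contribute, each as much as it does to the integral that
defines L. *)
Lemma rate_equiv : exists c C y0 : R, [/\ 0 < c, 0 < C, 0 < y0 & forall y, y0 <= y ->
  c * (L y / y `^ alpha) <= V y /\ V y <= C * (L y / y `^ alpha)].
Proof.
have [_ lpos _ _] := slowX; have [y1 y11 equiv] := slow_part_equiv.
have [a2|a2] := ltP alpha 2.
  have h4 : 2 `^ (- 2) = 4^-1 :> R by rewrite powRN powR_mulrn//; congr (_^-1); ring.
  have q4 : 4^-1 < 2 `^ (- alpha) :> R by rewrite -h4; exact: powR2N_lt.
  have [y2 y20 dbl] := tail_doubling_ge ((4^-1 + 2 `^ (- alpha)) / 2) ltac:(lra).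
  have q4' : 4^-1 < (4^-1 + 2 `^ (- alpha)) / 2 by lra.
  have [C C0 hC] := tail_rate_le_tail tail_gt0 y20 q4' dbl.
  exists (2^-1), (2 * C), (y1 + y2); split; try lra.
  move=> y hy; have y0 : 0 < y by lra.
  have [e1 e2] := equiv y ltac:(lra); rewrite tilde_lt2//.
  have ya : 0 < y `^ alpha by exact: powR_gt0.
  have w1 : l y / y `^ alpha <= 2 * tail y.
    by rewrite ler_pdivrMr//; lra.
  have w2 : tail y <= 2 * (l y / y `^ alpha).
    by rewrite mulrA ler_pdivlMr//; lra.
  have := tail_le_rate (P := P) (X := X) y y0; have := hC y ltac:(lra).
  move=> v1 v2; split; first lra.
  by rewrite (le_trans v1)// [2 * C]mulrC -mulrA ler_pM2l.
have {}a2 : alpha = 2 by apply/eqP; rewrite eq_le alpha_le2.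
have h4 : 2 `^ (- alpha) = 4^-1 :> R.
  by rewrite a2 powRN powR_mulrn//; congr (_^-1); ring.
have [y3 y30 dbl] := tail_doubling_ge 8^-1 ltac:(rewrite h4; lra).
have [y2 [c [C [y20 c0 C0 incr]]]] := slow_integral_increment a2.
pose y0 := y1 + y2 + y3; have y00 : 0 < y0 by rewrite /y0; lra.
have L1 x : 1 <= L x by rewrite tilde_eq2// lerDl slow_integral_ge0.
have Lh x y : x <= y -> L x <= L y by move=> xy; rewrite !tilde_eq2// lerD2l slow_integral_homo.
have Phi0 y : 0 < y -> 0 < Phi y.
  move=> y_gt0; rewrite (lt_le_trans _ (sqr_tail_le (P := P) (X := X) y y_gt0))//.
  by rewrite mulr_gt0 ?exprn_gt0 ?tail_gt0.
have LPhi : exists2 K, 0 < K & forall y, y0 <= y -> L y <= K * Phi y.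
  apply: (@dominated_by_increments R L Phi (C * 8 / 3) (L (2 * y0) / Phi y0)) => // y.
  - by move=> yy0; apply/ltW/Phi0; lra.
  - by move=> yy0; apply: truncated_moment_homo; lra.
  - move=> yy0; have [_ i2] := incr y ltac:(rewrite /y0 in yy0; lra).
    have db := dbl y ltac:(rewrite /y0 in yy0; lra).
    have g := truncated_moment_double_ge (P := P) (X := X) y ltac:(lra).
    rewrite !tilde_eq2//.
    have d2 : y ^+ 2 * tail y <= 8 * (y ^+ 2 * tail (2 * y)).
      by rewrite mulrCA ler_wpM2l ?sqr_ge0//; lra.
    have d3 : y ^+ 2 * tail y <= 8 / 3 * (Phi (2 * y) - Phi y) by lra.
    have := ler_wpM2l (ltW C0) d3; lra.
  - move=> /andP[b1 b2]; rewrite mulrAC ler_pdivlMr ?Phi0//.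
    apply: ler_pM; [by rewrite (le_trans _ (L1 _))|exact/ltW/Phi0|exact: Lh|].
    by apply: truncated_moment_homo; lra.
have PhiL : exists2 K, 0 < K & forall y, y0 <= y -> Phi y <= K * L y.
  apply: (@dominated_by_increments R Phi L (3 / c) (Phi (2 * y0))) => // y.
  - by move=> yy0; rewrite (le_trans _ (L1 _)).
  - by move=> yy0; apply: Lh; lra.
  - move=> yy0; have [i1 _] := incr y ltac:(rewrite /y0 in yy0; lra).
    have g := truncated_moment_double_le (P := P) (X := X) y ltac:(lra).
    by rewrite !tilde_eq2// [leRHS]mulrAC ler_pdivlMr//; nra.
  - move=> /andP[b1 b2].
    have p1 : Phi y <= Phi (2 * y0) by apply: truncated_moment_homo; lra.
    have p2 : 0 <= Phi (2 * y0) by exact: truncated_moment_ge0.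
    by rewrite (le_trans p1)// ler_peMr.
have [K1 K10 h1] := LPhi; have [K2 K20 h2] := PhiL.
exists K1^-1, K2, y0; split=> //; first by rewrite invr_gt0.
move=> y yy0; have y_gt0 : 0 < y by lra.
rewrite a2 powR_mulrn ?(ltW y_gt0)// -a2; split.
  by rewrite mulrA ler_pM2r ?invr_gt0 ?exprn_gt0// ler_pdivrMl// h1.
by rewrite mulrA ler_pM2r ?invr_gt0 ?exprn_gt0// h2.
Qed.

Lemma tilde_gt0 x : 0 <= x -> 0 < L x.
Proof.
have [_ lpos _ _] := slowX => x0; have [a2|a2] := ltP alpha 2.
  by rewrite tilde_lt2// lpos.
rewrite tilde_eq2; last by apply/eqP; rewrite eq_le alpha_le2.
by have := slow_integral_ge0 x; lra.
Qed.

Lemma tilde_lower K : 0 <= K -> exists2 w, 0 < w & forall x, 0 <= x <= K -> w <= L x.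
Proof.
have [cl lpos _ _] := slowX => K0; have [a2|a2] := ltP alpha 2.
  have cK : {within `[0, K], continuous l}.
    by apply: continuous_subspaceW cl => u /=; rewrite !in_itv /= andbT => /andP[].
  have [x0 x0K min] := EVT_min K0 cK.
  exists (l x0); first by apply: lpos; move: x0K; rewrite in_itv /= => /andP[].
  by move=> x xK; rewrite tilde_lt2//; apply: min; rewrite in_itv.
exists 1 => // x _; rewrite tilde_eq2; last by apply/eqP; rewrite eq_le alpha_le2.
by rewrite lerDl slow_integral_ge0.
Qed.

(** The scale a_n tends to infinity, since L(y)/y^alpha is bounded below on
bounded sets, and then n V(a_n) stays bounded away from 0. *)
Lemma scale_large (a : nat -> R) : (forall n, (1 <= n)%N -> 0 < a n) ->
  n%:R * L (a n) / a n `^ alpha @[n --> \oo] --> (1 : R) ->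
  exists2 c2, 0 < c2 & exists n0, forall n, (n0 <= n)%N -> 1 <= a n /\ c2 <= n%:R * V (a n).
Proof.
move=> a0 lim; have [c [C [y0 [c0 C0 y00 equiv]]]] := rate_equiv.
pose K := 1 + y0; have K0 : 0 < K by rewrite /K; lra.
have [w w0 wL] := tilde_lower K (ltW K0).
have Ka : 0 < K `^ alpha by exact: powR_gt0.
have /cvgr_lt /(_ 2) /(_ ltac:(lra)) [N1 _ hN1] := lim.
have /cvgr_gt /(_ 2^-1) /(_ ltac:(lra)) [N2 _ hN2] := lim.
exists (c / 2); first by rewrite divr_gt0.
exists (maxn (maxn N1 N2) (Num.truncn (2 * K `^ alpha / w)).+1) => n.
rewrite !geq_max => /andP[/andP[n1 n2] n3].
have n_gt0 : (0 < n)%N by exact: leq_ltn_trans n3.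
have nR : (0 : R) < n%:R by rewrite ltr0n.
have an := a0 n n_gt0.
have b1 := hN1 n n1; have b2 := hN2 n n2; rewrite /= in b1 b2.
have aK : K < a n.
  rewrite ltNge; apply/negP => aK.
  have n3' : 2 * K `^ alpha / w < n%:R.
    by rewrite (lt_le_trans (truncnS_gt _))// ler_nat.
  rewrite ltr_pdivrMr// in n3'.
  have aa : a n `^ alpha <= K `^ alpha.
    by rewrite ge0_ler_powR ?nnegrE ?(ltW alpha_pos)// ltW.
  have aa0 : 0 < a n `^ alpha by exact: powR_gt0.
  have wl := wL (a n) ltac:(by rewrite (ltW an)).
  rewrite ltr_pdivrMr// in b1.
  have := ler_wpM2l (ltW nR) wl; lra.
split; first by rewrite /K in aK; lra.
have [v1 _] := equiv (a n) ltac:(rewrite /K in aK; lra).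
have := ler_wpM2l (ltW nR) v1; have := ler_wpM2l (ltW c0) (ltW b2); lra.
Qed.

End RateEquivalence.

(** * Local large deviations *)

Section LocalLargeDeviations.
Context {disp : measure_display} {T : measurableType disp} {R : realType}
  {d : nat} {P : probability T R} {X : {RV P >-> borel_rV R d}}
  {Y : nat -> {RV P >-> borel_rV R d}} {alpha : R} {l : R -> R}.
Hypothesis d_gt0 : (1 <= d)%N.
Hypothesis alphaE : 0 < alpha < 1 \/ 1 < alpha <= 2.
Hypothesis copiesY : independent_copies P X Y.
Hypothesis slowX : tail_slow_part P X alpha l.
Hypothesis doublingX : tail_prob P X (2 * t) / tail_prob P X t @[t --> +oo] --> 2 `^ (- alpha).
Implicit Types (x v : 'rV[R]_d) (y h : R).

Local Notation tail := (tail_prob P X).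
Local Notation V := (tail_rate (P := P) (X := X)).
Local Notation L := (tilde alpha l).

Lemma alpha_gt0 : 0 < alpha.
Proof. by case: alphaE => /andP[]; lra. Qed.

Lemma alpha_le2 : alpha <= 2.
Proof. by case: alphaE => /andP[]; lra. Qed.

Lemma tail_rate_gt0 y : 0 < y -> 0 < V y.
Proof.
move=> y0; exact: lt_le_trans (tail_gt0 slowX y) (tail_le_rate y y0).
Qed.

Lemma tail_rate_potter : exists (p : nat) (K y0 : R), [/\ 0 < K, 0 < y0 &
  forall z y, y0 <= z -> z <= y -> V y ^+ p.+1 <= K * (z / y) ^+ (2 * d) * V z ^+ p.+1].
Proof.
have a0 := alpha_gt0.
have p1 := powR2N_lt1 a0.
have p4 : 0 < 2 `^ (- alpha) :> R by exact: powR_gt0.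
pose q : R := (1 + 2 `^ (- alpha)) / 2.
have [q1 q2] : 4^-1 < q /\ q < 1 by rewrite /q; split; lra.
have [y0 y00 dbl] := tail_doubling_le slowX doublingX q ltac:(rewrite /q; lra).
have [C C0 growth] := second_moment_growth y00 q1
  (fun y => truncated_moment_double_le (P := P) (X := X) y)
  (fun y _ => tail_ge0 y) (fun y => sqr_tail_le y) dbl.
have VC k y : y0 <= y -> V (2 ^+ k * y) <= C * q ^+ k * V y.
  move=> yy0; have y_gt0 : 0 < y by lra.
  have := growth k y yy0; rewrite /tail_rate => g.
  rewrite exprMn ler_pdivrMr ?mulr_gt0 ?exprn_gt0//.
  apply: (le_trans g); rewrite le_eqVlt; apply/orP; left; apply/eqP.
  have -> : (2 ^+ k) ^+ 2 = 4 ^+ k :> R by rewrite -exprM mulnC exprM; congr (_ ^+ k); ring.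
  by rewrite exprMn; field; rewrite gt_eqF.
have [|||p [K K0 hK]] := potter_power (2 * d) y00 C0 _ _ _ VC; last by exists p, K, y0.
- lra.
- by move=> y _; exact: tail_rate_ge0.
- exact: tail_rate_noninc.
Qed.

(** The range of alpha decides between the two estimates: the first moment is
carried by the last dyadic shell for alpha < 1, and by the first one, so that X
is integrable and can be centered, for alpha > 1. *)
Lemma sum_tail : exists C y0 : R, [/\ 0 < C, 0 < y0 &
  forall (r : seq nat) y, uniq r -> y0 <= y ->
    fine (P [set w | y <= enorm (list_sum (Y := Y) r w - centering P X alpha (size r))])
    <= C * ((size r)%:R * V y)].
Proof.
case: alphaE => /andP[a0 a1].
  have h2 : 2^-1 < 2 `^ (- alpha) :> R by rewrite -(powR_inv1 (_ : 0 <= 2))//; exact: powR2N_lt.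
  have [y0 y00 dbl] := tail_doubling_ge slowX doublingX ((2^-1 + 2 `^ (- alpha)) / 2) ltac:(lra).
  have q2 : 2^-1 < (2^-1 + 2 `^ (- alpha)) / 2 by lra.
  have [C C0 hC] := capped_mean_slow (tail_gt0 slowX) y00 q2 dbl.
  exists C, y0; split=> // r y ur yy0.
  have := sum_tail_uncentered copiesY y00 hC r y yy0.
  by rewrite /centering a1; under eq_set do rewrite -[list_sum _ _]subr0.
have h2 : 2 `^ (- alpha) < 2^-1 :> R by rewrite -(powR_inv1 (_ : 0 <= 2))//; exact: powR2N_lt.
have p0 : 0 < 2 `^ (- alpha) :> R by exact: powR_gt0.
have [y0 y00 dbl] := tail_doubling_le slowX doublingX ((2^-1 + 2 `^ (- alpha)) / 2) ltac:(lra).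
have q0 : 0 < (2^-1 + 2 `^ (- alpha)) / 2 by lra.
have q2 : (2^-1 + 2 `^ (- alpha)) / 2 < 2^-1 by lra.
have [Cc Cc0 hC] := mean_truncation_error y00 q0 q2 dbl.
have [C C0 tailC] := sum_tail_centered copiesY d_gt0 (ltW Cc0) y00 hC.
exists C, y0; split=> // r y ur yy0.
by rewrite /centering ltNge (ltW a0) /=; exact: tailC.
Qed.

Lemma centeringD m n : centering P X alpha (m + n) =
  centering P X alpha m + centering P X alpha n.
Proof. by rewrite /centering; case: ifP => _; rewrite ?addr0// natrD scalerDl. Qed.

Lemma cube_enorm_ge h x z : cube h x z -> enorm x - d%:R * h <= enorm z.
Proof.
move=> xz; have e : x = z + (x - z) by rewrite addrC subrK.
have h1 : enorm (x - z) <= d%:R * h.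
  rewrite (le_trans (enorm_le_sum _))//.
  apply: (@le_trans _ _ (\sum_(j < d) h)).
    apply: ler_sum => j _; have /andP[z1 z2] := xz j.
    by rewrite !mxE ler_norml; apply/andP; split; lra.
  by rewrite sumr_const card_ord -[leLHS]mulr_natl.
by have := enormD z (x - z); rewrite -e; lra.
Qed.

(** The concentration bound for all n at once: finitely many n are absorbed in
the constant. *)
Lemma uniform_concentration (a : nat -> R) h :
  0 < h -> (forall n, (1 <= n)%N -> 0 < a n) ->
  n%:R * L (a n) / a n `^ alpha @[n --> \oo] --> (1 : R) ->
  (exists c delta : R, [/\ 0 < c, 0 < delta & forall t, 0 < enorm t -> enorm t <= delta ->
    c * V (enorm t)^-1 <= 1 - sqr_chf (X := X) t]) ->
  exists2 C, 0 < C & forall n (s : {fset nat}) (q r : seq nat) x v (B : set T),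
    (1 <= n)%N -> ((2 <= n)%N -> (n <= 3 * size r)%N) ->
    uniq r -> {in r, forall i, i \notin s} -> {subset q <= s} ->
    @measurable _ (coordinate_algebra P Y s) B ->
    fine (P (B `&` [set w | cube h x (list_sum (Y := Y) q w + list_sum (Y := Y) r w - v)]))
    <= C / a n ^+ d * fine (P B).
Proof.
move=> h0 a0 lima [c [delta [c0 delta0 lower]]].
have [p [K [y1 [K0 y10 potter]]]] := tail_rate_potter.
have [c2 c20 [n0 an]] := scale_large alpha_gt0 alpha_le2 slowX doublingX a a0 lima.
have [C1 C10 conc] := concentration_bound copiesY c0 delta0 y10 K0 c20 h0 lower
  tail_rate_gt0 potter an.
pose n1 := maxn n0 2; pose A := \sum_(i < n1.+1) `|a i| ^+ d.
have A_ge n : (n <= n1)%N -> `|a n| ^+ d <= A.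
  move=> nn1; rewrite /A (bigD1 (Ordinal (nn1 : (n < n1.+1)%N)))//= lerDl.
  by apply: sumr_ge0 => i _; rewrite exprn_ge0.
have A0 : 0 <= A by apply: sumr_ge0 => i _; rewrite exprn_ge0.
exists (C1 + A) => [|n s q r x v B n_gt0 nr ur rs qs mB]; first exact: ltr_wpDr.
have ad0 : 0 < a n ^+ d by rewrite exprn_gt0// a0.
have PB := fineP_ge0 P B.
have [nn1|n1n] := leqP n1 n.
  have nn0 : (n0 <= n)%N by rewrite (leq_trans _ nn1)// leq_maxl.
  have n2 : (2 <= n)%N by rewrite (leq_trans _ nn1)// leq_maxr.
  rewrite (le_trans (conc n s q r x v B nn0 (nr n2) ur rs qs mB))//.
  by rewrite ler_wpM2r// ler_wpM2r ?invr_ge0 ?(ltW ad0)// lerDl.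
have mBT : measurable B by exact: coordinate_subalgebra mB.
apply: (@le_trans _ _ (fine (P B))).
  apply: fineP_le => //.
  by apply: measurableI => //; exact: measurable_list_sum_cube.
have Aa := A_ge n (ltnW n1n); rewrite gtr0_norm ?a0// in Aa.
by rewrite ler_peMl// ler_pdivlMr// mul1r (le_trans Aa)// lerDr ltW.
Qed.

Lemma half_size n : (2 <= n)%N -> (n <= 3 * n./2)%N /\ (n <= 3 * (n - n./2))%N.
Proof.
by move=> n2; have := odd_double_half n; rewrite -addnn; move: (n./2) (odd n) => m [] /=; lia.
Qed.

Lemma quarter_arith {X0 dh S s1 s2 y : R} : X0 - dh <= S -> s1 < y -> s2 < y ->
  S <= s1 + s2 -> 2 * dh <= X0 -> 4 * y = X0 -> False.
Proof. lra. Qed.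

(** A large value of the whole sum forces a large value of one of its halves,
and given that half the other one still spreads out at scale a_n. *)
Lemma half_split (n : nat) (Ca C2 y : R) h x :
  0 < Ca -> 2 * (d%:R * h) <= enorm x -> 4 * y = enorm x ->
  (forall (s : {fset nat}) (q r : seq nat) v (B : set T),
    ((2 <= n)%N -> (n <= 3 * size r)%N) ->
    uniq r -> {in r, forall i, i \notin s} -> {subset q <= s} ->
    @measurable _ (coordinate_algebra P Y s) B ->
    fine (P (B `&` [set w | cube h x (list_sum (Y := Y) q w + list_sum (Y := Y) r w - v)]))
    <= Ca * fine (P B)) ->
  (forall r : seq nat, uniq r ->
    fine (P [set w | y <= enorm (list_sum (Y := Y) r w - centering P X alpha (size r))])
    <= C2 * ((size r)%:R * V y)) ->
  fine (P [set w | cube h x (partial_sum P Y n w - centering P X alpha n)])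
  <= Ca * (C2 * (n%:R * V y)).
Proof.
move=> Ca0 hx y4 conc tailS.
pose m := n./2; pose q := iota 0 m; pose r := iota m (n - m).
have mn : (m <= n)%N by rewrite -[n]odd_double_half /m -addnn addnA leq_addl.
have sizeq : size q = m by rewrite size_iota.
have sizer : size r = (n - m)%N by rewrite size_iota.
have bn : centering P X alpha n = centering P X alpha m + centering P X alpha (n - m).
  by rewrite -centeringD subnKC.
have sumE w' : partial_sum P Y n w' = list_sum (Y := Y) q w' + list_sum (Y := Y) r w'.
  rewrite /partial_sum /list_sum -big_cat /q /r /= -{2}[m]add0n -iotaD subnKC//.
  by rewrite -[n in iota 0 n]subn0 -/(index_iota 0 n) big_mkord.
under eq_set do rewrite sumE.
set b := centering P X alpha n in bn *; set D := [set w | _].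
have mD : measurable D by exact: measurable_list_sum_cube.
pose B1 := [set w | y <= enorm (list_sum (Y := Y) q w - centering P X alpha m)].
pose B2 := [set w | y <= enorm (list_sum (Y := Y) r w - centering P X alpha (n - m))].
have mB1 : measurable B1 by exact: measurable_list_sum_ge.
have mB2 : measurable B2 by exact: measurable_list_sum_ge.
have cover : D `<=` (B1 `&` D) `|` (B2 `&` D).
  move=> w' Dw; have big := cube_enorm_ge h x _ Dw.
  have [h1|h1] := leP y (enorm (list_sum (Y := Y) q w' - centering P X alpha m)); first by left.
  right; split=> //; rewrite /B2 /= leNgt; apply/negP => h2.
  have := enormD (list_sum (Y := Y) q w' - centering P X alpha m)
    (list_sum (Y := Y) r w' - centering P X alpha (n - m)).
  by rewrite addrACA -opprD -bn => h3; exact: (quarter_arith big h1 h2 h3 hx y4).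
have split_D : fine (P D) <= fine (P (B1 `&` D)) + fine (P (B2 `&` D)).
  have m1 : measurable (B1 `&` D) by exact: measurableI.
  have m2 : measurable (B2 `&` D) by exact: measurableI.
  rewrite -lee_fin EFinD !fineK ?fin_num_measure//.
  apply: le_trans (measureU2 P m1 m2).
  by apply: le_measure; rewrite ?inE//; exact: measurableU.
have disj i : i \in q -> i \in r -> False.
  by rewrite !mem_iota => /andP[_ i1] /andP[i2 _]; move: i1; rewrite add0n ltnNge i2.
have half1 : fine (P (B1 `&` D)) <= Ca * fine (P B1).
  apply: (conc [fset i in q]%fset q r b B1).
  - by move=> /half_size [_]; rewrite sizer.
  - exact: iota_uniq.
  - by move=> i ir; rewrite inE; apply/negP => iq; exact: (disj i).
  - by move=> i; rewrite inE.
  - by apply: measurable_list_sum_ge_algebra => i; rewrite inE.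
have half2 : fine (P (B2 `&` D)) <= Ca * fine (P B2).
  have -> : D = [set w' | cube h x (list_sum (Y := Y) r w' + list_sum (Y := Y) q w' - b)].
    by apply: eq_set => w'; rewrite [list_sum (Y := Y) r w' + _]addrC.
  apply: (conc [fset i in r]%fset r q b B2).
  - by move=> /half_size [+ _]; rewrite sizeq.
  - exact: iota_uniq.
  - by move=> i iq; rewrite inE; apply/negP => ir; exact: (disj i).
  - by move=> i; rewrite inE.
  - by apply: measurable_list_sum_ge_algebra => i; rewrite inE.
have tail1 : fine (P B1) <= C2 * (m%:R * V y).
  by have := tailS q (iota_uniq _ _); rewrite sizeq.
have tail2 : fine (P B2) <= C2 * ((n - m)%:R * V y).
  by have := tailS r (iota_uniq _ _); rewrite sizer.
have sum_tails : fine (P B1) + fine (P B2) <= C2 * (n%:R * V y).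
  have -> : n%:R = m%:R + (n - m)%:R :> R by rewrite -natrD subnKC.
  by rewrite mulrDl mulrDr; exact: lerD.
apply: (le_trans split_D); apply: (le_trans (lerD half1 half2)).
by rewrite -mulrDr ler_pM2l.
Qed.

Lemma near_arith (Cs ad n w Lx X0 Xa : R) : 0 < Cs -> 0 < ad -> 1 <= n -> 0 < w ->
  w <= Lx -> 0 <= Xa -> Xa <= X0 ->
  Cs / ad <= Cs * (1 + X0) / w * (n / ad) * (Lx / (1 + Xa)).
Proof.
move=> Cs0 ad0 n1 w0 wL Xa0 XaX.
have h1 : 1 <= Lx / w by rewrite ler_pdivlMr// mul1r.
have h2 : 1 <= (1 + X0) / (1 + Xa) by rewrite ler_pdivlMr; lra.
have h3 : 1 + Xa != 0 by rewrite gt_eqF//; lra.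
have -> : Cs * (1 + X0) / w * (n / ad) * (Lx / (1 + Xa)) =
    Cs / ad * (n * (Lx / w * ((1 + X0) / (1 + Xa)))).
  by field; rewrite h3 !gt_eqF.
have Ca : 0 < Cs / ad by rewrite divr_gt0.
have h4 : 1 <= Lx / w * ((1 + X0) / (1 + Xa)) by rewrite mulr_ege1.
by rewrite ler_pMr// mulr_ege1.
Qed.

Lemma far_arith (CV Lx Xa : R) : 0 < CV -> 0 < Lx -> 1 <= Xa ->
  CV * (Lx / Xa) <= 2 * CV * (Lx / (1 + Xa)).
Proof.
move=> CV0 L0 Xa1; rewrite [2 * CV]mulrC -mulrA ler_pM2l//.
rewrite mulrCA ler_pM2l// ler_pdivlMr; last lra.
by rewrite mulrC ler_pdivrMr; lra.
Qed.

Lemma local_large_deviation (a : nat -> R) h :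
  0 < h -> (forall n, (1 <= n)%N -> 0 < a n) ->
  n%:R * L (a n) / a n `^ alpha @[n --> \oo] --> (1 : R) ->
  (exists c delta : R, [/\ 0 < c, 0 < delta & forall t, 0 < enorm t -> enorm t <= delta ->
    c * V (enorm t)^-1 <= 1 - sqr_chf (X := X) t]) ->
  exists2 C, 0 < C & forall (n : nat) x, (1 <= n)%N ->
    (P [set w | cube h x (partial_sum P Y n w - centering P X alpha n)%R]
     <= (C * (n%:R / a n ^+ d) * (L (enorm x) / (1 + enorm x `^ alpha)))%:E)%E.
Proof.
move=> h0 a0 lima lower.
have [Cs Cs0 conc] := uniform_concentration a h h0 a0 lima lower.
have [C2 [y2 [C20 y20 tailS]]] := sum_tail.
have [cV [CV [y3 [cV0 CV0 y30 equiv]]]] := rate_equiv alpha_le2 slowX doublingX.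
have dh0 : 0 <= d%:R * h by rewrite mulr_ge0// ltW.
have [x0 [x00 x01 x02 x03 x04]] : exists x0 : R,
    [/\ 0 < x0, 1 <= x0, 4 * y2 <= x0, y3 <= x0 & 2 * (d%:R * h) <= x0].
  by exists (1 + 4 * y2 + y3 + 2 * (d%:R * h)); split; lra.
have [w w0 wL] := tilde_lower alpha_le2 slowX x0 (ltW x00).
pose near_const := Cs * (1 + x0 `^ alpha) / w.
pose far_const := Cs * (C2 * (16 * (2 * CV))).
have near0 : 0 < near_const.
  by rewrite divr_gt0// mulr_gt0// ltr_wpDr// powR_ge0.
have far0 : 0 < far_const.
  by rewrite mulr_gt0// mulr_gt0// mulr_gt0// mulr_gt0.
exists (near_const + far_const) => [|n x n_gt0]; first exact: addr_gt0.
have an0 := a0 n n_gt0; have ad0 : 0 < a n ^+ d by rewrite exprn_gt0.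
have nR : 1 <= n%:R :> R by rewrite ler1n.
have e0 := enorm_ge0 x; have ea0 : 0 <= enorm x `^ alpha by exact: powR_ge0.
have Lx := tilde_gt0 alpha_le2 slowX (enorm x) e0.
have F0 : 0 < L (enorm x) / (1 + enorm x `^ alpha) by rewrite divr_gt0// ltr_wpDr.
have na0 : 0 < n%:R / a n ^+ d by rewrite divr_gt0// (lt_le_trans ltr01).
have nF0 := mulr_gt0 na0 F0.
pose D := [set w | cube h x (partial_sum P Y n w - centering P X alpha n)].
have DE : D = [set w' | cube h x (list_sum (Y := Y) [::] w' + list_sum (Y := Y) (iota 0 n) w'
    - centering P X alpha n)].
  apply: eq_set => w'; rewrite [list_sum [::] w']big_nil add0r /partial_sum /list_sum.
  by rewrite -[n in iota 0 n]subn0 -/(index_iota 0 n) big_mkord.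
have mD : measurable D by rewrite DE; exact: measurable_list_sum_cube.
rewrite -/D -(fineK (fin_num_measure P D mD)) lee_fin -mulrA mulrDl.
have [xlarge|xsmall] := leP x0 (enorm x); last first.
  apply: (@le_trans _ _ (near_const * (n%:R / a n ^+ d * (L (enorm x) / (1 + enorm x `^ alpha))))); last first.
    by rewrite lerDl ltW// mulr_gt0.
  apply: (@le_trans _ _ (Cs / a n ^+ d)).
    have := conc n fset0 [::] (iota 0 n) x (centering P X alpha n) setT n_gt0.
    rewrite setTI -DE probability_setT /= mulr1; apply => //.
      by rewrite size_iota leq_pmull.
    exact: iota_uniq.
  rewrite mulrA; apply: near_arith => //.
    by apply: wL; rewrite e0 ltW.
  by rewrite ge0_ler_powR ?nnegrE ?(ltW alpha_gt0)// ltW.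
apply: (@le_trans _ _ (far_const * (n%:R / a n ^+ d * (L (enorm x) / (1 + enorm x `^ alpha))))); last first.
  by rewrite lerDr ltW// mulr_gt0.
pose y := enorm x / 4.
have y4 : 4 * y = enorm x by rewrite /y mulrC divfK.
have yy2 : y2 <= y by rewrite -(ler_pM2l (_ : 0 < 4))// y4 (le_trans x02).
have hx : 2 * (d%:R * h) <= enorm x by exact: le_trans xlarge.
have Ca0 : 0 < Cs / a n ^+ d by rewrite divr_gt0.
apply: (le_trans (half_split n (Cs / a n ^+ d) C2 y h x Ca0 hx y4 _ _)).
- by move=> s q r v B; exact: conc.
- by move=> r ur; exact: tailS.
have Vy : V y <= 16 * V (enorm x).
  have -> : 16 = 4 ^+ 2 :> R by ring.
  by apply: tail_rate_scale; [exact: lt_le_trans xlarge|rewrite ler1n].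
have [_ Vx] := equiv (enorm x) (le_trans x03 xlarge).
have x1 : 1 <= enorm x `^ alpha.
  have p1 : 1 `^ alpha = 1 :> R by rewrite powR1.
  by rewrite -[leLHS]p1 ge0_ler_powR ?nnegrE ?(ltW alpha_gt0)// (le_trans x01).
have Vfar : V y <= 16 * (2 * CV * (L (enorm x) / (1 + enorm x `^ alpha))).
  rewrite (le_trans Vy)// ler_pM2l// (le_trans Vx)//; exact: far_arith.
have n0 : (0 : R) < n%:R by exact: lt_le_trans nR.
have : Cs / a n ^+ d * (C2 * (n%:R * V y)) <= Cs / a n ^+ d * (C2 * (n%:R *
    (16 * (2 * CV * (L (enorm x) / (1 + enorm x `^ alpha)))))).
  by rewrite ler_pM2l// ler_pM2l// ler_pM2l.
move=> /le_trans; apply; rewrite /far_const.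
move: (a n ^+ d)^-1 (L (enorm x) / _) => u F.
by rewrite le_eqVlt; apply/orP; left; apply/eqP; ring.
Qed.

End LocalLargeDeviations.
Theorem theorem1p6 (R : realType) (d : nat) (hd : (1 <= d)%N)
    (alpha : R) (halpha : 0 < alpha < 1 \/ 1 < alpha <= 2)
    (disp : measure_display) (T : measurableType disp) (P : probability T R)
    (X : {RV P >-> borel_rV R d})
    (hX2 : ('E_P[fun w => (enorm (X w) ^+ 2)%R] = +oo)%E)
    (sigma : probability (borel_rV R d) R)
    (hX : regularly_varying P X alpha sigma)
    (hsigma : nondegenerate_spectral alpha sigma)
    (Xs : nat -> {RV P >-> borel_rV R d})
    (hXs : independent_copies P X Xs)
    (l : R -> R) (hl : tail_slow_part P X alpha l)
    (a : nat -> R) (ha0 : forall n, (1 <= n)%N -> 0 < a n)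
    (ha : n%:R * tilde alpha l (a n) / a n `^ alpha @[n --> \oo] --> (1 : R)) :
  forall h : R, 0 < h ->
  exists2 C : R, 0 < C &
    forall (n : nat) (x : 'rV[R]_d), (1 <= n)%N ->
      (P [set w | cube h x (partial_sum P Xs n w - centering P X alpha n)%R]
       <= (C * (n%:R / a n ^+ d)
             * (tilde alpha l (enorm x) / (1 + enorm x `^ alpha)))%:E)%E.
Proof.
have alpha0 : 0 < alpha by case: halpha => /andP[]; lra.
have alpha2 : alpha <= 2 by case: halpha => /andP[]; lra.
have tpos := tail_gt0 hl.
have dbl := tail_doubling hX.
have [kappa kappa0 dir] := directional_mass_uniform alpha0 hX tpos hsigma.
have [M tM] := tail_half alpha0 hl dbl.
have [c c0 [delta delta0 lower]] := fourier_lower hXs kappa kappa M kappa0 kappa0 tpos tM dir.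
move=> h h0; apply: (local_large_deviation hd halpha hXs hl dbl a h h0 ha0 ha).
by exists c, delta.
Qed.
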